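(* Let $u_\varepsilon$ be the wavefront tracking approximate solution described in the context, with collision times $t_1<\dots<t_J$, $t_0=0$, wave sets $\mathcal W(t)$ and wave speeds $\sigma(t,s)$. Then $$\sum_{j=1}^{J}\ \sum_{s\in\mathcal W(t_j)}|\sigma(t_j,s)-\sigma(t_{j-1},s)|\,|s|\ \le\ (3+2\log 2)\,\|f''\|_{L^\infty}\,\mathrm{Tot.Var.}(\bar u)^2,$$ where $|s|:=\varepsilon$ is the strength of the wave $s$.
   Context: Standing assumptions: $f:\mathbb R\to\mathbb R$ is $C^2$ with $0<f'(u)<1$ for all $u$ and $f''$ bounded; $\bar u\in BV(\mathbb R)$; $\log$ is the natural logarithm. For continuous $g:\mathbb R\to\mathbb R$, $\mathrm{conv}_{[a,b]}g$ is the largest convex function on $[a,b]$ which is $\le g$, and $\mathrm{conc}_{[a,b]}g$ the smallest concave function on $[a,b]$ which is $\ge g$. Wavefront tracking. Fix $\varepsilon>0$; $f_\varepsilon$ is the piecewise affine function coinciding with $f$ at the points of $\varepsilon\mathbb Z$ and affine between consecutive ones. $\bar u_\varepsilon$ is a right-continuous, piecewise constant, compactly supported function with values in $\varepsilon\mathbb Z$ and $\mathrm{Tot.Var.}(\bar u_\varepsilon)\le\mathrm{Tot.Var.}(\bar u)$. $u_\varepsilon$ is the solution of $u_t+f_\varepsilon(u)_x=0$, $u(0,\cdot)=\bar u_\varepsilon$, built by solving the Riemann problem with flux $f_\varepsilon$ at each jump of $\bar u_\varepsilon$ and at each point where discontinuity lines (wavefronts) meet: a jump $[u^-,u^+]$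 with $u^-<u^+$ is resolved into the wavefronts corresponding to the maximal affine pieces of $\mathrm{conv}_{[u^-,u^+]}f_\varepsilon$, each travelling with the slope of its piece as speed; if $u^->u^+$ one uses $\mathrm{conc}_{[u^+,u^-]}f_\varepsilon$. $u_\varepsilon(t,\cdot)$ is piecewise constant, right-continuous, with values in $\varepsilon\mathbb Z$. Wavefronts meet at finitely many points $(t_j,x_j)$, $j=1,\dots,J$; it is assumed that $t_j<t_{j+1}$ and that exactly two wavefronts meet at each $(t_j,x_j)$. Put $t_0=0$. Waves. $\mathcal W:=\{1,2,\dots,\frac1\varepsilon\mathrm{Tot.Var.}(\bar u_\varepsilon)\}$, $U(x):=\mathrm{Tot.Var.}(\bar u_\varepsilon;(-\infty,x])$; initial position $\mathtt x(0,s):=\inf\{x:\varepsilon s\le U(x)\}$; sign $\mathcal S(s):=\mathrm{sign}[\bar u_\varepsilon(\mathtt x(0,s))-\bar u_\varepsilon(\mathtt x(0,s)-)]$; right state $\hat u(s):=\bar u_\varepsilon(\mathtt x(0,s)-)+\mathcal S(s)[\varepsilon s-U(\mathtt x(0,s)-)]$. The speed is $\sigma(t,s)=+\infty$ if $\mathtt x(t,s)=+\infty$; otherwise, with $x=\mathtt x(t,s)$, $u^-=u_\varepsilon(t,x-)$, $u^+=u_\varepsilon(t,x)$, $\sigma(t,s)$ is the (constant) derivative of $\mathrm{conv}_{[u^-,u^+]}f_\varepsilon$ on $(\hat u(s)-\varepsilon,\hat u(s))$ if $\mathcal S(s)=+1$, and of $\mathrm{conc}_{[u^+,u^-]}f_\varepsilon$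 on $(\hat u(s),\hat u(s)+\varepsilon)$ if $\mathcal S(s)=-1$. Positions evolve inductively: for $t\in(t_j,t_{j+1}]$ (or $t>t_J$), $\mathtt x(t,s)=\mathtt x(t_j,s)+\sigma(t_j,s)(t-t_j)$, except that at $t=t_{j+1}$ a wave $s$ arriving at $x_{j+1}$ which does not satisfy $\mathcal S(s)u_\varepsilon(t_{j+1},x_{j+1}-)\le\mathcal S(s)\hat u(s)-\varepsilon\le\mathcal S(s)\hat u(s)\le\mathcal S(s)u_\varepsilon(t_{j+1},x_{j+1})$ is removed: $\mathtt x(t,s)=+\infty$ for $t\ge t_{j+1}$. Finally $\mathcal W(t):=\{s\in\mathcal W:\mathtt x(t,s)<+\infty\}$. *)

(* Defs.v *)
(* MathComp-Analysis; [R : realType] plays the role of the real line. *)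
Set Warnings "-notation-overridden,-ambiguous-paths,-notation-incompatible-prefix,-redundant-canonical-projection".
From HB Require Import structures.
From mathcomp Require Import all_boot all_order all_algebra.
From mathcomp Require Import all_classical all_reals all_analysis.
From mathcomp Require Import lra.

Set Implicit Arguments.
Unset Strict Implicit.
Unset Printing Implicit Defensive.

Import Order.TTheory GRing.Theory Num.Theory.
Import numFieldNormedType.Exports.

Local Open Scope ring_scope.
Local Open Scope classical_set_scope.

Section functions.
Context {R : realType}.
Implicit Types (v g h f : R -> R) (a b x : R).

Definition convex_on a b h : Prop :=
  convex_function (`[a, b]%classic : set R^o) (h : R^o -> R^o).

Definition concave_on a b h : Prop := convex_on a b (\- h).

Definition convex_minorants a b g : set (R -> R) :=
  [set h | convex_on a b h /\ forall u, a <= u <= b -> h u <= g u].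

Definition concave_majorants a b g : set (R -> R) :=
  [set h | concave_on a b h /\ forall u, a <= u <= b -> g u <= h u].

(* Only the values on [a, b] are meaningful; there the pointwise supremum is the
   largest convex minorant, see [convex_env_largest] below (dually for
   [concave_env]). *)
Definition convex_env a b g : R -> R :=
  fun u => sup [set h u | h in convex_minorants a b g].

Definition concave_env a b g : R -> R :=
  fun u => inf [set h u | h in concave_majorants a b g].

Definition pw_affine_interp (eps : R) f : R -> R := fun u =>
  let k := Num.floor (u / eps) in
  let u0 := k%:~R * eps in
  let u1 := (k + 1)%:~R * eps in
  f u0 + (f u1 - f u0) / eps * (u - u0).

Definition left_lim v x : R := lim (v y @[y --> x^'-]).

(* Total variation (of the pointwise representative) on the whole line and on
   (-oo, x]. *)
Definition tot_var v : \bar R :=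
  ereal_sup [set V | exists a b, a <= b /\ V = total_variation a b v].

Definition tot_var_upto v x : \bar R :=
  ereal_sup [set V | exists2 a, a <= x & V = total_variation a x v].

Definition piecewise_constant v : Prop :=
  exists d : seq R, forall x y, x <= y ->
    (forall p, p \in d -> p < x \/ y < p) -> v x = v y.

Definition right_continuous v : Prop := forall x, v y @[y --> x^'+] --> v x.

Definition affine_on g p q (slope : R) : Prop :=
  forall u w, p <= u <= q -> p <= w <= q -> g w - g u = slope * (w - u).

Definition maximal_affine_piece a b g p q (slope : R) : Prop :=
  [/\ a <= p, p < q, q <= b, affine_on g p q slope &
      forall p' q' slope', a <= p' <= p -> q <= q' <= b ->
        affine_on g p' q' slope' -> p' = p /\ q' = q].

End functions.

Record admissible_flux (R : realType) (f : R -> R) : Prop := {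
  flux_derivable : forall u, derivable f u 1;
  flux_derivable2 : forall u, derivable f^`() u 1;
  flux_continuous2 : continuous f^`(2);
  flux_speed : forall u, 0 < f^`() u < 1;
  flux_bounded2 : exists M, forall u, `|f^`(2) u| <= M
}.

Record admissible_datum (R : realType) (eps : R) (ubar v0 : R -> R) : Prop := {
  datum_right_continuous : right_continuous v0;
  datum_piecewise_constant : piecewise_constant v0;
  datum_support : compact (closure [set x | v0 x != 0]);
  datum_grid : forall x, exists k : int, v0 x = k%:~R * eps;
  datum_tot_var : (tot_var v0 <= tot_var ubar)%E
}.

(* A wavefront is a discontinuity line issued from the space-time point
   [(wf_time, wf_origin)], separating two constant states. *)
Record wavefront (R : realType) := Wavefront {
  wf_time : R;
  wf_origin : R;
  wf_left : R;
  wf_right : R;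
  wf_speed : R
}.

HB.instance Definition _ (R : realType) := gen_eqMixin (wavefront R).

Section wavefronts.
Context {R : realType}.
Implicit Types (g v : R -> R) (phi psi chi : wavefront R).

Definition wf_pos phi (t : R) : R :=
  wf_origin phi + wf_speed phi * (t - wf_time phi).

(* [phi] is one of the wavefronts solving, for the flux [g], the Riemann problem
   with left state [ul] and right state [ur] placed at [(t, x)]; there is none
   when [ul = ur]. *)
Definition riemann_front g (t x ul ur : R) phi : Prop :=
  [/\ wf_time phi = t, wf_origin phi = x &
      (ul < ur /\ maximal_affine_piece ul ur (convex_env ul ur g)
                    (wf_left phi) (wf_right phi) (wf_speed phi)) \/
      (ur < ul /\ maximal_affine_piece ur ul (concave_env ur ul g)
                    (wf_right phi) (wf_left phi) (wf_speed phi))].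

Definition left_to_right (t : R) (F : seq (wavefront R)) : Prop :=
  sorted <%R [seq wf_pos phi t | phi <- F].

(* The right-continuous profile at time [t] of a list of wavefronts ordered from
   left to right: the right state of the last wavefront at or before [x]. The
   far-left state is 0, by compactness of the support. *)
Definition profile (F : seq (wavefront R)) (t : R) : R -> R :=
  fun x => last 0 [seq wf_right phi | phi <- F & wf_pos phi t <= x].

(* Exactly two wavefronts of [F] meet at [(t, x)], no others meet at time [t],
   and [F'] is obtained from [F] by solving the resulting Riemann problem. *)
Definition binary_collision g (t x : R) (F F' : seq (wavefront R)) : Prop :=
  exists (pre post out : seq (wavefront R)) phi psi,
    [/\ F = pre ++ phi :: psi :: post,
        wf_pos phi t = x /\ wf_pos psi t = x,
        left_to_right t (pre ++ phi :: post),
        F' = pre ++ out ++ post &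
        forall chi, chi \in out <->
          riemann_front g t x (wf_left phi) (wf_right psi) chi].

End wavefronts.

(* Wavefront tracking solution [u] for the flux [g] and datum [v0]. The collision
   points are [(tc j, xc j)] for [1 <= j <= J] ([xc 0] is unused), and [F j] lists
   from left to right the wavefronts present between [tc j] and the next collision
   time (forever if [j = J]). That [F j] stays strictly ordered on the open time
   interval means that its wavefronts do not meet there; it also fixes the order of
   wavefronts issued from one point. *)
Record wavefront_tracking (R : realType) (g v0 : R -> R) (J : nat)
    (tc xc : nat -> R) (F : nat -> seq (wavefront R)) (u : R -> R -> R) : Prop := {
  wft_tc0 : tc 0%N = 0;
  wft_tc_incr : forall j, (j < J)%N -> tc j < tc j.+1;
  wft_init : forall phi, phi \in F 0%N <->
    riemann_front g 0 (wf_origin phi) (left_lim v0 (wf_origin phi))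
      (v0 (wf_origin phi)) phi;
  wft_no_meeting : forall j t, (j <= J)%N -> tc j < t ->
    ((j < J)%N -> t < tc j.+1) -> left_to_right t (F j);
  wft_collision : forall j, (j < J)%N ->
    binary_collision g (tc j.+1) (xc j.+1) (F j) (F j.+1);
  wft_solution0 : forall x, u 0 x = v0 x;
  wft_solution : forall j t x, (j <= J)%N -> tc j <= t ->
    ((j < J)%N -> t < tc j.+1) -> u t x = profile (F j) t x
}.

Section waves.
Context {R : realType}.
Variables (eps : R) (v0 : R -> R).

(* The quotient is a natural number, as [v0] takes values in [eps]Z. *)
Definition nwaves : nat := Num.truncn (fine (tot_var v0) / eps).

Definition waves : seq nat := iota 1 nwaves.

Definition wave_U (x : R) : R := fine (tot_var_upto v0 x).

Definition wave_x0 (s : nat) : R := inf [set x | eps * s%:R <= wave_U x].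

Definition wave_sign (s : nat) : R :=
  Num.sg (v0 (wave_x0 s) - left_lim v0 (wave_x0 s)).

Definition wave_state (s : nat) : R :=
  left_lim v0 (wave_x0 s)
  + wave_sign s * (eps * s%:R - left_lim wave_U (wave_x0 s)).

(* Speed of the wave [s] placed at [x] in the profile [v]; the derivative is
   constant on the open interval whose midpoint is used. The value [-oo] of [x]
   does not occur. *)
Definition wave_speed (g v : R -> R) (x : \bar R) (s : nat) : \bar R :=
  if x is x'%:E then
    if wave_sign s == 1 then
      (derive1 (convex_env (left_lim v x') (v x') g) (wave_state s - eps / 2))%:E
    else
      (derive1 (concave_env (v x') (left_lim v x') g) (wave_state s + eps / 2))%:E
  else +oo%E.

(* The wave [s] survives at the point [x] of the profile [v]. *)
Definition wave_fits (v : R -> R) (x : R) (s : nat) : bool :=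
  [&& wave_sign s * left_lim v x <= wave_sign s * wave_state s - eps,
      wave_sign s * wave_state s - eps <= wave_sign s * wave_state s &
      wave_sign s * wave_state s <= wave_sign s * v x].

End waves.

(* [X t s] is the position at time [t] of the wave [s], +oo once removed. The speed
   [wave_speed] being +oo at +oo, removed waves stay at +oo. *)
Record wave_positions (R : realType) (eps : R) (g v0 : R -> R) (J : nat)
    (tc xc : nat -> R) (u : R -> R -> R) (X : R -> nat -> \bar R) : Prop := {
  wave_pos_init : forall s, s \in waves eps v0 -> X 0 s = (wave_x0 eps v0 s)%:E;
  wave_pos_move : forall j t s, s \in waves eps v0 -> (j <= J)%N -> tc j < t ->
    ((j < J)%N -> t < tc j.+1) ->
    X t s = (X (tc j) s
             + wave_speed eps v0 g (u (tc j)) (X (tc j) s) s * (t - tc j)%:E)%E;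
  wave_pos_collision : forall j s, s \in waves eps v0 -> (j < J)%N ->
    let y := (X (tc j) s + wave_speed eps v0 g (u (tc j)) (X (tc j) s) s
                           * (tc j.+1 - tc j)%:E)%E in
    X (tc j.+1) s =
      if (y == (xc j.+1)%:E) && ~~ wave_fits eps v0 (u (tc j.+1)) (xc j.+1) s
      then +oo%E else y
}.

Definition waves_at (R : realType) (eps : R) (v0 : R -> R) (X : R -> nat -> \bar R)
  (t : R) : seq nat := [seq s <- waves eps v0 | (X t s < +oo)%E].

Definition sigma (R : realType) (eps : R) (g v0 : R -> R) (u : R -> R -> R)
  (X : R -> nat -> \bar R) (t : R) (s : nat) : \bar R :=
  wave_speed eps v0 g (u t) (X t s) s.

Section sanity.
Context {R : realType}.

Lemma convex_env_largest (a b : R) (g : R -> R) :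
  convex_minorants a b g !=set0 ->
  convex_minorants a b g (convex_env a b g) /\
  forall h, convex_minorants a b g h ->
    forall u, a <= u <= b -> h u <= convex_env a b g u.
Proof.
move=> [h0 h0P].
have ub u : a <= u <= b -> has_sup [set h u | h in convex_minorants a b g].
  move=> uab; split; first by exists (h0 u), h0.
  by exists (g u) => _ [h [_ hg] <-]; exact: hg.
have max h : convex_minorants a b g h ->
    forall u, a <= u <= b -> h u <= convex_env a b g u.
  by move=> hP u uab; apply: ub_le_sup; [case: (ub u uab) | exists h].
split=> //; split; last first.
  move=> u uab; apply: ge_sup; first by case: (ub u uab).
  by move=> _ [h [_ hg] <-]; exact: hg.
move=> t x y; rewrite !inE /= => xab yab.
set w := conv t x y; set tn := t%:num : R.
have t0 : 0 <= tn by rewrite /tn.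
have t1 : 0 <= 1 - tn by rewrite subr_ge0 /tn.
have wE : w = tn * x + (1 - tn) * y by [].
have xab' : a <= x <= b by rewrite in_itv in xab.
have yab' : a <= y <= b by rewrite in_itv in yab.
have wab : a <= w <= b.
  case/andP: xab' => ax xb; case/andP: yab' => ay yb; rewrite wE.
  by apply/andP; split; nra.
apply: ge_sup; first by case: (ub _ wab).
move=> _ [h hP <-]; have [hc _] := hP.
have := hc t x y; rewrite !inE /= => /(_ xab yab) /le_trans; apply.
rewrite -[leLHS]/(tn * h x + (1 - tn) * h y).
rewrite -[leRHS]/(tn * convex_env a b g x + (1 - tn) * convex_env a b g y).
by apply: lerD; apply: ler_wpM2l => //; apply: max.
Qed.

Lemma pw_affine_interp_grid (eps : R) (f : R -> R) (k : int) : 0 < eps ->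
  pw_affine_interp eps f (k%:~R * eps) = f (k%:~R * eps).
Proof.
move=> e0; rewrite /pw_affine_interp mulfK ?gt_eqF// intrKfloor subrr mulr0.
by rewrite addr0.
Qed.

End sanity.

(* Main.v *)
Require Import Defs.
From mathcomp Require Import all_boot all_order all_algebra.
From mathcomp Require Import all_classical all_reals all_analysis.
From mathcomp Require Import ess_sup_inf.
From mathcomp Require Import lra ring zify.

(** A wave [s] carries the slope [c s] of the flux over its cell of length [eps], and
a front moves with the mean of [c] over its waves. The change of speed at a
collision has two sources.

A collision of fronts of opposite sign kills [k] waves on each side; the surviving
waves change speed by a total of at most [k] times their number times
[|f''| eps^2 / 2], which is absorbed by the decrease of the total variation.

Two merging fronts [L], [Q] of the same sign cost
[2 (c L - c Q) |L| |Q| / (|L| + |Q|)] (times [eps]), where [c L], [c Q] are their speeds.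
A pair of waves which has met before satisfies a separation inequality: the flux at
each front boundary between them lies below (above, for negative waves) its chord
over the states they span. It survives every later collision, and forces the cost
to be at most a multiple of the number of pairs meeting for the first time, up to a
term of the order of the kink [|f''| eps] of the interpolated flux at the boundary.
That kink term matters only if the end waves of both fronts have already met the
front across the boundary. Such boundaries are never created by a merging, and each
cancellation creates at most two of them, next to the fronts it emits; as there are
at most [Tot.Var. / (2 eps)] cancellations, their contribution is quadratic too.
Hence [4 U + n/2 b + 3/4 n a], with [U] the number of pairs of waves which never
met, [b] the number of such boundaries, [n] and [a] the numbers of initial and
of present waves, decreases by at least the cost, up to the factor [|f''| eps^2]. *)

Set Implicit Arguments.
Unset Strict Implicit.
Unset Printing Implicit Defensive.

Import Order.TTheory GRing.Theory Num.Theory.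
Import numFieldNormedType.Exports.

Local Open Scope ring_scope.
Local Open Scope classical_set_scope.

(** * Riemann problems as partitions of lists of waves *)

Section means.
Context {R : realFieldType}.
Variable c : nat -> R.
Implicit Types (K : R) (W L P Q A : seq nat) (Os : seq (seq nat)) (mu : R) (x y : nat).

(** The obstacle is that two waves may meet, be parted when a cancellation cuts their common front,
    and approach again, so that a merging need not be paid for by pairs meeting for the first time.
    The separation inequality limits the difference of speed that such waves can regain: the part of
    a front which has already met the single wave across the boundary has a mean slope no worse than
    the slope of that wave. Only the part which has not met it, and the kink, can then produce an
    excess of speed. The dynamics is carried by lists of labels: a front is a list, its speed a
    mean, a fan a partition into shocks of increasing means. Envelopes of the flux enter only to
    show that the actual fronts are these lists. Both signs fit one formalism, because read from
    left to right the fronts of a fan have increasing speeds whether the envelope is convex or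
    concave. *)

Definition mean W : R := (\sum_(z <- W) c z) / (size W)%:R.

Lemma size_gt0 W : W != [::] -> 0 < (size W)%:R :> R.
Proof. by case: W => // a W _; rewrite ltr0n. Qed.

Lemma mean_size W : mean W * (size W)%:R = \sum_(z <- W) c z.
Proof.
case: W => [|a W]; first by rewrite big_nil mulr0.
by rewrite /mean mulfVK // pnatr_eq0.
Qed.

Lemma sum_sub W mu : \sum_(z <- W) (c z - mu) = \sum_(z <- W) c z - mu * (size W)%:R.
Proof. by rewrite sumrB big_const_seq count_predT iter_addr_0 mulr_natr. Qed.

Lemma sum_sub_mean W mu :
  \sum_(z <- W) (c z - mu) = (mean W - mu) * (size W)%:R.
Proof. by rewrite sum_sub -mean_size mulrBl. Qed.

Lemma mean_le W mu : W != [::] -> (mean W <= mu) = (\sum_(z <- W) (c z - mu) <= 0).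
Proof. by move=> W0; rewrite sum_sub_mean pmulr_lle0 ?size_gt0// subr_le0. Qed.

Lemma mean_ge W mu : W != [::] -> (mu <= mean W) = (0 <= \sum_(z <- W) (c z - mu)).
Proof. by move=> W0; rewrite sum_sub_mean pmulr_lge0 ?size_gt0// subr_ge0. Qed.

Lemma mean1 a : mean [:: a] = c a.
Proof. by rewrite /mean big_seq1 divr1. Qed.

Lemma mean_cat_le P Q mu : P != [::] -> Q != [::] -> mean P <= mu -> mean Q <= mu ->
  mean (P ++ Q) <= mu.
Proof.
move=> P0 Q0; rewrite !mean_le ?big_cat//=; last by case: (P) P0.
by move=> hP hQ; rewrite -oppr_ge0 opprD addr_ge0 ?oppr_ge0.
Qed.

Lemma mean_cat_ge P Q mu : P != [::] -> Q != [::] -> mu <= mean P -> mu <= mean Q ->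
  mu <= mean (P ++ Q).
Proof.
move=> P0 Q0; rewrite !mean_ge ?big_cat//=; last by case: (P) P0.
by move=> hP hQ; rewrite addr_ge0.
Qed.

Lemma mean_cat P Q : P != [::] -> mean (P ++ Q) =
  (mean P * (size P)%:R + mean Q * (size Q)%:R) / ((size P)%:R + (size Q)%:R).
Proof. by move=> P0; rewrite !mean_size /mean big_cat size_cat natrD. Qed.

(* The graph of the flux over a front lies on the correct side of the chord. *)
Definition shock W := forall y, \sum_(z <- W | (y <= z)%N) (c z - mean W) <= 0.

Lemma shock_lo W y : shock W -> 0 <= \sum_(z <- W | (z < y)%N) (c z - mean W).
Proof.
move=> /(_ y) h; have : \sum_(z <- W) (c z - mean W) = 0.
  by rewrite sum_sub_mean subrr mul0r.
rewrite (bigID (fun z => y <= z)%N) /= => e.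
have -> : \sum_(z <- W | (z < y)%N) (c z - mean W)
    = \sum_(z <- W | ~~ (y <= z)%N) (c z - mean W).
  by apply: eq_bigl => z; rewrite ltnNge.
lra.
Qed.

Lemma shock1 a : shock [:: a].
Proof.
by move=> y; rewrite mean1 big_cons big_nil subrr addr0; case: ifP.
Qed.

Lemma sum_sub_cond W (p : pred nat) mu nu :
  \sum_(z <- W | p z) (c z - mu) =
  \sum_(z <- W | p z) (c z - nu) + (nu - mu) * (count p W)%:R.
Proof.
rewrite -[LHS]big_filter -[X in _ = X + _]big_filter -size_filter (sum_sub _ mu) (sum_sub _ nu) mulrBl; set S := \sum_(z <- _) _; lra.
Qed.


Lemma sorted_catP L Q : sorted ltn (L ++ Q) ->
  [/\ sorted ltn L, sorted ltn Q & forall z w, z \in L -> w \in Q -> (z < w)%N].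
Proof.
rewrite (sorted_pairwise ltn_trans) pairwise_cat -!(sorted_pairwise ltn_trans).
by move=> /and3P[/allrelP h -> ->]; split.
Qed.

Lemma catP_sorted L Q : sorted ltn L -> sorted ltn Q ->
  (forall z w, z \in L -> w \in Q -> (z < w)%N) -> sorted ltn (L ++ Q).
Proof.
rewrite !(sorted_pairwise ltn_trans) pairwise_cat => -> -> h.
by rewrite !andbT; apply/allrelP.
Qed.

(** The joint mean lies between [mean Q] and [mean L]. For a cut inside [Q], replacing [mean Q] by
    the joint mean only lowers the sum. For a cut inside [L] the tail contains all of [Q], and the
    total deviation of [L ++ Q] from its mean vanishes. *)
Lemma shock_cat L Q : sorted ltn (L ++ Q) -> shock L -> shock Q -> L != [::] ->
  Q != [::] -> mean Q <= mean L -> shock (L ++ Q).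
Proof.
move=> s shL shQ L0 Q0 QL y.
have mL : mean (L ++ Q) <= mean L by apply: mean_cat_le.
have mQ : mean Q <= mean (L ++ Q) by apply: mean_cat_ge.
have [_ _ lt] := sorted_catP s.
have sum0 : \sum_(z <- L ++ Q) (c z - mean (L ++ Q)) = 0.
  by rewrite sum_sub_mean subrr mul0r.
have := shL y; have := shQ y; rewrite big_cat/=.
rewrite (sum_sub_cond _ _ (mean (L ++ Q)) (mean L)).
rewrite (sum_sub_cond _ _ (mean (L ++ Q)) (mean Q)) => hQ hL.
have [/hasP[z zL yz]|] := boolP (has (leq y) L); last first.
  rewrite has_count -eqn0Ngt => /eqP ->.
  have : 0 <= (mean (L ++ Q) - mean Q) * (count (leq y) Q)%:R.
    by rewrite mulr_ge0 ?subr_ge0.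
  lra.
have -> : \sum_(z <- Q | (y <= z)%N) (c z - mean Q) = 0.
  rewrite big_seq_cond (eq_bigl (fun z => z \in Q)) -?big_seq.
    by rewrite sum_sub_mean subrr mul0r.
  move=> w /=; case wQ: (w \in Q) => //=.
  exact: (leq_trans yz (ltnW (lt _ _ zL wQ))).
have -> : count (leq y) Q = size Q.
  apply/eqP; rewrite -all_count; apply/allP => w wQ /=.
  exact: (leq_trans yz (ltnW (lt _ _ zL wQ))).
have cL : (count (leq y) L)%:R <= (size L)%:R :> R by rewrite ler_nat count_size.
move: sum0; rewrite big_cat /= !sum_sub_mean.
have : (mean L - mean (L ++ Q)) * (count (leq y) L)%:R
   <= (mean L - mean (L ++ Q)) * (size L)%:R by rewrite ler_wpM2l ?subr_ge0.
lra.
Qed.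

Lemma sum_hi P Q y (F : nat -> R) : sorted ltn (P ++ y :: Q) ->
  \sum_(z <- P ++ y :: Q | (y <= z)%N) F z = \sum_(z <- y :: Q) F z.
Proof.
move=> /sorted_catP[_ sQ ltPQ]; rewrite big_cat /= big_seq_cond big_pred0 ?add0r.
  rewrite big_seq_cond [RHS]big_seq; apply: eq_bigl => z /=; apply: andb_idr.
  rewrite inE => /predU1P[->//|zQ]; apply: ltnW.
  by move: sQ; rewrite /= (path_sortedE ltn_trans) => /andP[/allP h _]; exact: h.
move=> z; case zP : (z \in P) => //=; apply/negbTE; rewrite -ltnNge.
by apply: ltPQ zP _; rewrite inE eqxx.
Qed.

Lemma sum_lo P Q y (F : nat -> R) : sorted ltn (P ++ y :: Q) ->
  \sum_(z <- P ++ y :: Q | (z < y)%N) F z = \sum_(z <- P) F z.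
Proof.
move=> s; apply: (addrI (\sum_(z <- y :: Q) F z)); rewrite -{1}(sum_hi F s).
rewrite [RHS]addrC -big_cat [RHS](bigID (fun z => y <= z)%N) /=; congr (_ + _).
by apply: eq_bigl => z; rewrite ltnNge.
Qed.

Lemma shock_suffix P Q : sorted ltn (P ++ Q) -> Q != [::] -> shock (P ++ Q) ->
  mean Q <= mean (P ++ Q).
Proof.
case: Q => // y Q s _ /(_ y); rewrite sum_hi//.
by rewrite mean_le.
Qed.

Lemma shock_prefix P Q : sorted ltn (P ++ Q) -> P != [::] -> shock (P ++ Q) ->
  mean (P ++ Q) <= mean P.
Proof.
case: Q => [|y Q] s P0; first by rewrite cats0.
by move=> /(shock_lo y); rewrite sum_lo// mean_ge.
Qed.

(* The entropy solution of a Riemann problem, as a partition into fronts of the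
   list of its waves. *)
Record riemann_groups A Os : Prop := {
  rg_flatten : flatten Os = A;
  rg_nonempty : [::] \notin Os;
  rg_shock : forall W, W \in Os -> shock W;
  rg_speed : sorted (fun L Q => mean L < mean Q) Os
}.

(** Pooling of adjacent violators: waves are added from the right, each as a front of its own, which
    absorbs its right neighbour as long as that one is not faster. [shock_cat] keeps the absorbed
    list a shock. *)
Lemma riemann_groups_exist A : sorted ltn A -> exists Os, riemann_groups A Os.
Proof.
suff merge W Os : W != [::] -> shock W -> sorted ltn (W ++ flatten Os) ->
    [::] \notin Os -> (forall W, W \in Os -> shock W) ->
    sorted (fun L Q => mean L < mean Q) Os ->
    exists Os', riemann_groups (W ++ flatten Os) Os'.
  elim: A => [_|a A IH /= sA]; first by exists [::]; split.
  have [Os [e ne sh sp]] := IH (path_sorted sA).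
  have [||||||Os' h] := merge [:: a] Os => //; first exact: shock1.
    by rewrite e.
  by exists Os'; rewrite -[X in riemann_groups X]/([:: a] ++ A) -e.
elim: Os W => [W W0 shW _ _ _ _|V Os IH W W0 shW].
  exists [:: W]; split => //=; first by rewrite inE eq_sym.
  by move=> W'; rewrite inE => /eqP->.
move=> s; rewrite inE negb_or => /andP[V0 ne] sh sp.
have [VW|WV] := leP (mean V) (mean W).
  rewrite /= catA; apply: IH.
  - by case: (W) W0.
  - apply: shock_cat => //; last by rewrite eq_sym.
    + by move: s; rewrite /= catA => /sorted_catP[].
    + by apply: sh; rewrite inE eqxx.
  - by rewrite -catA.
  - by [].
  - by move=> U UO; apply: sh; rewrite inE UO orbT.
  - exact: path_sorted sp.
exists [:: W, V & Os]; split => //=.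
- by rewrite !inE !negb_or ne V0 eq_sym W0.
- by move=> U; rewrite inE => /predU1P[->//|]; exact: sh.
- by rewrite WV.
Qed.

(** With its dual [groups_lo], this compares a block that starts or ends in the middle of a front
    with a speed separating the fronts; the separation inequalities inside a new fan come from
    here. *)
Lemma groups_hi Os mu y : (forall W, W \in Os -> shock W) ->
  (forall W, W \in Os -> mean W <= mu) ->
  \sum_(z <- flatten Os | (y <= z)%N) (c z - mu) <= 0.
Proof.
move=> sh le; rewrite big_flatten /= big_seq -oppr_ge0 -sumrN sumr_ge0// => W WO.
rewrite (sum_sub_cond _ _ mu (mean W)); have := sh _ WO y.
have : (mean W - mu) * (count (leq y) W)%:R <= 0.
  by rewrite mulr_le0_ge0 ?subr_le0 ?le.
lra.
Qed.

Lemma groups_lo Os mu y : (forall W, W \in Os -> shock W) ->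
  (forall W, W \in Os -> mu <= mean W) ->
  0 <= \sum_(z <- flatten Os | (z < y)%N) (c z - mu).
Proof.
move=> sh le; rewrite big_flatten /= big_seq sumr_ge0// => W WO.
rewrite (sum_sub_cond _ _ mu (mean W)) addr_ge0 ?shock_lo//; first exact: sh.
by rewrite mulr_ge0 ?subr_ge0 ?le.
Qed.

Lemma speed_le W Os V : path (fun L Q => mean L < mean Q) W Os -> V \in Os ->
  mean W < mean V.
Proof.
rewrite path_sortedE; last by move=> ? ? ?; exact: lt_trans.
by move=> /andP[/allP h _] /h.
Qed.

Lemma speed_cat Os1 Os2 V W : sorted (fun L Q => mean L < mean Q) (Os1 ++ Os2) ->
  V \in Os1 -> W \in Os2 -> mean V < mean W.
Proof.
rewrite sorted_pairwise; last by move=> ? ? ?; exact: lt_trans.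
by rewrite pairwise_cat => /and3P[/allrelP h _ _]; exact: h.
Qed.

Lemma flatten_eq0 Os : [::] \notin Os -> flatten Os = [::] -> Os = [::].
Proof. by case: Os => // [[|a W]] Os //=; rewrite inE eqxx. Qed.

(** If there were several fronts, the first, a prefix of the shock [A], would have mean at least
    [mean A], and the remaining ones, a suffix, at most [mean A], against the increase of the
    speeds. *)
Lemma riemann_groups_shock A Os : A != [::] -> sorted ltn A -> shock A ->
  riemann_groups A Os -> Os = [:: A].
Proof.
move=> A0 sA shA [e ne sh sp]; case: Os e ne sh sp A0 => [<-//|W Os e ne sh sp A0].
have := ne; rewrite inE negb_or => /andP[W0 ne0].
have [Os0|OsN0] := eqVneq Os [::]; first by move: e; rewrite Os0 /= cats0 => ->.
case E : (flatten Os) => [|y Q]; first by rewrite (flatten_eq0 ne0 E) in OsN0.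
have eA : A = W ++ y :: Q by rewrite -e /= E.
have hi : mean (y :: Q) <= mean A by rewrite eA shock_suffix// -eA.
have : mean W < mean (y :: Q).
  case: Os E ne ne0 OsN0 sp {e sh} (sh) => // V Os E _ ne0 _ sp sh.
  apply: (@lt_le_trans _ _ (mean V)); first by case/andP: sp.
  (* A cut above every label turns [groups_lo] into a statement on the whole sum. *)
  have ltM z : z \in y :: Q -> (z < (foldr maxn 0 (y :: Q)).+1)%N.
    rewrite ltnS; elim: (y :: Q) => //= a l IH.
    by rewrite inE leq_max => /predU1P[->|/IH->]; rewrite ?leqnn ?orbT.
  have := @groups_lo (V :: Os) (mean V) (foldr maxn 0 (y :: Q)).+1.
  rewrite E big_seq_cond (eq_bigl (fun z => z \in y :: Q)) -?big_seq; last first.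
    by move=> z /=; apply: andb_idr => /ltM.
  rewrite mean_ge//; apply=> [U UO|U]; first by apply: sh; rewrite inE UO orbT.
  rewrite inE => /predU1P[->//|UO].
  by case/andP: sp => _ sp; rewrite (ltW (speed_le sp UO)).
have : mean A <= mean W by rewrite eA shock_prefix// -?eA// eq_sym.
by move=> AW WQ; have := lt_le_trans WQ (le_trans hi AW); rewrite ltxx.
Qed.


(** Discrete form of the bound on the second derivative of the flux: the slopes of neighbouring
    cells differ by at most [K], which will be [M * eps]. *)
Definition lip K W := sorted (fun z w => `|c w - c z| <= K) W.

Lemma lip_sum_ge K x Q : path (fun z w => `|c w - c z| <= K) x Q ->
  (size Q)%:R * c x - K * (size Q)%:R * ((size Q)%:R + 1) / 2 <= \sum_(z <- Q) c z.
Proof.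
elim: Q x => [|q Q IH] x /=; first by rewrite big_nil; lra.
move=> /andP[xq /IH]; rewrite big_cons -[(size Q).+1%:R]natr1.
have : c x - K <= c q by move: xq; rewrite ler_norml => /andP[]; lra.
have : 0 <= (size Q)%:R :> R by [].
move: (size Q)%:R (\sum_(z <- Q) c z) => m S m0 h1 h2.
have : (m + 1) * (c x - K) <= (m + 1) * c q by rewrite ler_wpM2l//; lra.
move: h2; move: (c x) (c q) => cx cq h2 h3; lra.
Qed.

Lemma lip_last K x Q : path (fun z w => `|c w - c z| <= K) x Q ->
  c x <= c (last x Q) + K * (size Q)%:R /\
  \sum_(z <- x :: Q) c z <= (size Q).+1%:R * c (last x Q)
     + K * (size Q)%:R * ((size Q)%:R + 1) / 2.
Proof.
elim: Q x => [|q Q IH] x /=; first by rewrite big_seq1; lra.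
move=> /andP[xq /IH]; rewrite !big_cons -[(size Q).+2%:R]natr1 -[(size Q).+1%:R]natr1.
move: xq; rewrite ler_norml => /andP[h0 h1] [h2 h3]; split; lra.
Qed.

(** Both means are compared with the slope of the last wave of [P]. The centres of the two blocks
    are half the total length apart, whence the factor 1/2. *)
Lemma lip_mean K P Q : P != [::] -> Q != [::] -> lip K (P ++ Q) ->
  mean P - mean Q <= K * (size (P ++ Q))%:R / 2.
Proof.
case: P => // p P _ Q0; rewrite /lip /= cat_path => /andP[/lip_last[_ hP]].
move=> /lip_sum_ge; rewrite -(mean_size Q) -(mean_size (p :: P)) /= in hP *.
rewrite -[(size (P ++ Q)).+1%:R]natr1 size_cat natrD; rewrite -[(size P).+1%:R]natr1 in hP.
have : 0 < (size Q)%:R :> R by exact: size_gt0.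
have : 0 <= (size P)%:R :> R by [].
move: (mean Q) (mean (p :: P)) hP => mQ mP.
move: (size Q)%:R (size P)%:R (c _) => m n x hP n0 m0 hQ.
have : mP <= x + K * n / 2.
  have n1 : 0 < n + 1 by lra.
  by rewrite -(ler_pM2r n1); apply: (le_trans hP); lra.
have : x - K * (m + 1) / 2 <= mQ.
  by rewrite -(ler_pM2r m0); apply: le_trans hQ; lra.
lra.
Qed.

Lemma groups_cost_ge Os mu : (forall W, W \in Os -> mu <= mean W) ->
  \sum_(W <- Os) `|mean W - mu| * (size W)%:R
  = \sum_(z <- flatten Os) (c z - mu).
Proof.
move=> h; rewrite big_flatten /= !big_seq; apply: eq_bigr => W /h mW.
by rewrite sum_sub_mean ger0_norm// subr_ge0.
Qed.

Lemma groups_cost_le Os mu : (forall W, W \in Os -> mean W <= mu) ->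
  \sum_(W <- Os) `|mean W - mu| * (size W)%:R
  = - \sum_(z <- flatten Os) (c z - mu).
Proof.
move=> h; rewrite big_flatten /= !big_seq -sumrN; apply: eq_bigr => W /h mW.
by rewrite sum_sub_mean ler0_norm ?subr_le0// mulNr.
Qed.

(** Cutting the tail off a shock can only accelerate the rest: the first group is a prefix of the
    shock and the others are faster. The absolute values thus add up to the change of the mean of
    [A], which is the difference of the means of [A] and [B] times |B|/(|A|+|B|). [cut_left_cost] is
    the mirror image, with deceleration. *)
Lemma cut_right_cost K A B Os : sorted ltn (A ++ B) -> B != [::] ->
  shock (A ++ B) -> lip K (A ++ B) -> riemann_groups A Os ->
  \sum_(W <- Os) `|mean W - mean (A ++ B)| * (size W)%:R
  <= K * (size A)%:R * (size B)%:R / 2.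
Proof.
move=> s B0 sh li [e ne shO sp].
have [A0|A0] := eqVneq A [::].
  by rewrite A0 in e *; rewrite (flatten_eq0 ne e) big_nil /= mulr0 !mul0r.
rewrite groups_cost_ge.
  have := lip_mean A0 B0 li; rewrite e sum_sub_mean (mean_cat _ A0) size_cat natrD.
  have := size_gt0 A0; have := size_gt0 B0.
  move: (mean A) (mean B) (size A)%:R (size B)%:R => mA mB a b b0 a0 h.
  have ab : 0 < a + b by lra.
  have -> : (mA - (mA * a + mB * b) / (a + b)) * a = (mA - mB) * (a * b / (a + b)).
    by field; rewrite gt_eqF.
  have -> : K * a * b / 2 = K * (a + b) / 2 * (a * b / (a + b)).
    by field; rewrite gt_eqF.
  by rewrite ler_wpM2r// divr_ge0// ?mulr_ge0//; apply: ltW.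
case: Os e ne shO sp => // W Os e ne shO sp.
have W1 : mean (A ++ B) <= mean W.
  rewrite -e /= -catA shock_prefix//; first by rewrite catA -[W ++ _]/(flatten (W :: Os)) e.
    by move: ne; rewrite inE negb_or eq_sym => /andP[].
  by rewrite catA -[W ++ _]/(flatten (W :: Os)) e.
move=> V; rewrite inE => /predU1P[->//|/(speed_le sp) WV].
exact: le_trans W1 (ltW WV).
Qed.

Lemma cut_left_cost K A B Os : sorted ltn (B ++ A) -> B != [::] ->
  shock (B ++ A) -> lip K (B ++ A) -> riemann_groups A Os ->
  \sum_(W <- Os) `|mean W - mean (B ++ A)| * (size W)%:R
  <= K * (size A)%:R * (size B)%:R / 2.
Proof.
move=> s B0 sh li [e ne shO sp].
have [A0|A0] := eqVneq A [::].
  by rewrite A0 in e *; rewrite (flatten_eq0 ne e) big_nil /= mulr0 !mul0r.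
rewrite groups_cost_le.
  have := lip_mean B0 A0 li; rewrite e sum_sub_mean (mean_cat _ B0) size_cat natrD.
  have := size_gt0 A0; have := size_gt0 B0.
  move: (mean A) (mean B) (size A)%:R (size B)%:R => mA mB a b b0 a0 h.
  have ab : 0 < a + b by lra.
  have -> : - ((mA - (mB * b + mA * a) / (b + a)) * a) = (mB - mA) * (a * b / (a + b)).
    by field; rewrite !gt_eqF//; lra.
  have -> : K * a * b / 2 = K * (b + a) / 2 * (a * b / (a + b)).
    by field; rewrite gt_eqF.
  by rewrite ler_wpM2r// divr_ge0// ?mulr_ge0//; apply: ltW.
case/lastP: Os e ne shO sp => [|Os W] e ne shO sp; first by [].
have eF : flatten (rcons Os W) = flatten Os ++ W.
  by rewrite -cats1 flatten_cat /= cats0.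
have W1 : mean W <= mean (B ++ A).
  rewrite -e eF catA shock_suffix//; rewrite -?catA -?eF ?e//.
  by move: ne; rewrite mem_rcons inE negb_or eq_sym => /andP[].
move=> V; rewrite mem_rcons inE => /predU1P[->//|VO].
apply: le_trans W1; rewrite ltW//; apply: (@speed_cat Os [:: W]) => //.
  by rewrite cats1.
by rewrite inE.
Qed.

Lemma merge_cost L Q : L != [::] -> Q != [::] -> mean Q <= mean L ->
  `|mean (L ++ Q) - mean L| * (size L)%:R + `|mean (L ++ Q) - mean Q| * (size Q)%:R
  = 2 * (mean L - mean Q)
      * ((size L)%:R * (size Q)%:R / ((size L)%:R + (size Q)%:R)).
Proof.
move=> L0 Q0 QL.
have l0 := size_gt0 L0; have q0 := size_gt0 Q0.
rewrite ler0_norm ?subr_le0 ?mean_cat_le// ger0_norm ?subr_ge0 ?mean_cat_ge//.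
rewrite mean_cat//; field; rewrite gt_eqF//; lra.
Qed.

(** The joint mean is the weighted average of the two, so it exceeds [mean Q] by the fraction
    |P|/(|P|+|Q|) of the difference bounded in [lip_mean]. *)
Lemma lip_cat_mean K P Q : P != [::] -> Q != [::] -> lip K (P ++ Q) ->
  mean (P ++ Q) <= mean Q + K * (size P)%:R / 2
  /\ mean P - K * (size Q)%:R / 2 <= mean (P ++ Q).
Proof.
move=> P0 Q0 /(lip_mean P0 Q0); rewrite size_cat natrD mean_cat//.
have := size_gt0 P0; have := size_gt0 Q0.
move: (mean P) (mean Q) (size P)%:R (size Q)%:R => mP mQ p q q0 p0 h.
have pq : 0 < p + q by lra.
have h1 : p * (mP - mQ) <= p * (K * (p + q) / 2) by rewrite ler_wpM2l// ltW.
have h2 : q * (mP - mQ) <= q * (K * (p + q) / 2) by rewrite ler_wpM2l// ltW.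
by split; [rewrite ler_pdivrMr//|rewrite ler_pdivlMr//]; lra.
Qed.

(* [La] and [Qb] are the waves which have not met the wave just across the
   boundary between the fronts; [c y - c x] is the kink of the flux there. *)
Lemma merge_cost_le K La Lb Qa Qb x y : 0 <= K -> lip K (La ++ Lb) -> lip K (Qa ++ Qb) ->
  Lb != [::] -> Qa != [::] -> c y - c x <= K ->
  mean Lb <= c y -> c x <= mean Qa ->
  mean (La ++ Lb) - mean (Qa ++ Qb)
  <= K * (2 + (size La)%:R + (size Qb)%:R) / 2.
Proof.
move=> K0 lL lQ Lb0 Qa0 xy hLb hQa.
have : mean (La ++ Lb) <= mean Lb + K * (size La)%:R / 2.
  have [->|La0] := eqVneq La [::]; first by rewrite /=; lra.
  by have [] := lip_cat_mean La0 Lb0 lL.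
have : mean Qa - K * (size Qb)%:R / 2 <= mean (Qa ++ Qb).
  have [->|Qb0] := eqVneq Qb [::]; first by rewrite cats0 /=; lra.
  by have [] := lip_cat_mean Qa0 Qb0 lQ.
lra.
Qed.

End means.

(** * The interaction potential *)

Section segments.
Implicit Types (al P Q X Y : seq nat).

Definition seg al x y := [seq z <- al | (x <= z < y)%N].

Lemma mem_seg al x y z : (z \in seg al x y) = (z \in al) && (x <= z < y)%N.
Proof. by rewrite mem_filter andbC. Qed.

Lemma seg_sorted al x y : sorted ltn al -> sorted ltn (seg al x y).
Proof. by move=> s; apply: sorted_filter => //; exact: ltn_trans. Qed.

Lemma seg_eq al P x y : sorted ltn al -> sorted ltn P ->
  (forall z, (z \in P) = (z \in al) && (x <= z < y)%N) -> seg al x y = P.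
Proof.
move=> s sP h; apply: (irr_sorted_eq ltn_trans ltnn) => //.
  exact: seg_sorted.
by move=> z; rewrite mem_seg h.
Qed.

Lemma seg_cat al x y z : sorted ltn al -> (x <= y)%N -> (y <= z)%N ->
  seg al x z = seg al x y ++ seg al y z.
Proof.
move=> s xy yz; apply: seg_eq => //.
  apply: catP_sorted; [exact: seg_sorted|exact: seg_sorted|].
  by move=> v w; rewrite !mem_seg => /and3P[_ _ h] /and3P[_ h' _]; lia.
by move=> w; rewrite mem_cat !mem_seg -andb_orr; congr (_ && _); lia.
Qed.

Lemma seg_neq0 al x y z : z \in al -> (x <= z < y)%N -> seg al x y != [::].
Proof.
move=> zal xzy; have : z \in seg al x y by rewrite mem_seg zal.
by case: (seg al x y).
Qed.

Lemma head_le P z : sorted ltn P -> z \in P -> (head 0 P <= z)%N.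
Proof.
case: P => //= a P; rewrite (path_sortedE ltn_trans) => /andP[/allP h _].
by rewrite inE => /predU1P[->//|/h/ltnW].
Qed.

Lemma last_ge P z : sorted ltn P -> z \in P -> (z <= last 0 P)%N.
Proof.
case/lastP: P => // P a; rewrite last_rcons -cats1 => /sorted_catP[_ _ h].
rewrite mem_cat inE => /orP[/h|/eqP->//]; move/(_ a); rewrite inE eqxx.
by move=> /(_ isT)/ltnW.
Qed.

Lemma mem_head0 P : P != [::] -> head 0 P \in P.
Proof. by case: P => //= a P _; rewrite inE eqxx. Qed.

Lemma mem_last0 P : P != [::] -> last 0 P \in P.
Proof. by case: P => //= a P _; exact: mem_last. Qed.

Lemma filter_split P (p : pred nat) : sorted ltn P ->
  (forall s x, s \in P -> x \in P -> (s < x)%N -> p s -> p x) ->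
  P = [seq s <- P | ~~ p s] ++ [seq s <- P | p s].
Proof.
move=> sP h; apply: (irr_sorted_eq ltn_trans ltnn) => //.
  apply: catP_sorted; try by apply: sorted_filter => //; exact: ltn_trans.
  move=> v w; rewrite !mem_filter => /andP[pv vP] /andP[pw wP].
  rewrite ltnNge leq_eqVlt; apply/negP => /orP[/eqP e|wv].
    by rewrite -e pw in pv.
  by rewrite (h _ _ wP vP wv pw) in pv.
by move=> z; rewrite mem_cat !mem_filter; case: (p z); rewrite /= ?orbF.
Qed.

End segments.

(** * The invariant, the potential, and the removal of waves *)

Section dynamics.
Context {R : realFieldType}.
Variables (c sg : nat -> R) (n : nat).
Implicit Types (K : R) (I : rel nat) (Fl W L Q A : seq nat) (Ws pre post Os : seq (seq nat)).

(** By the betweenness property of the invariant, the first two relations say that all of [W] has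
    met the head of [V] and all of [V] the last wave of [W], so a merging might create few first
    meetings. If the extreme waves have met, separation prevents the fronts from approaching, and no
    flag is required. The empty [W] stands for the absence of a left neighbour at the start of
    [path]. *)
Definition flagged I Fl W V :=
  [&& W != [::], I (head 0 W) (head 0 V), I (last 0 W) (last 0 V) &
      ~~ I (head 0 W) (last 0 V)] ==> (head 0 V \in Fl).

(* [I s s'] holds for the waves [s < s'] which have interacted; [Fl] contains the
   first waves of some fronts, including those for which the boundary to the
   preceding front may be crossed at an interaction without a proportional number
   of first meetings. *)
Record state_inv Ws I Fl : Prop := {
  inv_sorted : sorted ltn (flatten Ws);
  inv_sub : {subset flatten Ws <= iota 1 n};
  inv_nonempty : [::] \notin Ws;
  inv_front : forall W s s', W \in Ws -> s \in W -> s' \in W -> (s < s')%N -> I s s';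
  inv_between : forall s x s', s \in flatten Ws -> x \in flatten Ws ->
    s' \in flatten Ws -> (s < s')%N -> (s <= x <= s')%N -> I s s' ->
    [/\ sg x = sg s, (s < x)%N -> I s x & (x < s')%N -> I x s'];
  inv_sep : forall W s s', W \in Ws -> s \in flatten Ws -> s' \in flatten Ws ->
    (s < head 0 W <= s')%N -> I s s' ->
    mean c (seg (flatten Ws) s (head 0 W)) <= mean c (seg (flatten Ws) (head 0 W) s'.+1);
  inv_flag : path (flagged I Fl) [::] Ws
}.

Definition unmet I : nat :=
  \sum_(s <- iota 1 n) \sum_(s' <- iota 1 n) ((s < s')%N && ~~ I s s').

(** The factor 4 comes from a merging with some unmet wave next to the boundary, n/2 from one
    without, which spends a flag. With 3/4, the 2k waves lost in a cancellation release 3nk/2, which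
    covers nk/2 of speed change and n for two new flags. *)
Definition potential I Fl (a : nat) : R :=
  4 * (unmet I)%:R + n%:R / 2 * (size Fl)%:R + 3 / 4 * n%:R * a%:R.

Lemma unmet_drop I I' P Q : uniq P -> uniq Q -> {subset P <= iota 1 n} ->
  {subset Q <= iota 1 n} -> subrel I I' ->
  (forall s s', s \in P -> s' \in Q -> [/\ (s < s')%N, ~~ I s s' & I' s s']) ->
  (unmet I' + size P * size Q <= unmet I)%N.
Proof.
move=> uP uQ sP sQ II' h.
have cnt X : uniq X -> {subset X <= iota 1 n} ->
    size X = (\sum_(s <- iota 1 n) (s \in X))%N.
  move=> uX sX; rewrite -big_mkcond sum1_count -size_filter.
  apply/eqP; rewrite eq_sym -(uniq_size_uniq uX); last first.
    by move=> z; rewrite mem_filter; case zX : (z \in X) => //=; rewrite sX.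
  exact/filter_uniq/iota_uniq.
rewrite (cnt P)// (cnt Q)// big_distrl /= -big_split /= leq_sum// => s _.
rewrite big_distrr /= -big_split /= leq_sum// => s' _.
case sP' : (s \in P); case sQ' : (s' \in Q); rewrite ?muln0 ?mul0n ?addn0.
- by have [-> -> ->] := h _ _ sP' sQ'.
all: by case: (s < s')%N => //=; case E : (I s s'); rewrite ?(II' _ _ E); case: (I' s s').
Qed.

Lemma flatten_mid pre (W : seq nat) post :
  flatten (pre ++ W :: post) = flatten pre ++ W ++ flatten post.
Proof. by rewrite flatten_cat. Qed.

Lemma mem_flatten Ws W z : W \in Ws -> z \in W -> z \in flatten Ws.
Proof. by move=> WW zW; apply/flattenP; exists W. Qed.

Lemma lip_junction K L Q : L != [::] -> Q != [::] -> lip c K (L ++ Q) ->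
  c (head 0 Q) - c (last 0 L) <= K.
Proof.
case: L => // l L _; case: Q => // q Q _; rewrite /lip /= cat_path => /andP[_ /andP[]].
by rewrite ler_norml => /andP[_].
Qed.

Lemma lip_catP K L Q : lip c K (L ++ Q) -> lip c K L /\ lip c K Q.
Proof. by move=> /cat_sorted2[]. Qed.

Lemma flagged_groups I F Os : sorted ltn (flatten Os) -> [::] \notin Os ->
  (forall s s', s \in flatten Os -> s' \in flatten Os -> (s < s')%N -> I s s') ->
  sorted (flagged I F) Os.
Proof.
elim: Os => [//|W [//|V Os] IH] s; rewrite inE negb_or => /andP[W0 ne] h.
have /= [_ sV lt] := sorted_catP s.
rewrite /= -/(sorted _ (V :: Os)) IH// ?andbT; last first.
  by move=> x y xO yO; apply: h; rewrite mem_cat ?xO ?yO orbT.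
have V0 : V != [::] by move: ne; rewrite inE negb_or eq_sym => /andP[].
have hW : head 0 W \in W by rewrite mem_head0 1?eq_sym.
have lV : last 0 V \in V ++ flatten Os by rewrite mem_cat mem_last0.
have IWV : I (head 0 W) (last 0 V).
  by apply: h; [rewrite mem_cat hW|rewrite mem_cat lV orbT|exact: lt].
by rewrite /flagged IWV !andbF.
Qed.

(** Common core of both cancellations: [Z1] and [Z2] disappear on either side of the survivors [A],
    which are resolved again into [Os]. No removed wave lies between two survivors that have met, so
    the blocks in the old separation inequalities are unchanged. If nothing is removed on the left,
    [A] must begin where an old front begins, so that an old inequality is available there. *)
Lemma state_inv_replace Ws pre post Os I Fl Z1 Z2 A :
  state_inv Ws I Fl ->
  flatten Ws = flatten pre ++ Z1 ++ A ++ Z2 ++ flatten post ->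
  {subset pre <= Ws} -> {subset post <= Ws} ->
  path (flagged I Fl) [::] pre -> sorted (flagged I Fl) post ->
  (forall s z s', s \in flatten pre ++ A ++ flatten post ->
     s' \in flatten pre ++ A ++ flatten post -> z \in Z1 ++ Z2 ->
     (s < s')%N -> I s s' -> ~~ (s <= z <= s')%N) ->
  (forall s s', s \in A -> s' \in A -> (s < s')%N -> I s s') ->
  (Z1 = [::] -> A != [::] -> exists2 W, W \in Ws & head 0 W = head 0 A) ->
  riemann_groups c A Os ->
  state_inv (pre ++ Os ++ post) I
    [:: head 0 (flatten Os ++ flatten post), head 0 (flatten post) & Fl].
Proof.
move=> hinv alE preW postW fpre fpost zsep frontA headA [OsA ne sh sp].
set Fm := [:: _, _ & Fl].
set X := flatten pre in alE zsep *; set Y := flatten post in alE zsep *.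
set al := flatten Ws in alE.
have s_al : sorted ltn al := inv_sorted hinv.
set al' := X ++ A ++ Y.
have al'E : flatten (pre ++ Os ++ post) = al' by rewrite !flatten_cat OsA.
have sub_al z : z \in al' -> z \in al.
  by rewrite alE !mem_cat => /or3P[] ->; rewrite ?orbT.
have al_al' z : z \in al -> (z \in al') || (z \in Z1 ++ Z2).
  rewrite alE !mem_cat.
  by case/or4P => [->|->|->|/orP[->|->]]; rewrite ?orbT.
have s_al' : sorted ltn al'.
  apply: (subseq_sorted ltn_trans _ s_al); rewrite alE.
  apply: cat_subseq (subseq_refl _) _.
  apply: subseq_trans (suffix_subseq Z1 _).
  apply: cat_subseq (subseq_refl _) _.
  exact: suffix_subseq.
have [sX sAY XAY] := sorted_catP s_al'.
have [sA sY AY] := sorted_catP sAY.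
have XA x y : x \in X -> y \in A -> (x < y)%N.
  by move=> xX yA; apply: XAY; rewrite // mem_cat yA.
have XY x y : x \in X -> y \in Y -> (x < y)%N.
  by move=> xX yY; apply: XAY; rewrite // mem_cat yY orbT.
have segE s s' x y : s \in al' -> s' \in al' -> (s < s')%N -> I s s' ->
    (s <= x)%N -> (y <= s'.+1)%N -> seg al x y = seg al' x y.
  move=> sal s'al ss' Is sx ys'; apply: seg_eq => //; first exact: seg_sorted.
  move=> z; rewrite mem_seg.
  apply/andP/andP => [[zal xzy]|[zal xzy]]; split=> //; first exact: sub_al.
  have /orP[//|zZ] := al_al' _ zal.
  have := zsep _ _ _ sal s'al zZ ss' Is; case/andP: xzy => xz zy.
  by rewrite (leq_trans sx xz) /= -ltnS (leq_trans zy ys').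
have oldsep W s s' : W \in Ws -> s \in al' -> s' \in al' ->
    (s < head 0 W <= s')%N -> I s s' ->
    mean c (seg al' s (head 0 W)) <= mean c (seg al' (head 0 W) s'.+1).
  move=> WW sal s'al sWs' Is; have /andP[sW Ws'] := sWs'.
  have ss' := leq_trans sW Ws'.
  rewrite -!(segE s s')//; last 2 first.
  - exact: ltnW.
  - by rewrite ltnW.
  by apply: (inv_sep hinv) => //; exact: sub_al.
have between := inv_between hinv.
(* At a boundary [m] inside [A] the inequality is glued from the one within the fan and from old
   ones at the first wave [a] of [A] and at the first wave [y] after [A]. *)
have newsep W s s' : W \in Os -> s \in al' -> s' \in al' ->
    (s < head 0 W <= s')%N -> I s s' ->
    mean c (seg al' s (head 0 W)) <= mean c (seg al' (head 0 W) s'.+1).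
  move=> WO sal s'al sWs' Is; have /andP[sW Ws'] := sWs'.
  have ss' := leq_trans sW Ws'.
  have W0 : W != [::] by apply: contraNneq ne => <-.
  have mW := mem_head0 W0; set m := head 0 W in mW sWs' sW Ws' *.
  have mA : m \in A by rewrite -OsA; apply: mem_flatten WO mW.
  have A0 : A != [::] by case: (A) mA.
  have mal : m \in al' by rewrite !mem_cat mA orbT.
  have aA := mem_head0 A0; have bA := mem_last0 A0.
  set a := head 0 A in aA *; set b := last 0 A in bA *.
  have aal : a \in al' by rewrite !mem_cat aA orbT.
  have bal : b \in al' by rewrite !mem_cat bA orbT.
  have am : (a <= m)%N := head_le sA mA.
  have mb : (m <= b)%N := last_ge sA mA.
  (* If [s] is left of [A], then [Z1] is empty, since its waves would lie between [s] and [s']. *)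
  have leftA : (s < a)%N -> exists2 V, V \in Ws & head 0 V = a.
    move=> sa; apply: headA => //; case Z1E : Z1 => [//|z Z].
    have zZ : z \in Z1 ++ Z2 by rewrite Z1E !mem_cat inE eqxx.
    have := zsep _ _ _ sal s'al zZ ss' Is.
    have sz : (s <= z)%N.
      have sXX : s \in X.
        move: sal; rewrite !mem_cat => /or3P[//|sAA|sYY].
          by have := head_le sA sAA; rewrite leqNgt sa.
        by have := AY _ _ aA sYY; rewrite ltnNge ltnW.
      move: s_al; rewrite alE => /sorted_catP[_ _ h]; apply/ltnW/h => //.
      by rewrite Z1E mem_cat inE eqxx.
    have zs' : (z <= s')%N.
      apply: leq_trans Ws'; move: s_al; rewrite alE => /sorted_catP[_].
      move=> /sorted_catP[_ _ h] _; apply/ltnW/h; first by rewrite Z1E inE eqxx.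
      by rewrite mem_cat mA.
    by rewrite sz zs'.
  have [ o1 [ o2 OsE]] : exists o1 o2, Os = o1 ++ W :: o2.
    by case/splitPr: WO => o1 o2; exists o1, o2.
  have [ o10|o1N] := eqVneq o1 [::].
    have ma : m = a by rewrite /m /a -OsA OsE o10 /=; case: (W) W0.
    have [V VW Va] : exists2 V, V \in Ws & head 0 V = a by apply: leftA; rewrite -ma.
    by have := oldsep V s s' VW sal s'al; rewrite Va -ma; apply.
  have AE : A = flatten o1 ++ flatten (W :: o2) by rewrite -OsA OsE flatten_cat.
  have m2 : m \in flatten (W :: o2) by rewrite /= mem_cat mW.
  have := sA; rewrite {1}AE => /sorted_catP[so1 so2 o12].
  have mo2 z : z \in flatten (W :: o2) -> (m <= z)%N.
    have -> : m = head 0 (flatten (W :: o2)) by rewrite /m /=; case: (W) W0.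
    exact: head_le.
  have splitA z : z \in A -> (z < m)%N = (z \in flatten o1).
    rewrite AE mem_cat => /orP[z1|z2]; first by rewrite z1 o12.
    rewrite ltnNge mo2//; apply/esym/negbTE/negP => z1.
    by have := o12 _ _ z1 z2; rewrite ltnn.
  (* Within the fan [mean c W] separates: groups before [W] are slower, those from [W] on are
     not. *)
  have expose s0 t0 : s0 \in A -> t0 \in A -> (s0 < m)%N -> (m <= t0)%N ->
      mean c (seg al' s0 m) <= mean c (seg al' m t0.+1).
    move=> s0A t0A s0m mt0; apply: (@le_trans _ _ (mean c W)).
      have -> : seg al' s0 m = [seq z <- flatten o1 | (s0 <= z)%N].
        apply: seg_eq => //; first by apply: sorted_filter => //; exact: ltn_trans.
        move=> z; rewrite mem_filter; apply/andP/and3P => [[s0z z1]|[zal s0z zm]].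
          split=> //; last exact: o12.
          by rewrite !mem_cat AE mem_cat z1 orbT.
        split=> //; move: zal; rewrite !mem_cat => /or3P[zX|zA|zY].
        - by have := XA _ _ zX s0A; rewrite ltnNge s0z.
        - by rewrite -splitA.
        - by have := AY _ _ mA zY; rewrite ltnNge ltnW.
      have s01 : s0 \in flatten o1 by rewrite -splitA.
      rewrite mean_le ?big_filter; last first.
        have : s0 \in [seq z <- flatten o1 | (s0 <= z)%N] by rewrite mem_filter leqnn.
        by case: [seq _ <- _ | _].
      apply: groups_hi => V V1; first by apply: sh; rewrite OsE mem_cat V1.
      by apply/ltW/(speed_cat (Os2 := W :: o2) _ V1); rewrite -?OsE// inE eqxx.
    have -> : seg al' m t0.+1 = [seq z <- flatten (W :: o2) | (z < t0.+1)%N].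
      apply: seg_eq => //; first by apply: sorted_filter => //; exact: ltn_trans.
      move=> z; rewrite mem_filter; apply/andP/and3P => [[zt0 z2]|[zal mz zt0]].
        split=> //; last exact: mo2.
        by rewrite !mem_cat AE mem_cat z2 !orbT.
      split=> //; move: zal; rewrite !mem_cat => /or3P[zX|zA|zY].
      - by have := XA _ _ zX mA; rewrite ltnNge mz.
      - have := splitA _ zA; rewrite ltnNge mz /= => z1.
        by move: zA; rewrite AE mem_cat -z1 /= mem_cat.
      - by have := AY _ _ t0A zY; rewrite ltnNge -ltnS zt0.
    rewrite mean_ge ?big_filter; last first.
      have : m \in [seq z <- flatten (W :: o2) | (z < t0.+1)%N].
        by rewrite mem_filter ltnS mt0.
      by case: [seq _ <- _ | _].
    apply: groups_lo => V; first by move=> V2; apply: sh; rewrite OsE mem_cat V2 orbT.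
    rewrite inE => /predU1P[->//|V2].
    move: sp; rewrite OsE => /cat_sorted2[_] /= sp.
    by rewrite ltW// (speed_le sp).
  have am1 : (a < m)%N.
    rewrite ltn_neqAle am andbT; apply/eqP => e.
    have : (a < m)%N.
      rewrite splitA//; case E : o1 (o1N) => [//|V o] _.
      have : V != [::].
        by apply: contraNneq ne => <-; rewrite OsE E mem_cat inE eqxx.
      rewrite /a AE E /=; case: V {E} => //= v V _; by rewrite inE eqxx.
    by rewrite e ltnn.
  (* [t0] is the last wave of [A] not beyond [s']; the inequality is proved up to [t0] and then
     extended over the waves after [A]. *)
  have [t0 [t0A mt0 t0s' tmin]] : exists t0, [/\ t0 \in A, (m <= t0)%N, (t0 <= s')%N &
      (s' \in A /\ t0 = s') \/ (s' \in Y /\ t0 = b)].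
    have : s' \in X ++ A ++ Y := s'al; rewrite !mem_cat => /or3P[s'X|s'A|s'Y].
    - by have := XA _ _ s'X mA; rewrite ltnNge Ws'.
    - by exists s'; split=> //; left.
    - by exists b; split=> //; [apply: ltnW; exact: AY|right].
  have t0al : t0 \in al' by rewrite !mem_cat t0A orbT.
  have st0 : (s < t0)%N := leq_trans sW mt0.
  have Ist0 : I s t0.
    have := between _ _ _ (sub_al _ sal) (sub_al _ t0al) (sub_al _ s'al) ss' _ Is.
    by rewrite (ltnW st0) t0s' => /(_ isT)[_ h _]; exact: h.
  have left : mean c (seg al' s m) <= mean c (seg al' m t0.+1).
    have [sa|sa] := ltnP s a; last first.
      apply: expose => //; have : s \in X ++ A ++ Y := sal.
      rewrite !mem_cat => /or3P[sXX|//|sYY].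
        by have := XA _ _ sXX aA; rewrite ltnNge sa.
      by have := AY _ _ mA sYY; rewrite ltnNge ltnW.
    (* The old inequality bounds the mean over [s,a) by that over [a,t0], and the fan bounds [a,m)
       by [m,t0]; hence both [s,a) and [a,m) have mean at most that of [m,t0]. *)
    have [V VW Va] := leftA sa.
    have := oldsep V s t0 VW sal t0al; rewrite Va sa (leq_trans am mt0).
    move=> /(_ isT Ist0); rewrite (seg_cat s_al' am (leqW mt0)).
    rewrite (seg_cat s_al' (ltnW sa) am) => h.
    have e := expose a t0 aA t0A am1 mt0.
    have n1 : seg al' s a != [::] by rewrite (seg_neq0 sal)// leqnn.
    have n2 : seg al' a m != [::] by rewrite (seg_neq0 aal)// leqnn.
    have n3 : seg al' m t0.+1 != [::] by rewrite (seg_neq0 mal)// leqnn.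
    by apply: mean_cat_le => //; apply: (le_trans h); exact: mean_cat_le.
  case: tmin => [[_ <-//]|[s'Y t0b]]; rewrite t0b in left.
  (* The mean over [s,m) is at most that over [m,b], hence at most that over [s,y), which the old
     inequality at [y] bounds by the mean over [y,s']. *)
  have [V Vp Vh] : exists2 V, V \in post & head 0 V = head 0 Y.
    rewrite /Y; case E : post s'Y => [|V post'] //.
      by rewrite /Y E.
    move=> _; exists V; first by rewrite inE eqxx.
    have : V != [::].
      apply: contraNneq (inv_nonempty hinv) => <-; apply: postW.
      by rewrite E inE eqxx.
    by case: (V).
  have Y0 : Y != [::] by case: (Y) s'Y.
  have yY := mem_head0 Y0; set y := head 0 Y in yY Vh.
  have my : (m < y)%N by exact: AY.
  have ys' : (y <= s')%N by exact: head_le.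
  have by1 : (b < y)%N by exact: AY.
  have yal : y \in al' by rewrite !mem_cat yY !orbT.
  have := oldsep V s s' (postW _ Vp) sal s'al.
  rewrite Vh ys' (ltn_trans sW my) => /(_ isT Is).
  rewrite (seg_cat s_al' (ltnW sW) (ltnW my)) => h.
  rewrite (seg_cat s_al' (ltnW my) (leqW ys')).
  have e : seg al' m y = seg al' m b.+1.
    apply: seg_eq => //; first exact: seg_sorted.
    move=> z; rewrite mem_seg; case zal : (z \in al') => //=.
    have : z \in X ++ A ++ Y := zal; rewrite !mem_cat => /or3P[zX|zA|zY].
    - by have := XA _ _ zX mA; rewrite ltnNge => /negbTE ->.
    - by rewrite ltnS (last_ge sA zA) (AY _ _ zA yY).
    - have := AY _ _ bA zY; have := head_le sY zY; rewrite -/y.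
      by move=> yz bz; rewrite ltnS (ltnNge z y) yz (leqNgt z b) bz !andbF.
  rewrite e in h *.
  have n1 : seg al' s m != [::] by rewrite (seg_neq0 sal)// leqnn.
  have n2 : seg al' m b.+1 != [::] by rewrite (seg_neq0 mal)// leqnn.
  have n3 : seg al' y s'.+1 != [::] by rewrite (seg_neq0 yal)// leqnn.
  apply: mean_cat_ge => //; apply: le_trans h.
  exact: mean_cat_ge.
have flag_sub W V : flagged I Fl W V -> flagged I Fm W V.
  rewrite /flagged => /implyP h; apply/implyP => /h hF.
  by rewrite !inE hF !orbT.
split.
- by rewrite al'E.
- by move=> z; rewrite al'E => /sub_al; exact: (inv_sub hinv).
- rewrite !mem_cat !negb_or ne /=; apply/andP; split.
    by apply: contraNN (inv_nonempty hinv); exact: preW.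
  by apply: contraNN (inv_nonempty hinv); exact: postW.
- move=> W s s'; rewrite !mem_cat => /or3P[Wp|WO|Wp].
  + exact: (inv_front hinv (preW _ Wp)).
  + by move=> sW s'W; apply: frontA; rewrite -OsA; [exact: mem_flatten sW|exact: mem_flatten s'W].
  + exact: (inv_front hinv (postW _ Wp)).
- by rewrite al'E => s x s' /sub_al sal /sub_al xal /sub_al s'al; exact: between.
- rewrite al'E => W s s'; rewrite mem_cat [in X in _ || X]mem_cat => /or3P[Wp|WO|Wp].
  + exact: (oldsep _ _ _ (preW _ Wp)).
  + exact: newsep.
  + exact: (oldsep _ _ _ (postW _ Wp)).
(* Only the first front of [Os] and the first of [post] get a new left neighbour, and the two added
   labels flag them. Inside [Os] all pairs have met. *)
- rewrite cat_path; apply/andP; split; first exact: sub_path fpre.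
  have first W V : head 0 V \in Fm -> flagged I Fm W V.
    by rewrite /flagged => ->; exact: implybT.
  have ppost W : path (flagged I Fm) W post.
    case E : post fpost => [//|V post'] fp /=; apply/andP; split.
      apply: first; rewrite !inE /Y E /=.
      have : V != [::].
        apply: contraNneq (inv_nonempty hinv) => <-; apply: postW.
        by rewrite E inE eqxx.
      by case: (V) => //= v V' _; rewrite eqxx orbT.
    exact: sub_path fp.
  case E : Os (ne) (OsA) => [|W Os'] ne' OsA'; first exact: ppost.
  rewrite cat_path ppost andbT /=; apply/andP; split.
    apply: first; rewrite !inE E.
    have : W != [::] by move: ne'; rewrite inE negb_or eq_sym => /andP[].
    by case: (W) => //= w W' _; rewrite eqxx.
  by apply: (@flagged_groups _ _ (W :: Os')); rewrite ?OsA'.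
Qed.

(** * Effect of one collision on the invariant and on the potential *)

Section interaction.
Variables (pre post : seq (seq nat)) (L Q Fl : seq nat) (I : rel nat).
Hypothesis hinv : state_inv (pre ++ L :: Q :: post) I Fl.
Let al := flatten (pre ++ L :: Q :: post).

Let alE : al = flatten pre ++ L ++ Q ++ flatten post.
Proof. by rewrite /al flatten_mid. Qed.

Let s_al : sorted ltn al. Proof. exact: inv_sorted hinv. Qed.

Let L0 : L != [::].
Proof.
by apply: contraNneq (inv_nonempty hinv) => <-; rewrite mem_cat inE eqxx orbT.
Qed.

Let Q0 : Q != [::].
Proof.
by apply: contraNneq (inv_nonempty hinv) => <-; rewrite mem_cat !inE eqxx !orbT.
Qed.

Let Lin : L \in pre ++ L :: Q :: post.
Proof. by rewrite mem_cat inE eqxx orbT. Qed.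

Let Qin : Q \in pre ++ L :: Q :: post.
Proof. by rewrite mem_cat !inE eqxx !orbT. Qed.

Let Lal s : s \in L -> s \in al. Proof. by rewrite alE !mem_cat => ->; rewrite orbT. Qed.

Let Qal s : s \in Q -> s \in al. Proof. by rewrite alE !mem_cat => ->; rewrite !orbT. Qed.

Let order : [/\ sorted ltn L, sorted ltn Q,
  forall x y, x \in L -> y \in Q -> (x < y)%N,
  forall x y, x \in flatten pre -> y \in L ++ Q -> (x < y)%N &
  forall x y, x \in L ++ Q -> y \in flatten post -> (x < y)%N].
Proof.
move: s_al; rewrite alE => /sorted_catP[_ s1 h1]; move: (s1).
rewrite catA => /sorted_catP[/sorted_catP[sL sQ LQ] _ h2]; split => //.
move=> x y xp yLQ; apply: h1 => //; move: yLQ; rewrite !mem_cat.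
by case/orP => ->; rewrite ?orbT.
Qed.

Let segL s : s \in L -> seg al s (head 0 Q) = [seq x <- L | (s <= x)%N].
Proof.
have [sL sQ LQ pL Lp] := order; move=> sLs; apply: seg_eq => //.
  by apply: sorted_filter => //; exact: ltn_trans.
have hQ := mem_head0 Q0; move=> z; rewrite mem_filter alE !mem_cat.
case zL : (z \in L); rewrite ?orbT ?andbT /= ?(LQ _ _ zL hQ) ?andbT//.
rewrite andbF; apply/esym/negbTE/negP => /andP[zz /andP[sz zQ]].
case/or3P: zz => zz.
- by move: sz; rewrite leqNgt (pL _ s zz) ?mem_cat ?sLs.
- by move: zQ; rewrite ltnNge head_le.
- by move: zQ; rewrite ltnNge ltnW// (Lp (head 0 Q) _ _ zz)// mem_cat hQ orbT.
Qed.

Let segQ s : s \in Q -> seg al (head 0 Q) s.+1 = [seq x <- Q | (x <= s)%N].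
Proof.
have [sL sQ LQ pL Lp] := order; move=> sQs; apply: seg_eq => //.
  by apply: sorted_filter => //; exact: ltn_trans.
have hQ := mem_head0 Q0; move=> z; rewrite mem_filter alE !mem_cat ltnS.
case zQ : (z \in Q); rewrite ?orbT ?andbT /= ?(head_le sQ zQ)//.
rewrite andbF; apply/esym/negbTE/negP => /andP[zz /andP[sz zs]].
case/or3P: zz => // zz.
- by move: sz; rewrite leqNgt (pL _ (head 0 Q) zz)// mem_cat hQ orbT.
- by move: sz; rewrite leqNgt (LQ _ _ zz hQ).
- by move: zs; rewrite leqNgt (Lp s _ _ zz)// mem_cat sQs orbT.
Qed.

Let sep s s' : s \in L -> s' \in Q -> I s s' ->
  mean c [seq x <- L | (s <= x)%N] <= mean c [seq x <- Q | (x <= s')%N].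
Proof.
have [sL sQ LQ _ _] := order; move=> sLs sQs Is.
rewrite -segL// -segQ//; apply: (inv_sep hinv Qin) => //; try exact: Lal; try exact: Qal.
by rewrite LQ ?mem_head0//= head_le.
Qed.

(** Separation applied to the extreme pair would compare the whole fronts and contradict their
    approach. *)
Let unmet_ends : mean c Q < mean c L -> ~~ I (head 0 L) (last 0 Q).
Proof.
have [sL sQ LQ _ _] := order; rewrite ltNge; apply: contra => /sep.
rewrite mem_head0// mem_last0// => /(_ isT isT).
have -> : [seq x <- L | (head 0 L <= x)%N] = L.
  by apply/all_filterP/allP => x /(head_le sL).
have -> // : [seq x <- Q | (x <= last 0 Q)%N] = Q.
  by apply/all_filterP/allP => x /(last_ge sQ).
Qed.

Let I' s s' := I s s' || (s \in L) && (s' \in Q).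

Let Iin s x s' : s \in al -> x \in al -> s' \in al -> (s < s')%N -> (s <= x <= s')%N ->
  I s s' -> [/\ sg x = sg s, (s < x)%N -> I s x & (x < s')%N -> I x s'].
Proof. exact: (inv_between hinv). Qed.

(** By betweenness, a wave of [L] that has met some wave of [Q] has met the head of [Q]. So all
    pairs in [La] times [Q], and likewise in [L] times [Qb], meet for the first time. *)
Lemma merge_unmet :
  let La := [seq s <- L | ~~ I s (head 0 Q)] in
  let Qb := [seq s <- Q | ~~ I (last 0 L) s] in
  [/\ (unmet I' <= unmet I)%N, (unmet I' + size La * size Q <= unmet I)%N &
      (unmet I' + size L * size Qb <= unmet I)%N].
Proof.
have [sL sQ LQ _ _] := order.
have uL : uniq L by apply: sorted_uniq sL => //; [exact: ltn_trans|exact: ltnn].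
have uQ : uniq Q by apply: sorted_uniq sQ => //; [exact: ltn_trans|exact: ltnn].
have subL : {subset L <= iota 1 n} by move=> s /Lal; exact: (inv_sub hinv).
have subQ : {subset Q <= iota 1 n} by move=> s /Qal; exact: (inv_sub hinv).
have II' : subrel I I' by move=> s s'; rewrite /I' => ->.
have hQ := mem_head0 Q0; have lL := mem_last0 L0.
split.
- rewrite -[leqLHS]addn0.
  exact: (@unmet_drop I I' [::] [::]).
- apply: unmet_drop => //; first exact: filter_uniq.
    by move=> s; rewrite mem_filter => /andP[_ /subL].
  move=> s s'; rewrite mem_filter => /andP[nI sLs] s'Q.
  rewrite LQ// /I' sLs s'Q orbT; split => //; apply: contra nI => Is.
  have hs := head_le sQ s'Q.
  have [||_ h _] := Iin (Lal sLs) (Qal hQ) (Qal s'Q) _ _ Is; rewrite ?LQ//.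
    by rewrite hs ltnW ?LQ.
  by apply: h; rewrite LQ.
- apply: unmet_drop => //; first exact: filter_uniq.
    by move=> s; rewrite mem_filter => /andP[_ /subQ].
  move=> s s' sLs; rewrite mem_filter => /andP[nI s'Q].
  rewrite LQ// /I' sLs s'Q orbT; split => //; apply: contra nI => Is.
  have hs := last_ge sL sLs.
  have [||_ _ h] := Iin (Lal sLs) (Lal lL) (Qal s'Q) _ _ Is; rewrite ?LQ//.
    by rewrite hs ltnW ?LQ.
  by apply: h; rewrite LQ.
Qed.

Let sgL s s' : s \in L -> s' \in L -> sg s = sg s'.
Proof.
have h x y : x \in L -> y \in L -> (x < y)%N -> sg y = sg x.
  move=> xL yL xy; have Ixy := inv_front hinv Lin xL yL xy.
  have xyy : (x <= y <= y)%N by rewrite leqnn ltnW.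
  by have [] := Iin (Lal xL) (Lal yL) (Lal yL) xy xyy Ixy.
by move=> sLs s'L; case: (ltngtP s s') => [/h->|/h->|->].
Qed.

Let sgQ s s' : s \in Q -> s' \in Q -> sg s = sg s'.
Proof.
have h x y : x \in Q -> y \in Q -> (x < y)%N -> sg y = sg x.
  move=> xQ yQ xy; have Ixy := inv_front hinv Qin xQ yQ xy.
  have xyy : (x <= y <= y)%N by rewrite leqnn ltnW.
  by have [] := Iin (Qal xQ) (Qal yQ) (Qal yQ) xy xyy Ixy.
by move=> sQs s'Q; case: (ltngtP s s') => [/h->|/h->|->].
Qed.

Let between_LQ x s s' : s \in L ++ Q -> s' \in L ++ Q -> x \in al ->
  (s <= x <= s')%N -> x \in L ++ Q.
Proof.
have [_ _ _ pL Lp] := order.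
move=> sLs s'Q; rewrite alE [L ++ Q ++ _]catA mem_cat (mem_cat _ (L ++ Q)).
case/or3P => // xx /andP[sx xs'].
  by have := pL _ _ xx sLs; rewrite ltnNge sx.
by have := Lp _ _ s'Q xx; rewrite ltnNge xs'.
Qed.

Let pre_mem V : V \in pre -> V != [::] /\ {subset V <= flatten pre}.
Proof.
move=> Vp; split; last by move=> z; exact: mem_flatten.
by apply: contraNneq (inv_nonempty hinv) => <-; rewrite mem_cat Vp.
Qed.

Let post_mem V : V \in post -> V != [::] /\ {subset V <= flatten post}.
Proof.
move=> Vp; split; last by move=> z; exact: mem_flatten.
by apply: contraNneq (inv_nonempty hinv) => <-; rewrite mem_cat !inE Vp !orbT.
Qed.

Let zero_al : 0%N \notin al.
Proof. by apply/negP => /(inv_sub hinv); rewrite mem_iota. Qed.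

Let Fl' := [seq s <- Fl | s != head 0 Q].

Let flagged_away W V : head 0 W \notin L -> last 0 W \notin L ->
  head 0 V != head 0 Q -> flagged I Fl W V -> flagged I' Fl' W V.
Proof.
move=> hW lW hV; rewrite /flagged /I' (negbTE hW) (negbTE lW) !orbF.
by move=> /implyP h; apply/implyP => /h; rewrite mem_filter hV.
Qed.

Let merge_flag : mean c Q < mean c L ->
  path (flagged I' Fl') [::] (pre ++ (L ++ Q) :: post).
Proof.
move=> QL; have nLQ := unmet_ends QL.
have [sL sQ LQ pL Lp] := order.
have hL := mem_head0 L0; have hQ := mem_head0 Q0; have lQ := mem_last0 Q0.
have hLQ : head 0 (L ++ Q) = head 0 L by case: (L) L0.
have lLQ : last 0 (L ++ Q) = last 0 Q by rewrite last_cat; case: (Q) Q0.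
have hLLQ : head 0 L \in L ++ Q by rewrite mem_cat hL.
have lQLQ : last 0 Q \in L ++ Q by rewrite mem_cat lQ orbT.
have hQLQ : head 0 Q \in L ++ Q by rewrite mem_cat hQ orbT.
have preN z : z \in flatten pre -> z \notin L /\ z \in al.
  move=> zp; split; last by rewrite alE mem_cat zp.
  by apply/negP => zL; have := pL _ z zp; rewrite mem_cat zL ltnn => /(_ isT).
have postN z : z \in flatten post -> [/\ z \notin L, z \notin Q & z \in al].
  move=> zp; split; last by rewrite alE !mem_cat zp !orbT.
    by apply/negP => zL; have := Lp z _ _ zp; rewrite mem_cat zL ltnn => /(_ isT).
  by apply/negP => zL; have := Lp z _ _ zp; rewrite mem_cat zL orbT ltnn => /(_ isT).
have := inv_flag hinv; rewrite !cat_path /= => /andP[ppre /and3P[fL _ fpost]].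
apply/and3P; split.
- apply: (sub_in_path (P := [in [::] :: pre]) _ _ ppre); last by apply/allP.
  move=> W V; rewrite !inE => /predU1P[->//|Wp] Vp.
  have [W0 Wsub] := pre_mem Wp.
  have [hW _] := preN _ (Wsub _ (mem_head0 W0)).
  have [lW _] := preN _ (Wsub _ (mem_last0 W0)).
  apply: flagged_away => //; case/predU1P: Vp => [->|Vp] /=.
    (* The default head of the empty list is 0, which is not a label, since waves are numbered from
       1. *)
    by apply/eqP => e; case/negP: zero_al; rewrite [X in X \in _]e; exact: Qal.
  have [V0 Vsub] := pre_mem Vp; rewrite neq_ltn.
  by rewrite (pL _ _ (Vsub _ (mem_head0 V0)) hQLQ).
- have := mem_last [::] pre; case: (last [::] pre) => [//|k W]; rewrite inE /= => Wp.
  have [_ Wsub] := pre_mem Wp; rewrite /flagged hLQ lLQ.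
  apply/implyP => /and4P[_ _ + _]; set w := last _ _ => I'w.
  have wp : w \in flatten pre by apply: Wsub; rewrite /w mem_last0.
  have [wL wal] := preN _ wp.
  have Iw : I w (last 0 Q) by case/orP: I'w => // /andP[]; rewrite (negbTE wL).
  have wQ := pL _ _ wp lQLQ; have wL' := pL _ _ wp hLLQ.
  have [|_ _ h] := Iin wal (Lal hL) (Qal lQ) wQ _ Iw.
    by apply/andP; split; apply: ltnW => //; exact: LQ.
  by case/negP: nLQ; apply: h; rewrite LQ.
- case: (post) fpost Lp postN post_mem => //= V post' /andP[_ pV] Lp' postN pm.
  have [V0 Vsub] := pm V (mem_head _ _).
  have hV := Vsub _ (mem_head0 V0).
  have [hVL hVQ hVal] := postN _ hV.
  apply/andP; split.
    rewrite /flagged hLQ lLQ; apply/implyP => /and4P[_ + _ _].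
    rewrite /I' (negbTE hVQ) andbF orbF => Iw.
    have [||_ h _] := Iin (Lal hL) (Qal lQ) hVal _ _ Iw.
    - exact: Lp'.
    - by apply/andP; split; apply: ltnW; [exact: LQ|exact: Lp'].
    - by case/negP: nLQ; apply: h; rewrite LQ.
  apply: (sub_in_path (P := [in V :: post']) _ _ pV); last by apply/allP.
  move=> W U Wp Up.
  have [W0 Wsub] := pm _ Wp.
  have [hW _ _] := postN _ (Wsub _ (mem_head0 W0)).
  have [lW _ _] := postN _ (Wsub _ (mem_last0 W0)).
  apply: flagged_away => //.
  have [U0 Usub] := pm _ Up; rewrite neq_ltn orbC.
  by rewrite (Lp' _ _ hQLQ (Usub _ (mem_head0 U0))).
Qed.

(** The newly met pairs lie within a single front, so no boundary separates them; every remaining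
    boundary is an old one, and its inequalities concern old pairs only. *)
Let merge_inv : mean c Q < mean c L -> sg (head 0 L) = sg (head 0 Q) ->
  state_inv (pre ++ (L ++ Q) :: post) I' Fl'.
Proof.
move=> QL sgLQ; have [sL sQ LQ pL Lp] := order.
have hL := mem_head0 L0; have hQ := mem_head0 Q0.
have hLQ : head 0 (L ++ Q) = head 0 L by case: (L) L0.
have flE : flatten (pre ++ (L ++ Q) :: post) = al by rewrite flatten_mid alE -!catA.
have II' x y : I x y -> I' x y by rewrite /I' => ->.
have sgE x : x \in L ++ Q -> sg x = sg (head 0 L).
  by rewrite mem_cat => /orP[xL|xQ]; [exact: sgL|rewrite sgLQ; exact: sgQ].
have frontI x y : x \in L ++ Q -> y \in L ++ Q -> (x < y)%N -> I' x y.
  rewrite !mem_cat => /orP[xL|xQ] /orP[yL|yQ] xy.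
  - exact/II'/(inv_front hinv Lin).
  - by rewrite /I' xL yQ orbT.
  - by have := LQ _ _ yL xQ; rewrite ltnNge ltnW.
  - exact/II'/(inv_front hinv Qin).
split.
- by rewrite flE.
- by rewrite flE; exact: (inv_sub hinv).
- have := inv_nonempty hinv; rewrite !mem_cat !inE !negb_or => /and4P[-> _ _ ->].
  by case: (L) L0.
- move=> W s s'; rewrite mem_cat inE => /or3P[Wp|/eqP->|Wp]; last 2 first.
  + exact: frontI.
  + by move=> sW s'W ss'; apply/II'/(inv_front hinv _ sW s'W ss'); rewrite mem_cat !inE Wp !orbT.
  + by move=> sW s'W ss'; apply/II'/(inv_front hinv _ sW s'W ss'); rewrite mem_cat Wp.
- rewrite flE => s x s' sal xal s'al ss' sxs' /orP[Is|/andP[sLs s'Q]].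
    have [-> h1 h2] := Iin sal xal s'al ss' sxs' Is.
    by split=> // [/h1|/h2]; exact: II'.
  have sLQ : s \in L ++ Q by rewrite mem_cat sLs.
  have s'LQ : s' \in L ++ Q by rewrite mem_cat s'Q orbT.
  have xLQ := between_LQ sLQ s'LQ xal sxs'.
  by rewrite !sgE//; split=> // xs; exact: frontI.
- rewrite flE => W s s' Wp sal s'al /andP[sW Ws'] Is'.
  have [V Vin Vhead] : exists2 V, V \in pre ++ L :: Q :: post & head 0 V = head 0 W.
    move: Wp; rewrite mem_cat inE => /or3P[Wp|/eqP->|Wp].
    - by exists W => //; rewrite mem_cat Wp.
    - by exists L.
    - by exists W => //; rewrite mem_cat !inE Wp !orbT.
  case/orP: Is' => [Is|/andP[sLs s'Q]].
    by rewrite -Vhead; apply: (inv_sep hinv) => //; rewrite Vhead sW.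
  exfalso; move: Wp; rewrite mem_cat inE => /or3P[Wp|/eqP We|Wp].
  + have [W0 Wsub] := pre_mem Wp.
    have := pL _ s (Wsub _ (mem_head0 W0)); rewrite mem_cat sLs => /(_ isT).
    by rewrite ltnNge ltnW.
  + by move: sW; rewrite We hLQ ltnNge head_le.
  + have [W0 Wsub] := post_mem Wp.
    have := Lp s' _ _ (Wsub _ (mem_head0 W0)); rewrite mem_cat s'Q orbT => /(_ isT).
    by rewrite ltnNge Ws'.
- exact: merge_flag.
Qed.

Lemma merge_step K : 0 <= K -> lip c K (L ++ Q) -> mean c Q < mean c L ->
  sg (head 0 L) = sg (head 0 Q) ->
  exists J Fm, state_inv (pre ++ (L ++ Q) :: post) J Fm /\
    `|mean c (L ++ Q) - mean c L| * (size L)%:R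
    + `|mean c (L ++ Q) - mean c Q| * (size Q)%:R
    + K * potential J Fm (size al) <= K * potential I Fl (size al).
Proof.
move=> K0 li QL sgLQ; exists I', Fl'; split; first exact: merge_inv.
have [sL sQ LQ pL Lp] := order.
have hL := mem_head0 L0; have hQ := mem_head0 Q0.
have lL := mem_last0 L0; have lQ := mem_last0 Q0.
rewrite merge_cost//; last exact: ltW.
have [/= U0 U1 U2] := merge_unmet.
set La := [seq s <- L | _] in U1; set Qb := [seq s <- Q | _] in U2.
set l : R := (size L)%:R; set q : R := (size Q)%:R.
have l0 : 0 < l by exact: size_gt0. have q0 : 0 < q by exact: size_gt0.
set h := l * q / (l + q).
have lq0 : 0 < l + q by rewrite addr_gt0.
have h0 : 0 <= h by rewrite divr_ge0// ?mulr_ge0//; exact: ltW.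
have hl : h <= l by rewrite ler_pdivrMr// ler_wpM2l ?(ltW l0)// lerDr ltW.
have hq : h <= q by rewrite ler_pdivrMr// mulrC ler_wpM2l ?(ltW q0)// lerDl ltW.
(* Harmonic against arithmetic mean: [2 * h] is then at most n/2, the weight of one flag. *)
have h4 : h <= (l + q) / 4.
  rewrite ler_pdivrMr//; have : 0 <= (l - q) ^+ 2 by exact: sqr_ge0.
  move: (l) (q) => x y; lra.
have lqn : l + q <= n%:R.
  rewrite -natrD -size_cat ler_nat -[n](size_iota 1) uniq_leq_size//.
    apply: (subseq_uniq _ (sorted_uniq ltn_trans ltnn s_al)).
    rewrite alE [in X in subseq _ X]catA; apply: (@subseq_trans _ ((L ++ Q) ++ flatten post)).
      exact: prefix_subseq.
    by rewrite -!catA; exact: suffix_subseq.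
  by move=> z; rewrite mem_cat => /orP[/Lal|/Qal]; exact: (inv_sub hinv).
have szF : (size Fl' <= size Fl)%N by rewrite size_filter count_size.
have U0r : (unmet I')%:R <= (unmet I)%:R :> R by rewrite ler_nat.
have U1r : (unmet I')%:R + (size La)%:R * q <= (unmet I)%:R :> R.
  by rewrite -natrM -natrD ler_nat.
have U2r : (unmet I')%:R + l * (size Qb)%:R <= (unmet I)%:R :> R.
  by rewrite -natrM -natrD ler_nat.
have Fr : n%:R * (size Fl')%:R <= n%:R * (size Fl)%:R :> R by rewrite ler_wpM2l// ler_nat.
suff main : 2 * (mean c L - mean c Q) * h <= K * (4 * ((unmet I)%:R - (unmet I')%:R)
    + n%:R / 2 * ((size Fl)%:R - (size Fl')%:R)).
  by rewrite /potential; lra.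
(* If the two waves at the boundary never met, no wave of [L] has met one of [Q]: all products
   [l * q] are first meetings and the crude bound of [lip_mean] suffices. *)
have [Ijn|nIjn] := boolP (I (last 0 L) (head 0 Q)); last first.
  have LaE : La = L.
    apply/all_filterP/allP => s sLs; apply: contra nIjn => Is.
    have [||_ _ hh] := Iin (Lal sLs) (Lal lL) (Qal hQ) _ _ Is; rewrite ?LQ//.
      by rewrite last_ge//= ltnW ?LQ.
    by apply: hh; rewrite LQ.
  rewrite LaE -/l in U1r.
  have := lip_mean L0 Q0 li; rewrite size_cat natrD -/l -/q => mLQ.
  have e1 : 2 * (mean c L - mean c Q) * h <= K * (l * q).
    have -> : K * (l * q) = 2 * (K * (l + q) / 2) * h by rewrite /h; field; rewrite gt_eqF.
    by rewrite ler_wpM2r// ler_wpM2l.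
  apply: (le_trans e1); rewrite ler_wpM2l//.
  have : 0 <= l * q by rewrite mulr_ge0//; exact: ltW.
  lra.
set Lb := [seq s <- L | I s (head 0 Q)]; set Qa := [seq s <- Q | I (last 0 L) s].
have LE : L = La ++ Lb.
  apply: filter_split => // s x sLs xL sx Is.
  have [||_ _ hh] := Iin (Lal sLs) (Lal xL) (Qal hQ) _ _ Is; rewrite ?LQ//.
    by apply/andP; split; apply: ltnW => //; exact: LQ.
  by apply: hh; rewrite LQ.
have QE : Q = Qa ++ Qb.
  rewrite /Qa /Qb [LHS](@filter_split _ (fun s => ~~ I (last 0 L) s))//.
    by congr (_ ++ _); apply: eq_filter => s; rewrite negbK.
  move=> s x sQs xQ sx; apply: contra => Is.
  have [||_ hh _] := Iin (Lal lL) (Qal sQs) (Qal xQ) _ _ Is; rewrite ?LQ//.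
    by apply/andP; split; apply: ltnW => //; exact: LQ.
  by apply: hh; rewrite LQ.
have lLb : last 0 L \in Lb by rewrite mem_filter Ijn.
have hQa : head 0 Q \in Qa by rewrite mem_filter Ijn.
have Lb0 : Lb != [::] by case: (Lb) lLb.
have Qa0 : Qa != [::] by case: (Qa) hQa.
have sLb : sorted ltn Lb by apply: sorted_filter => //; exact: ltn_trans.
have sQa : sorted ltn Qa by apply: sorted_filter => //; exact: ltn_trans.
(* Separation for the first wave of [Lb] and the head of [Q]: the block on the right reduces to one
   wave. *)
have sepL : mean c Lb <= c (head 0 Q).
  have := mem_head0 Lb0; rewrite mem_filter => /andP[IhLb hLb].
  have := sep hLb hQ IhLb.
  have -> : [seq x <- Q | (x <= head 0 Q)%N] = [:: head 0 Q].
    apply: (irr_sorted_eq ltn_trans ltnn) => //.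
      by apply: sorted_filter => //; exact: ltn_trans.
    move=> z; rewrite mem_filter inE; apply/andP/eqP => [[z1 zQ]|->//].
    by apply/eqP; rewrite eqn_leq z1 head_le.
  rewrite mean1.
  have -> // : [seq x <- L | (head 0 Lb <= x)%N] = Lb.
  apply: eq_in_filter => x xL; apply/idP/idP => [hx|Ix]; last first.
    by apply: head_le => //; rewrite mem_filter Ix.
  have [||_ _ hh] := Iin (Lal hLb) (Lal xL) (Qal hQ) _ _ IhLb; rewrite ?LQ//.
    by rewrite hx ltnW ?LQ.
  by apply: hh; rewrite LQ.
have sepQ : c (last 0 L) <= mean c Qa.
  have := mem_last0 Qa0; rewrite mem_filter => /andP[IlQa lQa].
  have := sep lL lQa IlQa.
  have -> : [seq x <- L | (last 0 L <= x)%N] = [:: last 0 L].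
    apply: (irr_sorted_eq ltn_trans ltnn) => //.
      by apply: sorted_filter => //; exact: ltn_trans.
    move=> z; rewrite mem_filter inE; apply/andP/eqP => [[z1 zL]|->//].
    by apply/eqP; rewrite eqn_leq z1 last_ge.
  rewrite mean1.
  have -> // : [seq x <- Q | (x <= last 0 Qa)%N] = Qa.
  apply: eq_in_filter => x xQ; apply/idP/idP => [hx|Ix]; last first.
    by apply: last_ge => //; rewrite mem_filter Ix.
  have [||_ hh _] := Iin (Lal lL) (Qal xQ) (Qal lQa) _ _ IlQa; rewrite ?LQ//.
    by rewrite hx ltnW ?LQ.
  by apply: hh; rewrite LQ.
have [liL liQ] := lip_catP li.
have := merge_cost_le (La := La) (Qb := Qb) K0 _ _ Lb0 Qa0 (lip_junction L0 Q0 li) sepL sepQ.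
rewrite -LE -QE => /(_ liL liQ) mLQ.
set a : R := (size La)%:R in U1r mLQ; set b : R := (size Qb)%:R in U2r mLQ.
have a0 : 0 <= a by []. have b0 : 0 <= b by [].
have e1 : 2 * (mean c L - mean c Q) * h <= K * ((2 + a + b) * h).
  have -> : K * ((2 + a + b) * h) = 2 * (K * (2 + a + b) / 2) * h by field.
  by rewrite ler_wpM2r// ler_wpM2l.
apply: (le_trans e1); rewrite ler_wpM2l//.
have ah : a * h <= a * q by rewrite ler_wpM2l.
have bh : b * h <= l * b by rewrite mulrC ler_wpM2r.
(* As soon as [a] or [b] is at least 1, the constant 2 is absorbed: [(2 + a + b) * h] is at most
   [3 * a * h + b * h], or symmetrically, where [a * h] and [b * h] are each at most the drop of
   [unmet]. *)
have [La0|LaN] := eqVneq La [::]; last first.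
  have a1 : 1 <= a by rewrite ler1n lt0n size_eq0.
  have : h <= a * h by rewrite ler_peMl.
  lra.
have [Qb0|QbN] := eqVneq Qb [::]; last first.
  have b1 : 1 <= b by rewrite ler1n lt0n size_eq0.
  have : h <= b * h by rewrite ler_peMl.
  lra.
have hLb : I (head 0 L) (head 0 Q).
  have : head 0 L \in Lb by rewrite -[Lb]/([::] ++ Lb) -La0 -LE.
  by rewrite mem_filter => /andP[].
have lQa : I (last 0 L) (last 0 Q).
  have : last 0 Q \in Qa by rewrite -[Qa]cats0 -Qb0 -QE.
  by rewrite mem_filter => /andP[].
(* With [La] and [Qb] both empty the boundary is flagged; the merging deletes this flag, which pays
   for the kink. *)
have hF : head 0 Q \in Fl.
  have := inv_flag hinv; rewrite cat_path /= => /andP[_ /and3P[_ + _]].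
  by rewrite /flagged L0 hLb lQa unmet_ends.
have szF1 : (size Fl' < size Fl)%N.
  rewrite size_filter -(count_predC (fun s => s != head 0 Q)) -{1}[count _ _]addn0.
  rewrite ltn_add2l -has_count; apply/hasP; exists (head 0 Q) => //=.
  by rewrite eqxx.
have : n%:R * (size Fl').+1%:R <= n%:R * (size Fl)%:R :> R by rewrite ler_wpM2l// ler_nat.
rewrite -natr1 /a /b La0 Qb0 /=; lra.
Qed.

(** All waves between two waves that have met share their sign, whereas here both a wave of [L] and
    one of [Q] lie between [s] and [s']. *)
Let straddle s s' : sg (head 0 L) <> sg (head 0 Q) -> s \in flatten pre ++ L ->
  s' \in Q ++ flatten post -> ~~ I s s'.
Proof.
have [sL sQ LQ pL Lp] := order.
have lL := mem_last0 L0; have hQ := mem_head0 Q0; have hL := mem_head0 L0.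
have lLQ : last 0 L \in L ++ Q by rewrite mem_cat lL.
have hQLQ : head 0 Q \in L ++ Q by rewrite mem_cat hQ orbT.
move=> sgLQ sp s'p; apply/negP => Is.
have sal : s \in al.
  by move: sp; rewrite alE !mem_cat => /orP[->//|->]; rewrite orbT.
have s'al : s' \in al.
  by move: s'p; rewrite alE !mem_cat => /orP[->|->]; rewrite !orbT.
have sl : (s <= last 0 L)%N.
  move: sp; rewrite mem_cat => /orP[sp|sLs]; first exact/ltnW/pL.
  exact: last_ge.
have ls' : (last 0 L < s')%N.
  move: s'p; rewrite mem_cat => /orP[s'Q|s'p]; first exact: LQ.
  exact: Lp.
have sh : (s < head 0 Q)%N by apply: (leq_ltn_trans sl); exact: LQ.
have hs' : (head 0 Q <= s')%N.
  move: s'p; rewrite mem_cat => /orP[s'Q|s'p]; first exact: head_le.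
  by apply/ltnW/Lp.
have ss' := leq_trans sh hs'.
have [e1 _ _] := Iin sal (Lal lL) s'al ss' (introT andP (conj sl (ltnW ls'))) Is.
have [e2 _ _] := Iin sal (Qal hQ) s'al ss' (introT andP (conj (ltnW sh) hs')) Is.
by apply: sgLQ; rewrite (sgL hL lL) e1 e2.
Qed.

Let pre_sub : {subset pre <= pre ++ L :: Q :: post}.
Proof. by move=> W Wp; rewrite mem_cat Wp. Qed.

Let post_sub : {subset post <= pre ++ L :: Q :: post}.
Proof. by move=> W Wp; rewrite mem_cat !inE Wp !orbT. Qed.

Let flag_pre : path (flagged I Fl) [::] pre.
Proof. by have := inv_flag hinv; rewrite cat_path => /andP[]. Qed.

Let flag_post : sorted (flagged I Fl) post.
Proof.
have := inv_flag hinv; rewrite cat_path => /andP[_ /= /and3P[_ _]].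
exact: path_sorted.
Qed.

(** With k = |B|, the cost nk/2 and the two flags, worth n, fit into the released 3nk/2 because k is
    at least 1. *)
Let potential_drop K (A B : seq nat) x y : 0 <= K -> B != [::] ->
  (size A + size B <= n)%N ->
  size al = (size (flatten pre ++ A ++ flatten post) + 2 * size B)%N ->
  K * (size A)%:R * (size B)%:R / 2 +
    K * potential I [:: x, y & Fl] (size (flatten pre ++ A ++ flatten post))
  <= K * potential I Fl (size al).
Proof.
move=> K0 B0 ABn ->; set a' := size (flatten pre ++ _).
rewrite -!mulrA -mulrDr ler_wpM2l// /potential /= natrD natrM.
rewrite -[(size Fl).+2%:R]natr1 -[(size Fl).+1%:R]natr1.
have b1 : 1 <= (size B)%:R :> R by rewrite ler1n lt0n size_eq0.
have an : (size A)%:R <= n%:R :> R by rewrite ler_nat (leq_trans _ ABn)// leq_addr.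
have n0 : 0 <= n%:R :> R by [].
have : (size A)%:R * (size B)%:R <= n%:R * (size B)%:R :> R.
  by rewrite ler_wpM2r//; lra.
have : n%:R * 1 <= n%:R * (size B)%:R :> R by rewrite ler_wpM2l.
lra.
Qed.

Let size_LQ : (size L + size Q <= n)%N.
Proof.
rewrite -size_cat -[n](size_iota 1) uniq_leq_size//.
  apply: (subseq_uniq _ (sorted_uniq ltn_trans ltnn s_al)).
  rewrite alE [in X in subseq _ X]catA.
  apply: (@subseq_trans _ ((L ++ Q) ++ flatten post)).
    exact: prefix_subseq.
  by rewrite -!catA; exact: suffix_subseq.
by move=> z; rewrite mem_cat => /orP[/Lal|/Qal]; exact: (inv_sub hinv).
Qed.

Lemma cut_right_step K A B Os : 0 <= K -> L = A ++ B -> B != [::] ->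
  size B = size Q -> sg (head 0 L) <> sg (head 0 Q) -> shock c L -> lip c K L ->
  riemann_groups c A Os ->
  exists J Fm, state_inv (pre ++ Os ++ post) J Fm /\
    \sum_(W <- Os) `|mean c W - mean c L| * (size W)%:R
    + K * potential J Fm (size (flatten (pre ++ Os ++ post)))
    <= K * potential I Fl (size al).
Proof.
move=> K0 LE B0 BQ sgLQ shL liL rg; have [sL sQ LQ pL Lp] := order.
have AL z : z \in A -> z \in L by rewrite LE mem_cat => ->.
have BL z : z \in B -> z \in L by rewrite LE mem_cat => ->; rewrite orbT.
exists I, [:: head 0 (flatten Os ++ flatten post), head 0 (flatten post) & Fl].
split.
  (* Nothing is removed to the left of [A], whose first wave is that of the old front [L]. *)
  apply: (state_inv_replace (Z1 := [::]) (Z2 := B ++ Q) (A := A) hinv) => //.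
  - by rewrite [LHS]alE LE -!catA.
  - move=> s z s' sal s'al zBQ ss' Is; apply/negP => /andP[sz zs'].
    have zLQ : z \in L ++ Q.
      by move: zBQ; rewrite /= !mem_cat => /orP[/BL|] ->; rewrite ?orbT.
    have : ~~ I s s'; last by rewrite Is.
    have [_ _ AB] := sorted_catP (etrans (esym (congr1 (sorted ltn) LE)) sL).
    have AZ w : w \in A -> z \in B ++ Q -> (w < z)%N.
      by move=> wA; rewrite mem_cat => /orP[/(AB _ _ wA)//|/(LQ _ _ (AL _ wA))].
    apply: straddle => //.
      move: sal; rewrite !mem_cat => /or3P[->//|/AL ->|sp]; rewrite ?orbT//.
      by have := Lp _ _ zLQ sp; rewrite ltnNge sz.
    move: s'al; rewrite !mem_cat => /or3P[s'p|s'A|->]; rewrite ?orbT//.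
      by have := pL _ _ s'p zLQ; rewrite ltnNge zs'.
    by have := AZ _ s'A zBQ; rewrite ltnNge zs'.
  - by move=> s s' /AL sLs /AL s'L; exact: (inv_front hinv Lin).
  - by move=> _ A0; exists L => //; rewrite LE; case: (A) A0.
have -> : flatten (pre ++ Os ++ post) = flatten pre ++ A ++ flatten post.
  by rewrite !flatten_cat (rg_flatten rg).
apply: le_trans; last first.
  apply: (potential_drop (A := A) (B := B)) => //.
    by rewrite BQ (leq_trans _ size_LQ)// leq_add2r LE size_cat leq_addr.
  rewrite alE LE !size_cat -BQ mul2n -addnn -!addnA; congr (_ + (_ + _))%N.
  by rewrite addnA addnC.
by rewrite lerD2r LE; apply: cut_right_cost => //; rewrite -LE.
Qed.

Lemma cut_left_step K A B Os : 0 <= K -> Q = B ++ A -> B != [::] ->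
  size B = size L -> sg (head 0 L) <> sg (head 0 Q) -> shock c Q -> lip c K Q ->
  riemann_groups c A Os ->
  exists J Fm, state_inv (pre ++ Os ++ post) J Fm /\
    \sum_(W <- Os) `|mean c W - mean c Q| * (size W)%:R
    + K * potential J Fm (size (flatten (pre ++ Os ++ post)))
    <= K * potential I Fl (size al).
Proof.
move=> K0 QE B0 BL sgLQ shQ liQ rg; have [sL sQ LQ pL Lp] := order.
have AQ z : z \in A -> z \in Q by rewrite QE mem_cat => ->; rewrite orbT.
have BQ z : z \in B -> z \in Q by rewrite QE mem_cat => ->.
exists I, [:: head 0 (flatten Os ++ flatten post), head 0 (flatten post) & Fl].
split.
  apply: (state_inv_replace (Z1 := L ++ B) (Z2 := [::]) (A := A) hinv) => //.
  - by rewrite [LHS]alE QE -!catA.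
  - move=> s z s' sal s'al zLB ss' Is; apply/negP => /andP[sz zs'].
    rewrite cats0 in zLB.
    have zLQ : z \in L ++ Q.
      by move: zLB; rewrite /= !mem_cat => /orP[|/BQ] ->; rewrite ?orbT.
    have : ~~ I s s'; last by rewrite Is.
    have [_ _ BA] := sorted_catP (etrans (esym (congr1 (sorted ltn) QE)) sQ).
    have ZA w : w \in A -> z \in L ++ B -> (z < w)%N.
      move=> wA; rewrite mem_cat => /orP[zL|/BA]; last exact.
      exact: LQ zL (AQ _ wA).
    apply: straddle => //.
      move: sal; rewrite !mem_cat => /or3P[->//|sA|sp]; rewrite ?orbT//.
        by have := ZA _ sA zLB; rewrite ltnNge sz.
      by have := Lp _ _ zLQ sp; rewrite ltnNge sz.
    move: s'al; rewrite !mem_cat => /or3P[s'p|/AQ ->//|->]; rewrite ?orbT//.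
    by have := pL _ _ s'p zLQ; rewrite ltnNge zs'.
  - by move=> s s' /AQ sQs /AQ s'Q; exact: (inv_front hinv Qin).
  - by move=> LB0; case: (L) L0 LB0.
have -> : flatten (pre ++ Os ++ post) = flatten pre ++ A ++ flatten post.
  by rewrite !flatten_cat (rg_flatten rg).
apply: le_trans; last first.
  apply: (potential_drop (A := A) (B := B)) => //.
    by rewrite BL (leq_trans _ size_LQ)// addnC leq_add2l QE size_cat leq_addl.
  rewrite alE QE !size_cat -BL mul2n -addnn -!addnA; congr (_ + _)%N.
  by rewrite addnA addnC -addnA.
by rewrite lerD2r QE; apply: cut_left_cost => //; rewrite -QE.
Qed.

End interaction.

End dynamics.

(** * The invariant at the initial time and the size of the potential *)

Section initial_state.
Context {R : realFieldType}.
Variables (c sg : nat -> R) (n : nat) (Ws : seq (seq nat)).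
Hypothesis sWs : sorted ltn (flatten Ws).

Lemma front_contiguous W s x s' : W \in Ws -> s \in W -> s' \in W ->
  x \in flatten Ws -> (s <= x <= s')%N -> x \in W.
Proof.
move=> WW; case/splitPr: WW sWs => p q; rewrite flatten_mid.
move=> /sorted_catP[_ /sorted_catP[_ _ h1] h2] sW s'W.
rewrite !mem_cat => /or3P[xp|//|xq] /andP[sx xs'].
  by have := h2 _ s xp; rewrite mem_cat sW ltnNge sx => /(_ isT).
by have := h1 _ _ s'W xq; rewrite ltnNge xs'.
Qed.

Lemma front_disjoint W V z : W \in Ws -> V \in Ws -> z \in W -> z \in V -> W = V.
Proof.
move=> WW; case/splitPr: WW sWs => p q; rewrite flatten_mid.
move=> /sorted_catP[_ /sorted_catP[_ _ h1] h2].
rewrite mem_cat inE => /or3P[Vp|/eqP->//|Vq] zW zV.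
  have := h2 _ z (mem_flatten Vp zV).
  by rewrite mem_cat zW ltnn => /(_ isT).
by have := h1 _ _ zW (mem_flatten Vq zV); rewrite ltnn.
Qed.

Definition same_front : rel nat := fun s s' => has (fun W => (s \in W) && (s' \in W)) Ws.

(** Two waves count as having met exactly when they share a front. Such a pair never straddles a
    boundary, so separation is vacuous and no flag is required. *)
Lemma state_inv_initial : {subset flatten Ws <= iota 1 n} -> [::] \notin Ws ->
  (forall W s s', W \in Ws -> s \in W -> s' \in W -> sg s = sg s') ->
  state_inv c sg n Ws same_front [::].
Proof.
move=> sub ne sgW; split => //.
- by move=> W s s' WW sW s'W _; apply/hasP; exists W; rewrite ?sW.
- move=> s x s' _ xal _ ss' sxs' /hasP[W WW /andP[sW s'W]].
  have xW := front_contiguous WW sW s'W xal sxs'.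
  by split=> [|_|_]; [exact: sgW xW sW| |]; apply/hasP; exists W; rewrite ?sW ?xW.
- move=> W s s' WW _ _ sWs' /hasP[V VV /andP[sV s'V]].
  have hW : head 0%N W \in W by rewrite mem_head0//; apply: contraNneq ne => <-.
  have hV : head 0%N W \in V.
    apply: (front_contiguous VV sV s'V (mem_flatten WW hW)).
    by case/andP: sWs' => /ltnW -> ->.
  have e := front_disjoint WW VV hW hV; rewrite -e in sV.
  have : (head 0%N W <= s)%N.
    apply: head_le sV; case/splitPr: WW sWs => p q; rewrite flatten_mid.
    by move=> /sorted_catP[_ /sorted_catP[]].
  by rewrite leqNgt; case/andP: sWs' => ->.
- apply/(pathP [::]) => i iWs.
  have : nth [::] ([::] :: Ws) i \in [::] :: Ws by rewrite mem_nth//= ltnW.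
  have : nth [::] Ws i \in Ws by rewrite mem_nth.
  move: (nth _ _ _) (nth _ _ _) => W V VV; rewrite inE => /predU1P[->//|WW].
  apply/implyP => /and4P[W0 /hasP[U UU /andP[hW hV]] _].
  have V0 : V != [::] by apply: contraNneq ne => <-.
  have eW := front_disjoint WW UU (mem_head0 W0) hW.
  have eV := front_disjoint VV UU (mem_head0 V0) hV.
  case/negP; apply/hasP; exists U => //.
  by rewrite hW /= -eV mem_last0.
Qed.

End initial_state.

Lemma unmet_le (n : nat) (I : rel nat) : (unmet n I * 2 <= n * n)%N.
Proof.
have h : (unmet n I <= \sum_(s <- iota 1 n) \sum_(s' <- iota 1 n) (s < s'))%N.
  apply: leq_sum => s _; apply: leq_sum => s' _.
  by case: (s < s')%N => //; case: (I s s').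
have h' : (unmet n I <= \sum_(s <- iota 1 n) \sum_(s' <- iota 1 n) (s' < s))%N.
  by rewrite exchange_big.
rewrite muln2 -addnn; apply: (leq_trans (leq_add h h')).
rewrite -big_split /=.
have -> : (n * n = \sum_(s <- iota 1 n) \sum_(s' <- iota 1 n) 1)%N.
  by rewrite !big_const_seq !count_predT !size_iota !iter_addn_0 mul1n.
apply: leq_sum => s _; rewrite -big_split /=; apply: leq_sum => s' _.
by case: ltngtP.
Qed.

(** At most half of the n by n square consists of increasing pairs, so the value is at most (2 +
    3/4) times the square of n. *)
Lemma potential_le (R : realFieldType) (n : nat) I (a : nat) : (a <= n)%N ->
  @potential R n I [::] a <= 3 * n%:R ^+ 2.
Proof.
move=> an; rewrite /potential /= mulr0 addr0.
have : (unmet n I)%:R * 2 <= n%:R * n%:R :> R by rewrite -!natrM ler_nat unmet_le.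
have : n%:R * a%:R <= n%:R * n%:R :> R by rewrite ler_wpM2l// ler_nat.
have : 0 <= n%:R * n%:R :> R by rewrite mulr_ge0.
by rewrite expr2; lra.
Qed.

Lemma potential_ge0 (R : realFieldType) n I Fl a : 0 <= @potential R n I Fl a.
Proof. by rewrite /potential !addr_ge0// !mulr_ge0// invr_ge0. Qed.

(** * Envelopes of a cellwise affine flux *)

Section groups_take.
Context {R : realFieldType}.
Variable c : nat -> R.

Lemma groups_take Os (mu : R) j : sorted ltn (flatten Os) ->
  (forall W, W \in Os -> shock c W) -> (forall W, W \in Os -> mu <= mean c W) ->
  0 <= \sum_(z <- take j (flatten Os)) (c z - mu).
Proof.
move=> s sh le; have [jlt|jge] := ltnP j (size (flatten Os)).
  have e : flatten Os = take j (flatten Os) ++ nth 0%N (flatten Os) j :: drop j.+1 (flatten Os).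
    by rewrite -drop_nth// cat_take_drop.
  by rewrite -(sum_lo (Q := drop j.+1 (flatten Os)) (y := nth 0%N (flatten Os) j)) -?e// groups_lo.
rewrite take_oversize// big_flatten /= big_seq sumr_ge0// => W WO.
by rewrite sum_sub_mean mulr_ge0// subr_ge0 le.
Qed.

Lemma groups_drop Os (mu : R) j : sorted ltn (flatten Os) ->
  (forall W, W \in Os -> shock c W) -> (forall W, W \in Os -> mean c W <= mu) ->
  \sum_(z <- drop j (flatten Os)) (c z - mu) <= 0.
Proof.
move=> s sh le; have [jlt|jge] := ltnP j (size (flatten Os)); last first.
  by rewrite drop_oversize// big_nil.
have e : flatten Os = take j (flatten Os) ++ nth 0%N (flatten Os) j :: drop j.+1 (flatten Os).
  by rewrite -drop_nth// cat_take_drop.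
rewrite (drop_nth 0%N jlt) -(sum_hi (P := take j (flatten Os))) -?e//.
exact: groups_hi.
Qed.

End groups_take.

Section envelope.
Context {R : realType}.
Variables (c : nat -> R) (eps a : R) (h : R -> R) (A : seq nat) (Os : seq (seq nat)).
Hypotheses (eps0 : 0 < eps) (A0 : A != [::]) (sA : sorted ltn A).
Hypothesis rg : riemann_groups c A Os.
Hypothesis cells : forall k x, (k < size A)%N -> 0 <= x <= eps ->
  h (a + k%:R * eps + x) = h (a + k%:R * eps) + c (nth 0%N A k) * x.

Let b := a + (size A)%:R * eps.
Let pos (o : seq (seq nat)) := a + (size (flatten o))%:R * eps.
Let E := convex_env a b h.

Let h_grid k : (k <= size A)%N ->
  h (a + k%:R * eps) = h a + eps * \sum_(z <- take k A) c z.
Proof.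
elim: k => [|k IH] kA; first by rewrite mul0r addr0 take0 big_nil mulr0 addr0.
rewrite (take_nth 0%N kA) -cats1 big_cat big_seq1 /= mulrDr addrA -IH 1?ltnW//.
rewrite -natr1 mulrDl mul1r addrA cells ?(ltW eps0) ?lexx// [eps * _]mulrC//.
Qed.

Let cell_of u : a <= u <= b -> exists k, (k < size A)%N /\
  0 <= u - (a + k%:R * eps) <= eps.
Proof.
move=> /andP[au ub].
have n0 : (0 < size A)%N by rewrite lt0n size_eq0.
(* The right end is put into the last cell; the truncated quotient would give the index of a cell
   beyond it. *)
have [ltub|bu] := ltP u b; last first.
  exists (size A).-1; rewrite ltn_predL n0; split=> //.
  have -> : u = b by apply/eqP; rewrite eq_le ub bu.
  have e : (size A)%:R = (size A).-1%:R + 1 :> R by rewrite natr1 prednK.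
  rewrite /b e; move: (size A).-1%:R => m.
  have -> : a + (m + 1) * eps - (a + m * eps) = eps by ring.
  by rewrite lexx ltW.
have v0 : 0 <= (u - a) / eps by rewrite divr_ge0 ?subr_ge0// ltW.
have := truncn_itv v0; set k := Num.truncn _ => /andP[k1 k2].
exists k; rewrite ler_pdivlMr// in k1; rewrite ltr_pdivrMr// in k2.
split; last by rewrite -natr1 in k2; apply/andP; split; lra.
rewrite -(ltr_nat R) -(ltr_pM2r eps0); apply: le_lt_trans k1 _.
by move: ltub; rewrite /b; lra.
Qed.

Section piece.
Variables (o1 o2 : seq (seq nat)) (W : seq nat).
Hypothesis OsE : Os = o1 ++ W :: o2.
Let p := pos o1.
Let q := p + (size W)%:R * eps.
Let ell u := h p + mean c W * (u - p).

Let AE : A = flatten o1 ++ flatten (W :: o2).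
Proof. by rewrite -(rg_flatten rg) OsE flatten_cat. Qed.

Let W0 : W != [::].
Proof.
by apply: contraNneq (rg_nonempty rg) => <-; rewrite OsE mem_cat inE eqxx orbT.
Qed.

Lemma group_mean_le V : V \in o1 -> mean c V < mean c W.
Proof.
move=> V1; have := rg_speed rg; rewrite OsE => /speed_cat; apply => //.
by rewrite inE eqxx.
Qed.

Lemma group_mean_ge V : V \in o2 -> mean c W < mean c V.
Proof. by have := rg_speed rg; rewrite OsE => /cat_sorted2[_] /= /speed_le h' /h'. Qed.

Let excess k : (k <= size A)%N -> h (a + k%:R * eps) - ell (a + k%:R * eps) =
  eps * (\sum_(z <- take k A) (c z - mean c W)
         - \sum_(z <- flatten o1) (c z - mean c W)).
Proof.
move=> kA; rewrite /ell /p /pos !h_grid//; last by rewrite AE size_cat leq_addr.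
have -> : take (size (flatten o1)) A = flatten o1 by rewrite AE take_size_cat.
rewrite !sum_sub size_takel//; ring.
Qed.

(** Left of [p] the groups have smaller slopes than [ell], right of it not smaller ones; a grid
    point inside a group is covered by its shock condition. *)
Let ell_grid k : (k <= size A)%N -> ell (a + k%:R * eps) <= h (a + k%:R * eps).
Proof.
move=> kA; rewrite -subr_ge0 excess// pmulr_rge0// subr_ge0.
have := sA; rewrite {1}AE => /sorted_catP[s1 s2 _].
have sh V : V \in Os -> shock c V by exact: (rg_shock rg).
rewrite AE take_cat; case: ltnP => [k1|k1].
  rewrite -[X in \sum_(z <- X) _ <= _](cat_take_drop k) big_cat /= gerDl.
  apply: groups_drop => // V V1; first by apply: sh; rewrite OsE mem_cat V1.
  by rewrite ltW ?group_mean_le.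
rewrite big_cat /= lerDl; apply: (groups_take (Os := W :: o2)) => // V V2.
  by apply: sh; rewrite OsE mem_cat V2 orbT.
by move: V2; rewrite inE => /predU1P[->//|V2]; rewrite ltW ?group_mean_ge.
Qed.

Let ell_le u : a <= u <= b -> ell u <= h u.
Proof.
move=> /cell_of[k [kA]]; set x := u - _ => x01.
have -> : u = a + k%:R * eps + x by rewrite /x; ring.
rewrite cells//; have e1 := ell_grid (ltnW kA); have e2 := ell_grid kA.
have e3 : h (a + k.+1%:R * eps) = h (a + k%:R * eps) + c (nth 0%N A k) * eps.
  by rewrite -cells ?lexx ?(ltW eps0)// -natr1; congr h; ring.
rewrite e3 in e2; move: e1 e2; rewrite /ell -natr1.
set hp := h p; set y := h _; set m := mean c W; set cc := c _.
case/andP: x01 => x0 x1 e1 e2.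
(* Times [eps], the gap between [h] and [ell] is the combination with weights [eps - x] and [x] of
   the gaps at the two ends of the cell. *)
rewrite -subr_ge0 -(pmulr_rge0 _ eps0).
have : 0 <= (eps - x) * (y - (hp + m * (a + k%:R * eps - p))).
  by rewrite mulr_ge0 ?subr_ge0.
have : 0 <= x * (y + cc * eps - (hp + m * (a + (k%:R + 1) * eps - p))).
  by rewrite mulr_ge0// subr_ge0.
lra.
Qed.

Let ell_minorant : convex_minorants a b h ell.
Proof.
split; last exact: ell_le.
move=> t x y _ _; rewrite le_eqVlt; apply/orP; left; apply/eqP.
set tn : R := t%:num.
rewrite -[LHS]/(h p + mean c W * (tn * x + (1 - tn) * y - p)).
rewrite -[RHS]/(tn * (h p + mean c W * (x - p)) + (1 - tn) * (h p + mean c W * (y - p))).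
ring.
Qed.

Let pq_ab : [/\ a <= p, p < q & q <= b].
Proof.
have WR : 0 < (size W)%:R * eps by rewrite mulr_gt0// size_gt0.
split; first by rewrite lerDl mulr_ge0// ltW.
  by rewrite ltrDl.
rewrite /q /p /pos /b -addrA lerD2l -mulrDl -natrD ler_wpM2r ?(ltW eps0)// ler_nat.
by rewrite AE size_cat leq_add2l /= size_cat leq_addr.
Qed.

Let ell_q : h q = ell q.
Proof.
have -> : q = a + (size (flatten o1) + size W)%:R * eps.
  by rewrite /q /p /pos natrD; ring.
have kA : (size (flatten o1) + size W <= size A)%N.
  by rewrite AE size_cat leq_add2l /= size_cat leq_addr.
apply/eqP; rewrite -subr_eq0 excess// AE takeD take_size_cat//.
rewrite drop_size_cat//= take_size_cat// big_cat /= (sum_sub_mean c W) subrr mul0r addr0.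
by rewrite subrr mulr0.
Qed.

(** The line [ell] is a convex minorant, so [E] is above it; at [p] and [q] it touches [h], so
    convexity keeps [E] below it in between. *)
Lemma env_piece u : p <= u <= q -> E u = ell u.
Proof.
have [ap pq qb] := pq_ab; move=> /andP[pu uq].
have uab : a <= u <= b by rewrite (le_trans ap pu) (le_trans uq qb).
have [[Econv Eh] Emax] : convex_minorants a b h E /\
    forall m, convex_minorants a b h m -> forall u, a <= u <= b -> m u <= E u.
  by apply: convex_env_largest; exists ell.
apply/eqP; rewrite eq_le Emax// andbT.
pose t := (q - u) / (q - p).
have qp0 : 0 < q - p by rewrite subr_gt0.
have t01 : 0 <= t <= 1.
  by rewrite /t divr_ge0 ?subr_ge0 ?(ltW pq)//= ler_pdivrMr// mul1r lerD2l lerN2.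
have [t0 t1] := andP t01.
have ph : p \in (`[a, b] : set R^o) by rewrite inE /= in_itv /= ap (le_trans (ltW pq)).
have qh : q \in (`[a, b] : set R^o) by rewrite inE /= in_itv /= qb (le_trans ap (ltW pq)).
have := Econv (Itv01 t0 t1) p q ph qh.
rewrite -[leLHS]/(E (t * p + (1 - t) * q)) -[leRHS]/(t * E p + (1 - t) * E q).
have -> : t * p + (1 - t) * q = u.
  by rewrite /t; field; rewrite gt_eqF.
move=> /le_trans; apply.
have hp : E p <= ell p.
  by rewrite /ell subrr mulr0 addr0 Eh// ap (le_trans (ltW pq)).
have hq : E q <= ell q by rewrite -ell_q Eh// qb (le_trans ap (ltW pq)).
apply: (@le_trans _ _ (t * ell p + (1 - t) * ell q)).
  by apply: lerD; apply: ler_wpM2l => //; rewrite subr_ge0.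
rewrite le_eqVlt; apply/orP; left; apply/eqP; rewrite /ell /t; field.
by rewrite gt_eqF.
Qed.

Lemma env_affine : affine_on E p q (mean c W).
Proof. by move=> u w up wp; rewrite !env_piece// /ell; ring. Qed.

Lemma piece_bounds : [/\ a <= p, p < q & q <= b].
Proof. exact: pq_ab. Qed.

End piece.

Lemma affine_slope (g : R -> R) p q p' q' s s' x y : affine_on g p q s ->
  affine_on g p' q' s' -> x < y -> p <= x -> y <= q -> p' <= x -> y <= q' -> s = s'.
Proof.
move=> hg hg' xy px yq px' yq'.
have e : s * (y - x) = s' * (y - x).
  rewrite -hg ?px ?yq ?(le_trans px (ltW xy)) ?(le_trans (ltW xy) yq)//.
  by rewrite -hg' ?px' ?yq' ?(le_trans px' (ltW xy)) ?(le_trans (ltW xy) yq').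
by apply: mulIf e; rewrite subr_eq0 gt_eqF.
Qed.

Let pos_rcons o W : pos (rcons o W) = pos o + (size W)%:R * eps.
Proof. by rewrite /pos -cats1 flatten_cat size_cat /= cats0 natrD; ring. Qed.

(** A longer affine interval would overlap the piece of a neighbouring group, whose slope is
    strictly different. *)
Lemma maximal_group o1 W o2 : Os = o1 ++ W :: o2 ->
  maximal_affine_piece a b E (pos o1) (pos o1 + (size W)%:R * eps) (mean c W).
Proof.
move=> OsE; have [ap pq qb] := piece_bounds OsE.
have aff := env_affine OsE.
set p := pos o1 in ap pq aff *; set q := p + _ in pq qb aff *.
split=> // p' q' s' /andP[ap' p'p] /andP[qq' q'b] aff'.
have s'E : mean c W = s' by apply: (affine_slope aff aff' pq).
split; apply/eqP; rewrite eq_le ?p'p ?qq' ?andbT /= leNgt; apply/negP.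
- case/lastP: o1 OsE @p @q p'p ap aff pq qb qq' => [|o V] OsE p q p'p ap aff pq qb qq' p'lt.
    by move: p'lt; rewrite /p /pos /= mul0r addr0 ltNge ap'.
  have OsE' : Os = o ++ V :: W :: o2 by rewrite OsE cat_rcons.
  have affV := env_affine OsE'; have [_ pV _] := piece_bounds OsE'.
  have pE : pos o + (size V)%:R * eps = p by rewrite /p pos_rcons.
  rewrite pE in affV pV.
  have : mean c V = s'.
    apply: (@affine_slope _ _ _ _ _ _ _ (Num.max (pos o) p') p affV aff').
    - by rewrite gt_max pV p'lt.
    - by rewrite le_max lexx.
    - by [].
    - by rewrite le_max lexx orbT.
    - exact: le_trans (ltW pq) qq'.
  have := group_mean_ge OsE' (mem_head _ _).
  by rewrite s'E => + e; rewrite e ltxx.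
- move=> qlt; case: o2 OsE => [|V o2] OsE.
    have : b = q.
      rewrite /b /q /p /pos -(rg_flatten rg) OsE flatten_cat size_cat /= cats0 natrD.
      ring.
    by move=> bq; move: qlt; rewrite -bq ltNge q'b.
  have OsE' : Os = rcons o1 W ++ V :: o2 by rewrite cat_rcons.
  have affV := env_affine OsE'; have [_ qV _] := piece_bounds OsE'.
  rewrite pos_rcons -/p -/q in affV qV.
  have : mean c V = s'.
    apply: (@affine_slope _ _ _ _ _ _ _ q (Num.min q' (q + (size V)%:R * eps)) affV aff').
    - by rewrite lt_min qlt qV.
    - by [].
    - by rewrite ge_min lexx orbT.
    - exact: le_trans p'p (ltW pq).
    - by rewrite ge_min lexx.
  have := group_mean_ge OsE (mem_head _ _).
  by rewrite s'E => + e; rewrite e ltxx.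
Qed.

Let group_at u : a <= u -> u < b -> exists o1 W o2,
  [/\ Os = o1 ++ W :: o2, pos o1 <= u & u < pos o1 + (size W)%:R * eps].
Proof.
move=> au ub.
suff main o1 o2 : Os = o1 ++ o2 -> pos o1 <= u -> exists o1 W o2,
    [/\ Os = o1 ++ W :: o2, pos o1 <= u & u < pos o1 + (size W)%:R * eps].
  by apply: (main [::] Os) => //; rewrite /pos /= mul0r addr0.
elim: o2 o1 => [|W o2 IH] o1 OsE pu.
  move: ub; rewrite ltNge /b -(rg_flatten rg) OsE cats0 => /negP[]; exact: pu.
have [uq|qu] := ltP u (pos o1 + (size W)%:R * eps); first by exists o1, W, o2.
by apply: (IH (rcons o1 W)); rewrite ?cat_rcons// pos_rcons.
Qed.

Lemma maximal_groupP p q s : maximal_affine_piece a b E p q s ->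
  exists o1 W o2, [/\ Os = o1 ++ W :: o2, p = pos o1,
    q = pos o1 + (size W)%:R * eps & s = mean c W].
Proof.
case=> ap pq qb aff pmax.
have [ o1 [W [ o2 [OsE p1 p2]]]] := group_at ap (lt_le_trans pq qb).
exists o1, W, o2.
have [aW WW Wb] := piece_bounds OsE; have affW := env_affine OsE.
have sE : s = mean c W.
  apply: (@affine_slope _ _ _ _ _ _ _ p (Num.min q (pos o1 + (size W)%:R * eps)) aff affW).
  - by rewrite lt_min pq p2.
  - by [].
  - by rewrite ge_min lexx.
  - by [].
  - by rewrite ge_min lexx orbT.
have qW : q <= pos o1 + (size W)%:R * eps.
  rewrite leNgt; apply/negP => Wq; case: o2 OsE => [|V o2] OsE.
    have bE : b = pos o1 + (size W)%:R * eps.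
      rewrite /b /pos -(rg_flatten rg) OsE flatten_cat size_cat /= cats0 natrD.
      ring.
    by move: Wq; rewrite -bE ltNge qb.
  have OsE' : Os = rcons o1 W ++ V :: o2 by rewrite cat_rcons.
  have affV := env_affine OsE'; have [_ qV _] := piece_bounds OsE'.
  rewrite pos_rcons in affV qV.
  have : s = mean c V.
    apply: (@affine_slope _ _ _ _ _ _ _ (pos o1 + (size W)%:R * eps)
      (Num.min q (pos o1 + (size W)%:R * eps + (size V)%:R * eps)) aff affV).
    - by rewrite lt_min Wq qV.
    - exact: ltW.
    - by rewrite ge_min lexx.
    - by [].
    - by rewrite ge_min lexx orbT.
  have := group_mean_ge OsE (mem_head _ _).
  by rewrite sE => + e; rewrite e ltxx.
have [] := pmax (pos o1) (pos o1 + (size W)%:R * eps) (mean c W).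
- by rewrite aW.
- by rewrite qW.
- exact: affW.
by move=> -> ->.
Qed.

End envelope.

(** * Negative jumps by reflection of the flux *)

Section reflection.
Context {R : realType}.
Implicit Types (g C : R -> R) (a b p q s : R).

Lemma convex_reflect (k : R -> R) a b : convex_on a b k ->
  convex_on (- b) (- a) (fun w => k (- w)).
Proof.
move=> kc t x y; rewrite !inE /= !in_itv /= => /andP[x1 x2] /andP[y1 y2].
have := kc t (- x) (- y); rewrite !inE /= !in_itv /=.
rewrite lerNr lerNl x1 x2 lerNr lerNl y1 y2 => /(_ isT isT).
set tn : R := t%:num.
rewrite -[leLHS]/(k (tn * - x + (1 - tn) * - y)).
rewrite -[X in _ -> X <= _]/(k (- (tn * x + (1 - tn) * y))).
by rewrite !mulrN opprD.
Qed.

(** The point reflection of graphs through the origin exchanges concave majorants and convex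
    minorants and preserves slopes, so the wave speeds stay the same. *)
Lemma concave_env_reflect g a b u :
  concave_env a b g u = - convex_env (- b) (- a) (fun w => - g (- w)) (- u).
Proof.
rewrite /concave_env /convex_env /inf; congr (- sup _).
rewrite image_comp; apply/seteqP; split=> _ /= [m [mc mg] <-].
- exists (fun w => - m (- w)); rewrite ?opprK//; split.
    exact: (convex_reflect mc).
  by move=> w /andP[w1 w2]; rewrite lerN2 mg// lerNr w2 lerNl w1.
- exists (fun w => - m (- w)); rewrite /= ?opprK//; split.
    rewrite /concave_on -[a]opprK -[b]opprK.
    have -> : (\- (fun w => - m (- w))) = (fun w => m (- w)).
      by apply/funext => w /=; rewrite opprK.
    exact: (convex_reflect mc).
  move=> w /andP[w1 w2]; rewrite lerNr; have := mg (- w).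
  by rewrite opprK; apply; rewrite !lerN2 w1 w2.
Qed.

Lemma affine_reflect g p q s : affine_on g p q s ->
  affine_on (fun u => - g (- u)) (- q) (- p) s.
Proof.
move=> h u w /andP[u1 u2] /andP[w1 w2].
have := h (- w) (- u); rewrite !(lerNr p) !(lerNl _ q) u1 u2 w1 w2.
move=> /(_ isT isT) e; rewrite opprK addrC e; ring.
Qed.

Lemma maximal_affine_reflect g a b p q s : maximal_affine_piece a b g p q s ->
  maximal_affine_piece (- b) (- a) (fun u => - g (- u)) (- q) (- p) s.
Proof.
case=> ap pq qb aff pmax; split; rewrite ?lerN2 ?ltrN2//.
  exact: affine_reflect.
move=> q' p' s' /andP[bq' q'q] /andP[pp' p'a] aff'.
have [|||e1 e2] := pmax (- p') (- q') s'.
- by rewrite lerNr p'a lerNl pp'.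
- by rewrite lerNr q'q lerNl bq'.
- have := affine_reflect aff'.
  have -> // : (fun u : R => - - g (- - u)) = g by apply/funext => u; rewrite !opprK.
- by rewrite -e1 -e2 !opprK.
Qed.

End reflection.

(** * Riemann fans as lists of fronts *)

Section riemann.
Context {R : realType}.
Variables (c : nat -> R) (eps : R).
Implicit Types (g : R -> R) (A W : seq nat) (Os : seq (seq nat)) (d : R).

(* The fronts issued from [(t, x)] with leftmost state [l]; [d] is [eps] or [- eps]. *)
Fixpoint group_fronts (t x l d : R) Os : seq (wavefront R) :=
  if Os is W :: Os' then
    let r := l + (size W)%:R * d in
    Wavefront t x l r (mean c W) :: group_fronts t x r d Os'
  else [::].

Lemma mem_group_fronts t x l d Os phi : phi \in group_fronts t x l d Os <->
  exists o1 W o2, Os = o1 ++ W :: o2 /\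
    phi = Wavefront t x (l + (size (flatten o1))%:R * d)
      (l + (size (flatten o1))%:R * d + (size W)%:R * d) (mean c W).
Proof.
elim: Os l => [|V Os IH] l /=.
  by split=> // -[ o1 [W [ o2 []]]]; case: o1.
rewrite inE; split=> [/orP[/eqP->|/IH[ o1 [W [ o2 [-> ->]]]]]|].
- by exists [::], V, Os; rewrite /= mul0r addr0.
- exists (V :: o1), W, o2; split=> //=; congr Wavefront.
    by rewrite size_cat natrD; ring.
  by rewrite size_cat natrD; ring.
move=> [[|U o1] [W [ o2 [/= [VE OsE] phiE]]]].
  by rewrite phiE VE mul0r addr0 eqxx.
apply/orP; right; apply/IH; exists o1, W, o2; split=> //.
by rewrite phiE VE; congr Wavefront; rewrite size_cat natrD; ring.
Qed.

(* [S] is the sign of the jump: the states of the fan are [ul + S * k * eps]. *)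
Record fan g (S ul ur : R) A Os : Prop := {
  fan_sign : S = 1 \/ S = -1;
  fan_nonempty : A != [::];
  fan_sorted : sorted ltn A;
  fan_right : ur = ul + (size A)%:R * (S * eps);
  fan_groups : riemann_groups c A Os;
  fan_cells : forall k x, (k < size A)%N -> 0 <= x <= eps ->
    g (ul + S * (k%:R * eps + x)) = g (ul + S * (k%:R * eps))
      + S * (c (nth 0%N A k) * x)
}.

Definition fan_env (S ul ur : R) g : R -> R :=
  if S == 1 then convex_env ul ur g else concave_env ur ul g.

Hypothesis eps0 : 0 < eps.

Lemma riemann_front_groups g t x S ul ur A Os phi : fan g S ul ur A Os ->
  riemann_front g t x ul ur phi <-> phi \in group_fronts t x ul (S * eps) Os.
Proof.
case=> hS A0 sA ->{ur} rg cells; rewrite mem_group_fronts.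
have sz0 : 0 < (size A)%:R * eps by rewrite mulr_gt0// size_gt0.
case: hS cells => -> cells.
  have cells' k y : (k < size A)%N -> 0 <= y <= eps ->
      g (ul + k%:R * eps + y) = g (ul + k%:R * eps) + c (nth 0%N A k) * y.
    by move=> kA yeps; have := cells k y kA yeps; rewrite !mul1r addrA.
  rewrite mul1r; case: phi => pt px pl pr ps; rewrite /riemann_front /=.
  split=> [[-> -> [[_ pmax]|[lt _]]]|].
  - have [ o1 [W [ o2 [e1 -> -> ->]]]] := maximal_groupP eps0 A0 sA rg cells' pmax.
    by exists o1, W, o2.
  - by move: lt; rewrite ltNge lerDl ltW.
  - move=> [ o1 [W [ o2 [e1 [-> -> -> -> ->]]]]]; split=> //; left; split.
      by rewrite ltrDl.
    exact: (maximal_group eps0 A0 sA rg cells' e1).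
(* For a negative jump the reflected flux satisfies the hypotheses of the convex case, with the same
   cell slopes. *)
have cells' k y : (k < size A)%N -> 0 <= y <= eps ->
    - g (- (- ul + k%:R * eps + y)) = - g (- (- ul + k%:R * eps)) + c (nth 0%N A k) * y.
  move=> kA yeps; have := cells k y kA yeps; rewrite !mulN1r => e.
  rewrite !opprD !opprK; rewrite opprD addrA in e; rewrite e; ring.
have envE (u : R) : concave_env (ul + (size A)%:R * (-1 * eps)) ul g u
    = - convex_env (- ul) (- ul + (size A)%:R * eps) (fun w => - g (- w)) (- u).
  by rewrite concave_env_reflect; congr (- convex_env _ _ _ _); ring.
rewrite mulN1r; case: phi => pt px pl pr ps; rewrite /riemann_front /=.
rewrite !mulN1r in envE *.
split=> [[-> -> [[lt _]|[_ pmax]]]|].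
- by move: lt; rewrite ltNge mulrN gerDl oppr_le0 ltW.
- have := maximal_affine_reflect pmax.
  have -> : (fun u => - concave_env (ul + (size A)%:R * (- eps)) ul g (- u))
      = convex_env (- ul) (- ul + (size A)%:R * eps) (fun w => - g (- w)).
    by apply/funext => u; rewrite envE !opprK.
  have -> : - (ul + (size A)%:R * (- eps)) = - ul + (size A)%:R * eps by ring.
  move=> /(maximal_groupP eps0 A0 sA rg cells')[ o1 [W [ o2 [e1 e2 e3 ->]]]].
  exists o1, W, o2; split=> //; congr Wavefront.
    by rewrite -[pl]opprK e2; ring.
  by rewrite -[pr]opprK e3; ring.
- move=> [ o1 [W [ o2 [e1 [-> -> -> -> ->]]]]]; split=> //; right; split.
    by rewrite mulrN gtrDl oppr_lt0.
  have := maximal_affine_reflect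
    (maximal_group (h := fun w => - g (- w)) (a := - ul) eps0 A0 sA rg cells' e1).
  rewrite opprK.
  have -> : (fun u => - convex_env (- ul) (- ul + (size A)%:R * eps)
      (fun w => - g (- w)) (- u)) = concave_env (ul + (size A)%:R * (- eps)) ul g.
    by apply/funext => u; rewrite envE.
  by congr maximal_affine_piece; ring.
Qed.

End riemann.

Section speeds.
Context {R : realType}.
Implicit Types (g : R -> R) (A W : seq nat) (Os : seq (seq nat)).

Lemma derive1_affine g (p q s u : R) : affine_on g p q s -> p < u < q -> g^`() u = s.
Proof.
move=> aff /andP[pu uq]; rewrite derive1E.
rewrite (@near_eq_derive _ _ _ _ (fun w => g u + s * (w - u))); last first.
  have /near_in_itvoo uI : u \in `]p, q[%R by rewrite in_itv /= pu.
  near=> w.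
  have : w \in `]p, q[%R by near: w.
  rewrite in_itv /= => /andP[pw wq].
  by rewrite -aff ?(ltW pw) ?(ltW wq) ?(ltW pu) ?(ltW uq)//; ring.
have : is_derive u 1 (fun w => g u + s * (w - u)) s.
  by apply: is_derive_eq; rewrite /GRing.scale /=; ring.
by move=> ?; rewrite derive_val.
Unshelve. all: by end_near. Qed.

Variables (c : nat -> R) (eps : R).
Hypothesis eps0 : 0 < eps.

(** The point is the midpoint of the cell of the wave, where [wave_speed] takes the derivative; it
    is interior to the affine piece of [W]. *)
Lemma fan_env_speed g S ul ur A Os o1 W o2 k : fan c eps g S ul ur A Os ->
  Os = o1 ++ W :: o2 -> (k < size W)%N ->
  (fan_env S ul ur g)^`()
    (ul + S * ((size (flatten o1) + k)%:R * eps + eps / 2)) = mean c W.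
Proof.
move=> [hS A0 sA -> rg cells] OsE kW.
have N11 : (-1 == 1 :> R) = false by rewrite -subr_eq0 -opprD oppr_eq0 (pnatr_eq0 R 2).
have k1 : (k%:R + 1) * eps <= (size W)%:R * eps.
  by rewrite ler_wpM2r ?(ltW eps0)// natr1 ler_nat.
have k0 : 0 <= k%:R * eps by rewrite mulr_ge0 ?(ltW eps0).
have e0 := eps0.
case: hS cells => -> cells; rewrite /fan_env ?eqxx ?N11 natrD.
  have cells' j y : (j < size A)%N -> 0 <= y <= eps ->
      g (ul + j%:R * eps + y) = g (ul + j%:R * eps) + c (nth 0%N A j) * y.
    by move=> jA yeps; have := cells j y jA yeps; rewrite !mul1r addrA.
  have := env_affine eps0 A0 sA rg cells' OsE.
  by rewrite !mul1r => /derive1_affine; apply; apply/andP; split; lra.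
have cells' j y : (j < size A)%N -> 0 <= y <= eps ->
    - g (- (- ul + j%:R * eps + y)) = - g (- (- ul + j%:R * eps)) + c (nth 0%N A j) * y.
  move=> jA yeps; have := cells j y jA yeps; rewrite !mulN1r => e.
  rewrite !opprD !opprK; rewrite opprD addrA in e; rewrite e; ring.
have envE : concave_env (ul + (size A)%:R * (-1 * eps)) ul g
    = fun u => - convex_env (- ul) (- ul + (size A)%:R * eps) (fun w => - g (- w)) (- u).
  by apply/funext => u; rewrite concave_env_reflect; congr (- convex_env _ _ _ _); ring.
have := affine_reflect (env_affine (h := fun w => - g (- w)) (a := - ul) eps0 A0 sA rg cells' OsE).
rewrite -envE => /derive1_affine; apply; apply/andP; split; lra.
Qed.

Lemma group_fronts_sorted (t x l d : R) Os :
  sorted (fun L Q => mean c L < mean c Q) Os ->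
  sorted (fun phi psi => wf_speed phi < wf_speed psi) (group_fronts c t x l d Os).
Proof.
case: Os => //= W Os; elim: Os W l => //= V Os IH W l /andP[WV pV].
by rewrite WV; exact: IH.
Qed.

(** The outgoing fronts are prescribed only as a set; their strict order by speed determines the
    list. *)
Lemma riemann_out_eq g t x S ul ur A Os out : fan c eps g S ul ur A Os ->
  (forall chi, chi \in out <-> riemann_front g t x ul ur chi) ->
  sorted (fun phi psi => wf_speed phi < wf_speed psi) out ->
  out = group_fronts c t x ul (S * eps) Os.
Proof.
move=> hfan outP sout.
apply: (irr_sorted_eq (leT := fun phi psi : wavefront R => wf_speed phi < wf_speed psi)).
- by move=> ? ? ?; exact: lt_trans.
- by move=> ?; exact: ltxx.
- exact: sout.
- exact: group_fronts_sorted (rg_speed (fan_groups hfan)).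
- move=> chi; apply/idP/idP.
    by move=> /outP /(riemann_front_groups eps0 t x chi hfan).
  by move=> /(riemann_front_groups eps0 t x chi hfan) /outP.
Qed.

End speeds.

(** * The interpolated flux on the grid *)

Section grid.
Context {R : realType}.
Variables (eps : R) (f : R -> R).
Hypothesis eps0 : 0 < eps.
Let g := pw_affine_interp eps f.

Definition on_grid (x : R) := exists k : int, x = k%:~R * eps.

Lemma on_gridD x (S : R) (k : nat) : S = 1 \/ S = -1 -> on_grid x ->
  on_grid (x + S * (k%:R * eps)).
Proof.
move=> [] -> [m ->]; [exists (m + k%:Z)|exists (m - k%:Z)].
  by rewrite intrD mulrDl mul1r.
by rewrite intrB mulrBl mulN1r.
Qed.

Lemma interp_cell x y : on_grid x -> 0 <= y <= eps ->
  g (x + y) = g x + (g (x + eps) - g x) / eps * y.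
Proof.
move=> [m ->] /andP[y0]; rewrite le_eqVlt => /predU1P[->|y1].
  by rewrite mulfVK ?gt_eqF//; ring.
have xE : m%:~R * eps + eps = (m + 1)%:~R * eps by rewrite intrD mulrDl mul1r.
rewrite xE /g !pw_affine_interp_grid// /pw_affine_interp.
have -> : Num.floor ((m%:~R * eps + y) / eps) = m.
  apply: floor_def; rewrite ler_pdivlMr// ltr_pdivrMr// intrD mulrDl.
  by rewrite lerDl y0 ltrD2l mul1r.
by rewrite addrAC subrr add0r.
Qed.

Lemma fan_cell x (S d y : R) : S = 1 \/ S = -1 -> on_grid x -> 0 <= y <= eps ->
  d = S * (g (x + S * eps) - g x) / eps ->
  g (x + S * y) = g x + S * (d * y).
Proof.
move=> hS xg yeps ->; case: hS => ->; rewrite ?mulN1r ?mul1r.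
  exact: interp_cell.
have xg' : on_grid (x - eps).
  by have := @on_gridD x (-1) 1 (or_intror erefl) xg; rewrite mulN1r mul1r.
have yeps' : 0 <= eps - y <= eps.
  by case/andP: yeps => y0 y1; rewrite subr_ge0 y1 gerBl.
have := interp_cell xg' yeps'.
rewrite subrK => e; have -> : x - y = x - eps + (eps - y) by ring.
rewrite e; field; exact: lt0r_neq0.
Qed.

End grid.

(** The mean value theorem is applied to the increment [F] over one step and then to the first
    derivative. *)
Lemma second_difference (R : realType) (f : R -> R) (M x e : R) :
  (forall u, derivable f u 1) -> (forall u, derivable f^`() u 1) ->
  (forall u, `|f^`(2) u| <= M) -> 0 < e ->
  `|f (x + e) - f x - (f x - f (x - e))| <= M * e ^+ 2.
Proof.
move=> d1 d2 hM e0.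
have df (u : R) : is_derive u 1 f (f^`() u) by rewrite derive1E; exact: derivableP.
have ddf (u : R) : is_derive u 1 f^`() (f^`(2) u).
  by rewrite derive1nS derive1n1 derive1E; exact: derivableP.
pose F := fun u : R => f (u + e) - f u.
have dF (u : R) : is_derive u 1 F (derive1 f (u + e) - derive1 f u).
  have sh : is_derive u 1 (fun w : R => w + e) 1.
    by apply: is_derive_eq; rewrite addr0.
  have := @is_derive1_comp R f (fun w : R => w + e) u _ _ (df (u + e)) sh.
  by rewrite mulr1 => dsh; exact: is_deriveB.
have mvt (h dh : R -> R) (a b : R) : a < b -> (forall u : R, is_derive u 1 h (dh u)) ->
    exists z, h b - h a = dh z * (b - a).
  move=> ab hdh; have cont : {within `[a, b], continuous h}.
    by apply: derivable_within_continuous => u _; have [] := hdh u.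
  by have [z _ e1] := @MVT _ h dh a b ab (fun u _ => hdh u) cont; exists z.
have [z Fz] : exists z, F x - F (x - e) = (derive1 f (z + e) - derive1 f z) * (x - (x - e)).
  by apply: (mvt F (fun u => derive1 f (u + e) - derive1 f u)); rewrite ?gtrBl.
have [w fw] : exists w, derive1 f (z + e) - derive1 f z = derive1n 2 f w * (z + e - z).
  by apply: mvt; rewrite ?ltrDl.
have -> : f (x + e) - f x - (f x - f (x - e)) = derive1n 2 f w * e ^+ 2.
  have := Fz; rewrite fw /F subrK => ->; rewrite expr2; ring.
by rewrite normrM (ger0_norm (sqr_ge0 e)) ler_wpM2r ?sqr_ge0.
Qed.

(** * Runs of waves carried by fronts *)

Section runs.
Context {R : realType}.
Variables (eps : R) (f v0 : R -> R).
Hypothesis eps0 : 0 < eps.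
Let g := pw_affine_interp eps f.
Implicit Types (A W P Q : seq nat) (Os Ws : seq (seq nat)) (l S t x : R)
  (phi : wavefront R) (Fs : seq (wavefront R)).

Definition wave_slope (s : nat) : R :=
  wave_sign eps v0 s * (g (wave_state eps v0 s)
    - g (wave_state eps v0 s - wave_sign eps v0 s * eps)) / eps.

Let c := wave_slope.

(** The waves fill consecutive cells from the state [l] in the direction [S]; the index is [k.+1]
    because [wave_state] is the right state of a cell. *)
Definition run l S W := forall k, (k < size W)%N ->
  wave_sign eps v0 (nth 0%N W k) = S /\
  wave_state eps v0 (nth 0%N W k) = l + S * (k.+1%:R * eps).

Lemma run_cat l S P Q : run l S (P ++ Q) <->
  run l S P /\ run (l + (size P)%:R * (S * eps)) S Q.
Proof.
split=> [h|[hP hQ] k]; last first.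
  rewrite size_cat nth_cat => kPQ; case: ltnP => [kP|Pk]; first exact: hP.
  have [|-> ->] := hQ (k - size P)%N; first by rewrite ltn_subLR.
  by split=> //; rewrite -subSn// natrB; [ring|exact: leqW].
split=> k kk.
  have [|] := h k; first by rewrite size_cat ltn_addr.
  by rewrite nth_cat kk.
have [|] := h (size P + k)%N; first by rewrite size_cat ltn_add2l.
rewrite nth_cat ltnNge leq_addr /= addKn => -> ->; split=> //.
by rewrite -addnS natrD; ring.
Qed.

Lemma run_slope l S W k : S = 1 \/ S = -1 -> run l S W -> (k < size W)%N ->
  c (nth 0%N W k) = S * (g (l + S * (k%:R * eps) + S * eps)
    - g (l + S * (k%:R * eps))) / eps.
Proof.
move=> hS hr kW; have [e1 e2] := hr k kW; rewrite /c /wave_slope e1 e2.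
by congr (_ * (g _ - g _) / _); rewrite -natr1; ring.
Qed.

Lemma fan_of_run l S A Os : S = 1 \/ S = -1 -> on_grid eps l -> run l S A ->
  A != [::] -> sorted ltn A -> riemann_groups c A Os ->
  fan c eps g S l (l + (size A)%:R * (S * eps)) A Os.
Proof.
move=> hS gl hr A0 sA rg; split=> // k x kA xeps.
rewrite mulrDr addrA; apply: (fan_cell eps0 (f := f)) => //.
  exact: on_gridD.
exact: run_slope.
Qed.

(** Consecutive slopes differ by the second difference of [f] at the common grid point, divided by
    [eps]; on the grid the interpolated flux equals [f]. *)
Lemma lip_of_run M l S W : S = 1 \/ S = -1 -> on_grid eps l ->
  (forall x, on_grid eps x ->
    `|f (x + eps) - f x - (f x - f (x - eps))| <= M * eps ^+ 2) ->
  run l S W -> lip c (M * eps) W.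
Proof.
move=> hS gl hM hr; rewrite /lip; apply/(sortedP 0%N) => k kW.
rewrite !(run_slope hS hr)//; last exact: ltnW.
have gx (j : nat) : on_grid eps (l + S * (j%:R * eps)) by exact: on_gridD.
have gE x : on_grid eps x -> g x = f x.
  by move=> [m ->]; rewrite /g pw_affine_interp_grid.
have e1 (j : nat) : l + S * (j%:R * eps) + S * eps = l + S * (j.+1%:R * eps).
  by rewrite -natr1; ring.
rewrite !e1 !gE//.
have y0 : l + S * (k%:R * eps) = l + S * (k.+1%:R * eps) - S * eps.
  by rewrite -e1 addrK.
rewrite -(e1 k.+1) y0; have := hM _ (gx k.+1).
set y := l + S * (k.+1%:R * eps) => hy.
rewrite -!mulrA -mulrBr -mulrBl !normrM.
have -> : `|S| = 1 by case: hS => ->; rewrite ?normrN normr1.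
rewrite mul1r normfV (gtr0_norm eps0) ler_pdivrMr// -mulrA -expr2.
apply: le_trans hy; case: hS => ->; rewrite ?mulN1r ?mul1r ?opprK//.
rewrite le_eqVlt; apply/orP; left; apply/eqP.
by congr (`| _ |); ring.
Qed.

Definition front_run l phi W := [/\ wf_left phi = l, W != [::],
  exists S, [/\ S = 1 \/ S = -1, wf_right phi = l + (size W)%:R * (S * eps) & run l S W],
  wf_speed phi = mean c W & shock c W].

Fixpoint front_runs l Fs Ws : Prop :=
  match Fs, Ws with
  | [::], [::] => True
  | phi :: Fs', W :: Ws' => front_run l phi W /\ front_runs (wf_right phi) Fs' Ws'
  | _, _ => False
  end.

Definition end_state l Fs := last l [seq wf_right phi | phi <- Fs].

Lemma end_state_cat l F1 F2 : end_state l (F1 ++ F2) = end_state (end_state l F1) F2.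
Proof. by rewrite /end_state map_cat last_cat. Qed.

Lemma front_runs_catl l F1 F2 Ws : front_runs l (F1 ++ F2) Ws ->
  exists Ws1 Ws2, [/\ Ws = Ws1 ++ Ws2, front_runs l F1 Ws1 &
    front_runs (end_state l F1) F2 Ws2].
Proof.
elim: F1 l Ws => [|phi F1 IH] l Ws /=; first by exists [::], Ws.
case: Ws => // W Ws [h /IH[W1 [W2 [-> h1 h2]]]].
by exists (W :: W1), W2.
Qed.

Lemma front_runs_cat l F1 F2 Ws1 Ws2 : front_runs l F1 Ws1 ->
  front_runs (end_state l F1) F2 Ws2 -> front_runs l (F1 ++ F2) (Ws1 ++ Ws2).
Proof.
elim: F1 l Ws1 => [|phi F1 IH] l [|W Ws1] //= [h h1] h2; split=> //.
exact: IH.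
Qed.

Lemma front_runs_size l Fs Ws : front_runs l Fs Ws -> size Fs = size Ws.
Proof. by elim: Fs l Ws => [|phi Fs IH] l [|W Ws] //= [_ /IH->]. Qed.

Lemma front_runs_nonempty l Fs Ws : front_runs l Fs Ws -> [::] \notin Ws.
Proof.
elim: Fs l Ws => [|phi Fs IH] l [|W Ws] //= [[_ W0 _ _ _] /IH h].
by rewrite inE negb_or h eq_sym W0.
Qed.

Lemma run_sign l S W s : run l S W -> s \in W -> wave_sign eps v0 s = S.
Proof.
move=> hr sW; have [+ _] := hr _ (etrans (index_mem s W) sW).
by rewrite (nth_index 0%N sW).
Qed.

Lemma front_runs_mem l Fs Ws W : front_runs l Fs Ws -> W \in Ws ->
  exists l' S, run l' S W.
Proof.
elim: Fs l Ws => [|phi Fs IH] l [|V Ws] //= [h hs].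
rewrite inE => /predU1P[->|]; last exact: IH hs.
by case: h => _ _ [S [_ _ hr]] _ _; exists l, S.
Qed.

Lemma front_run_grid l phi W : on_grid eps l -> front_run l phi W ->
  on_grid eps (wf_right phi).
Proof.
move=> gl [_ _ [S [hS -> _]] _ _]; rewrite mulrCA; exact: on_gridD.
Qed.

Lemma end_state_grid l Fs Ws : on_grid eps l -> front_runs l Fs Ws ->
  on_grid eps (end_state l Fs).
Proof.
elim: Fs l Ws => [|phi Fs IH] l [|W Ws] //= gl [h hs].
by have := IH _ _ (front_run_grid gl h) hs.
Qed.

Lemma group_fronts_run t x l S Os : S = 1 \/ S = -1 -> run l S (flatten Os) ->
  [::] \notin Os -> (forall W, W \in Os -> shock c W) ->
  front_runs l (group_fronts c t x l (S * eps) Os) Os /\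
  end_state l (group_fronts c t x l (S * eps) Os) =
    l + (size (flatten Os))%:R * (S * eps).
Proof.
move=> hS; elim: Os l => [|W Os IH] l /=.
  by rewrite /end_state /= mul0r addr0.
move=> /run_cat[hW hOs]; rewrite inE negb_or => /andP[W0 ne] sh.
have [|h1 h2] := IH _ hOs ne; first by move=> V VO; apply: sh; rewrite inE VO orbT.
split; first split=> //.
  by split=> //; [rewrite eq_sym|exists S|apply: sh; rewrite inE eqxx].
by apply: (etrans h2); rewrite size_cat natrD; ring.
Qed.

Lemma riemann_groups_single W : W != [::] -> shock c W -> riemann_groups c W [:: W].
Proof.
move=> W0 sh; split=> //=; first by rewrite cats0.
  by rewrite inE eq_sym.
by move=> V; rewrite inE => /eqP->.
Qed.

End runs.

(** * One-sided values of a profile *)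

Section profiles.
Context {R : realType}.
Implicit Types (Fs P M Q : seq (wavefront R)) (t x : R).

Lemma profile_right P M Q t x : all (fun phi => wf_pos phi t < x) P ->
  all (fun phi => wf_pos phi t == x) M -> all (fun phi => x < wf_pos phi t) Q ->
  profile (P ++ M ++ Q) t x = end_state 0 (P ++ M).
Proof.
move=> hP hM hQ; rewrite /profile /end_state catA filter_cat.
have -> : [seq phi <- P ++ M | wf_pos phi t <= x] = P ++ M.
  apply/all_filterP; rewrite all_cat; apply/andP; split.
    by apply: sub_all hP => phi; exact: ltW.
  by apply: sub_all hM => phi /eqP->.
have -> : [seq phi <- Q | wf_pos phi t <= x] = [::].
  apply/eqP; rewrite -size_eq0 size_filter -leqn0 leqNgt -has_count.
  by rewrite -all_predC; apply: sub_all hQ => phi /=; rewrite -ltNge.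
by rewrite cats0.
Qed.

Lemma profile_left P Q t x : all (fun phi => wf_pos phi t < x) P ->
  all (fun phi => x <= wf_pos phi t) Q ->
  left_lim (profile (P ++ Q) t) x = end_state 0 P.
Proof.
move=> hP hQ; rewrite /left_lim.
(* Between [y0] and [x] there is no front, so the profile is constant there. *)
have [y0 [y0x hy0]] : exists y0, y0 < x /\ all (fun phi => wf_pos phi t <= y0) P.
  elim: P hP => [_|phi P IH /= /andP[h /IH[y0 [y0x hy0]]]].
    by exists (x - 1); split=> //; rewrite gtrBl.
  exists (Num.max y0 (wf_pos phi t)); split; first by rewrite gt_max y0x h.
  rewrite le_max lexx orbT /=; apply: sub_all hy0 => psi h'.
  by rewrite le_max h'.
apply: cvg_lim => //; apply: cvg_near_cst.
near=> y; rewrite /profile /end_state filter_cat.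
have yx : y < x by near: y; exact: nbhs_left_lt.
have y0y : y0 < y by near: y; exact: nbhs_left_gt.
have -> : [seq phi <- P | wf_pos phi t <= y] = P.
  by apply/all_filterP; apply: sub_all hy0 => phi h; exact: le_trans h (ltW y0y).
have -> : [seq phi <- Q | wf_pos phi t <= y] = [::].
  apply/eqP; rewrite -size_eq0 size_filter -leqn0 leqNgt -has_count.
  rewrite -all_predC; apply: sub_all hQ => phi /= h.
  by rewrite -ltNge (lt_le_trans yx).
by rewrite cats0.
Unshelve. all: by end_near. Qed.

End profiles.

(** * One collision *)

Lemma filter_take (P : seq nat) (p : pred nat) m :
  (forall k, (k < size P)%N -> p (nth 0%N P k) = (k < m)%N) ->
  [seq s <- P | p s] = take m P.
Proof.
elim: P m => [//|a P IH] m h /=.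
have := h 0%N isT; rewrite /= => ->; case: m h => [|m] h /=.
  by rewrite (IH 0%N) ?take0// => k kP; exact: (h k.+1).
by rewrite (IH m)// => k kP; exact: (h k.+1).
Qed.

Lemma filter_drop (P : seq nat) (p : pred nat) m :
  (forall k, (k < size P)%N -> p (nth 0%N P k) = (m <= k)%N) ->
  [seq s <- P | p s] = drop m P.
Proof.
elim: P m => [//|a P IH] m h /=.
have := h 0%N isT; rewrite /= => ->; case: m h => [|m] h /=.
  by rewrite (IH 0%N) ?drop0// => k kP; exact: (h k.+1).
by rewrite (IH m)// => k kP; exact: (h k.+1).
Qed.

Section all2.
Context {R : realType}.
Implicit Types (Fs : seq (wavefront R)) (Ws : seq (seq nat)).

Fixpoint all2P (P : wavefront R -> seq nat -> Prop) Fs Ws : Prop :=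
  match Fs, Ws with
  | phi :: Fs', W :: Ws' => P phi W /\ all2P P Fs' Ws'
  | [::], [::] => True
  | _, _ => False
  end.

Lemma all2P_cat P F1 F2 Ws1 Ws2 : size F1 = size Ws1 ->
  all2P P (F1 ++ F2) (Ws1 ++ Ws2) <-> all2P P F1 Ws1 /\ all2P P F2 Ws2.
Proof.
elim: F1 Ws1 => [|phi F1 IH] [|W Ws1] //= => [_|[/IH h]].
  by split=> // -[].
by split=> [[h1 /h[h2 h3]]|[[h1 h2] h3]]; split=> //; exact/h.
Qed.

Lemma all2P_mem P Fs Ws W : all2P P Fs Ws -> W \in Ws -> exists phi, P phi W.
Proof.
elim: Fs Ws => [|phi Fs IH] [|V Ws] //= [h hs].
by rewrite inE => /predU1P[->|]; [exists phi|exact: IH].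
Qed.

Lemma left_to_right_cat (t : R) F1 phi F2 : left_to_right t (F1 ++ phi :: F2) ->
  all (fun psi => wf_pos psi t < wf_pos phi t) F1 /\
  all (fun psi => wf_pos phi t < wf_pos psi t) F2.
Proof.
rewrite /left_to_right map_cat sorted_pairwise; last exact: lt_trans.
rewrite pairwise_cat allrel_consr => /and3P[/andP[h1 _] _ /andP[h2 _]].
by split; [rewrite all_map in h1|rewrite all_map in h2].
Qed.

End all2.

Section step.
Context {R : realType}.
Variables (f : R -> R) (eps : R) (v0 : R -> R) (J : nat) (tc xc : nat -> R)
  (F : nat -> seq (wavefront R)) (u : R -> R -> R) (X : R -> nat -> \bar R).
Hypothesis eps0 : 0 < eps.
Let g := pw_affine_interp eps f.
Hypothesis hu : wavefront_tracking g v0 J tc xc F u.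
Hypothesis hX : wave_positions eps g v0 J tc xc u X.
Let c := wave_slope eps f v0.
Let sgn := wave_sign eps v0.
Let st := wave_state eps v0.
Let sig := sigma eps g v0 u X.
Let n := nwaves eps v0.

Definition placed (t : R) (phi : wavefront R) (W : seq nat) := forall s, s \in W ->
  X t s = (wf_pos phi t)%:E /\ sig t s = (mean c W)%:E.

Definition stage j Ws := [/\ front_runs eps f v0 0 (F j) Ws,
  waves_at eps v0 X (tc j) = flatten Ws & all2P (placed (tc j)) (F j) Ws].

Lemma sigma_of_fan t y S ul ur A Os o1 W o2 k :
  left_lim (u t) y = ul -> u t y = ur -> fan c eps g S ul ur A Os ->
  Os = o1 ++ W :: o2 -> (k < size W)%N -> X t (nth 0%N W k) = y%:E ->
  sgn (nth 0%N W k) = S ->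
  st (nth 0%N W k) = ul + S * ((size (flatten o1) + k).+1%:R * eps) ->
  sig t (nth 0%N W k) = (mean c W)%:E.
Proof.
move=> hl hr hfan OsE kW XE sE stE; rewrite /sig /sigma /wave_speed XE hl hr.
have := fan_env_speed eps0 hfan OsE kW.
rewrite -/(sgn _) -/(st _) sE stE /fan_env => <-.
have N11 : (-1 == 1 :> R) = false by rewrite -subr_eq0 -opprD oppr_eq0 (pnatr_eq0 R 2).
by case: (fan_sign hfan) => ->; rewrite ?eqxx ?N11; congr (derive1 _ _)%:E;
  rewrite -natr1; field.
Qed.

(** A front away from the collision point is its own Riemann fan with a single group, so the speed
    of its waves, recomputed at each collision time, does not change. *)
Lemma placed_single t l phi W : left_lim (u t) (wf_pos phi t) = l ->
  u t (wf_pos phi t) = wf_right phi -> on_grid eps l -> sorted ltn W ->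
  front_run eps f v0 l phi W -> (forall s, s \in W -> X t s = (wf_pos phi t)%:E) ->
  placed t phi W.
Proof.
move=> hl hr gl sW [_ W0 [S [hS re hrun]] _ sh] XW s sWs; split; first exact: XW.
have hfan := fan_of_run eps0 hS gl hrun W0 sW (riemann_groups_single W0 sh).
rewrite -re in hfan.
have kW : (index s W < size W)%N by rewrite index_mem.
have [e1 e2] := hrun _ kW; rewrite nth_index// in e1 e2.
have := @sigma_of_fan t _ S l _ W [:: W] [::] W [::] (index s W) hl hr hfan erefl kW.
by rewrite nth_index//; apply=> //; exact: XW.
Qed.

Lemma waves_at_sorted t : sorted ltn (waves_at eps v0 X t).
Proof.
by apply: sorted_filter; [exact: ltn_trans|exact: iota_ltn_sorted].
Qed.

Lemma moved_wave j phi W s : (j < J)%N -> placed (tc j) phi W ->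
  wf_speed phi = mean c W -> s \in W -> s \in waves eps v0 ->
  X (tc j.+1) s =
    if (wf_pos phi (tc j.+1) == xc j.+1) &&
       ~~ wave_fits eps v0 (u (tc j.+1)) (xc j.+1) s
    then +oo%E else (wf_pos phi (tc j.+1))%:E.
Proof.
move=> jJ hp hs sW sw; rewrite (wave_pos_collision hX sw jJ).
have [Xs sigs] := hp _ sW.
have -> : (X (tc j) s + wave_speed eps v0 g (u (tc j)) (X (tc j) s) s
    * (tc j.+1 - tc j)%:E)%E = (wf_pos phi (tc j.+1))%:E.
  have -> : wave_speed eps v0 g (u (tc j)) (X (tc j) s) s = (wf_speed phi)%:E.
    by rewrite hs -sigs.
  by rewrite Xs -EFinM -EFinD; congr (_%:E); rewrite /wf_pos; ring.
by rewrite eqe.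
Qed.

Lemma removed_wave j s : (j < J)%N -> s \in waves eps v0 -> X (tc j) s = +oo%E ->
  X (tc j.+1) s = +oo%E.
Proof.
move=> jJ sw Xs; rewrite (wave_pos_collision hX sw jJ) Xs /=.
have tj : 0 < tc j.+1 - tc j by rewrite subr_gt0 (wft_tc_incr hu jJ).
by rewrite gt0_mulye ?lte_fin.
Qed.

(** The strict order before the collision, with equal positions at it, makes [phi] faster than
    [psi]. The strict order after it forces the outgoing fronts, all issued from one point, to be
    sorted by speed. *)
Lemma collision_geometry j : (j < J)%N -> let t := tc j.+1 in
  exists pre post out phi psi, [/\
    F j = pre ++ phi :: psi :: post, F j.+1 = pre ++ out ++ post,
    (forall chi, chi \in out <->
      riemann_front g t (xc j.+1) (wf_left phi) (wf_right psi) chi),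
    sorted (fun chi chi' => wf_speed chi < wf_speed chi') out &
    [/\ wf_pos phi t = xc j.+1, wf_pos psi t = xc j.+1,
      left_to_right t (pre ++ phi :: post), wf_speed psi < wf_speed phi &
      all (fun chi => wf_pos chi t == xc j.+1) out]].
Proof.
move=> jJ t; have [pre [post [out [phi [psi [Fj [p1 p2] ltr Fj1 outP]]]]]] :=
  wft_collision hu jJ.
have t01 : tc j < t by exact: (wft_tc_incr hu jJ).
exists pre, post, out, phi, psi; split=> //.
  have [t1 tt1 t12] : exists2 t1, t < t1 & ((j.+1 < J)%N -> t1 < tc j.+2).
    case: (ltnP j.+1 J) => [j1J|_]; last by exists (t + 1); rewrite ?ltrDl.
    have := wft_tc_incr hu j1J; rewrite -/t => tt2.
    by exists ((t + tc j.+2) / 2); [rewrite midf_lt|rewrite midf_lt].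
  have := wft_no_meeting hu jJ tt1 t12; rewrite Fj1 /left_to_right !map_cat.
  move=> /cat_sorted2[_] /cat_sorted2[+ _].
  rewrite sorted_map; apply: (@sub_in_sorted _ (mem out)); last by apply/allP.
  move=> chi chi' /outP[ct cx _] /outP[ct' cx' _] /=.
  by rewrite /wf_pos ct cx ct' cx' ltrD2l ltr_pM2r// subr_gt0.
split=> //.
- have tj : tc j < (tc j + t) / 2 < t by rewrite !midf_lt.
  have [h1 h2] := andP tj.
  have := wft_no_meeting hu (ltnW jJ) h1 (fun _ => h2).
  rewrite Fj => /left_to_right_cat[_ /andP[+ _]].
  set t' := (tc j + t) / 2 in h1 h2 *.
  have e chi : wf_pos chi t' = wf_pos chi t - wf_speed chi * (t - t').
    by rewrite /wf_pos; ring.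
  rewrite !e p1 p2 ltrD2l ltrN2 ltr_pM2r// subr_gt0//.
- apply/allP => chi /outP[ct cx _]; rewrite /wf_pos ct cx subrr mulr0 addr0.
  by rewrite eqxx.
Qed.

Lemma wave_fits_run t x l l' S ur W k : left_lim (u t) x = l -> u t x = ur ->
  S = 1 \/ S = -1 -> run eps v0 l' S W -> (k < size W)%N ->
  wave_fits eps v0 (u t) x (nth 0%N W k) =
    (S * l <= S * l' + k%:R * eps) && (S * l' + k.+1%:R * eps <= S * ur).
Proof.
move=> hl hr hS hrun kW; have [e1 e2] := hrun k kW.
rewrite /wave_fits e1 e2 hl hr.
have -> : S * (l' + S * (k.+1%:R * eps)) = S * l' + k.+1%:R * eps.
  by case: hS => ->; ring.
rewrite gerBl (ltW eps0) /=; congr (_ && _); congr (_ <= _).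
by rewrite -natr1; ring.
Qed.

(** Survival reduces to a comparison of counts: equal signs keep everything, opposite signs keep the
    initial part of a longer [L] or the final part of a longer [Q]. The one-sided values of [u] are
    premises of one clause only, because they are known only once the outgoing fan has been
    identified from [A]. *)
Lemma survivors t x l phi psi L Q : front_run eps f v0 l phi L ->
  front_run eps f v0 (wf_right phi) psi Q ->
  exists A S, [/\ S = 1 \/ S = -1, run eps v0 l S A,
    wf_right psi = l + (size A)%:R * (S * eps),
    (left_lim (u t) x = l -> u t x = wf_right psi ->
      [seq s <- L ++ Q | wave_fits eps v0 (u t) x s] = A) &
    [\/ sgn (head 0%N L) = sgn (head 0%N Q) /\ A = L ++ Q,
        sgn (head 0%N L) <> sgn (head 0%N Q) /\
          exists B, [/\ L = A ++ B, B != [::] & size B = size Q] |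
        sgn (head 0%N L) <> sgn (head 0%N Q) /\
          exists B, [/\ Q = B ++ A, B != [::] & size B = size L]]].
Proof.
move=> [_ L0 [SL [hSL rL runL]] _ _] [_ Q0 [SQ [hSQ rQ runQ]] _ _].
have sL0 : (0 < size L)%N by rewrite lt0n size_eq0.
have sQ0 : (0 < size Q)%N by rewrite lt0n size_eq0.
have hdL : sgn (head 0%N L) = SL by rewrite -nth0; have [] := runL _ sL0.
have hdQ : sgn (head 0%N Q) = SQ by rewrite -nth0; have [] := runQ _ sQ0.
have fitL k : left_lim (u t) x = l -> u t x = wf_right psi ->
    (k < size L)%N -> wave_fits eps v0 (u t) x (nth 0%N L k) =
    (k.+1%:R * eps <= (size L)%:R * eps + SL * SQ * (size Q)%:R * eps).
  move=> hl hr kL; rewrite (wave_fits_run hl hr hSL runL kL) lerDl mulr_ge0 ?(ltW eps0)//=.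
  rewrite rQ rL -subr_ge0 -[RHS]subr_ge0; congr (0 <= _).
  by case: hSL => ->; ring.
have fitQ k : left_lim (u t) x = l -> u t x = wf_right psi ->
    (k < size Q)%N -> wave_fits eps v0 (u t) x (nth 0%N Q k) =
    (0 <= SL * SQ * (size L)%:R * eps + k%:R * eps).
  move=> hl hr kQ; rewrite (wave_fits_run hl hr hSQ runQ kQ).
  have -> : SQ * wf_right phi + k.+1%:R * eps <= SQ * wf_right psi.
    rewrite rQ mulrDr lerD2l.
    have -> : SQ * ((size Q)%:R * (SQ * eps)) = (size Q)%:R * eps.
      by case: hSQ => ->; ring.
    by rewrite ler_pM2r// ler_nat.
  rewrite andbT rL -subr_ge0; congr (0 <= _); ring.
rewrite rL in runQ rQ; rewrite hdL hdQ.
have cS : SL = SQ \/ SL = - SQ.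
  by case: hSL => ->; case: hSQ => ->; rewrite ?opprK; [left|right|right|left].
have S2 : SQ * SQ = 1 by case: hSQ => ->; ring.
case: cS => [e|e].
  rewrite e in fitL fitQ rQ runQ runL *.
  exists (L ++ Q), SQ; split=> //.
  - exact/run_cat.
  - by rewrite rQ size_cat natrD; ring.
  - move=> hl hr; apply/all_filterP/allP => s; rewrite mem_cat => /orP[sL|sQ].
      rewrite -(nth_index 0%N sL) fitL ?index_mem//.
      rewrite S2 mul1r -mulrDl ler_pM2r// -natrD ler_nat.
      by rewrite (leq_trans _ (leq_addr _ _))// index_mem.
    rewrite -(nth_index 0%N sQ) fitQ ?index_mem//.
    by rewrite S2 mul1r addr_ge0// mulr_ge0// ltW.
  - by constructor 1.
have Ne : SL <> SQ.
  have h2 : (1 : R) <> -1 by apply/eqP; rewrite -subr_eq0 opprK (pnatr_eq0 R 2).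
  by rewrite e; case: hSQ => ->; rewrite ?opprK// => /esym.
have SLQ : SL * SQ = -1 by rewrite e mulNr S2.
have FL : left_lim (u t) x = l -> u t x = wf_right psi -> [seq s <- L | wave_fits eps v0 (u t) x s] = take (size L - size Q) L.
  move=> hl hr; apply: filter_take => k kL; rewrite fitL// SLQ mulN1r mulNr -mulrBl ler_pM2r//.
  by rewrite lerBrDr -natrD ler_nat ltn_subRL addnC addnS.
have FQ : left_lim (u t) x = l -> u t x = wf_right psi -> [seq s <- Q | wave_fits eps v0 (u t) x s] = drop (size L) Q.
  move=> hl hr; apply: filter_drop => k kQ; rewrite fitQ// SLQ mulN1r mulNr addrC subr_ge0 ler_pM2r//.
  by rewrite ler_nat.
(* Total annihilation, with equal sizes and [A] empty, falls under the first case. *)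
have [QL|LQ] := leqP (size Q) (size L).
- have dQ : drop (size L) Q = [::] by rewrite drop_oversize.
  have sA : size (take (size L - size Q) L) = (size L - size Q)%N.
    by rewrite size_takel// leq_subr.
  exists (take (size L - size Q) L), SL; split=> //.
  + by have := runL; rewrite -{1}(cat_take_drop (size L - size Q) L) => /run_cat[].
  + by rewrite rQ sA natrB// e; ring.
  + by move=> hl hr; rewrite filter_cat FL// FQ// dQ cats0.
  + constructor 2; split=> //; exists (drop (size L - size Q) L).
    rewrite cat_take_drop size_drop subKn//; split=> //.
    by rewrite -size_eq0 size_drop subKn// -lt0n.
- have tL : take (size L - size Q) L = [::].
    by apply/eqP; rewrite -size_eq0 size_take_min (eqP (ltnW LQ)) min0n.
  have sA : size (drop (size L) Q) = (size Q - size L)%N by rewrite size_drop.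
  exists (drop (size L) Q), SQ; split=> //.
  + have := runQ; rewrite -{1}(cat_take_drop (size L) Q) => /run_cat[_].
    rewrite size_takel ?(ltnW LQ)// e; congr run; ring.
  + by rewrite rQ sA natrB ?(ltnW LQ)// e; ring.
  + by move=> hl hr; rewrite filter_cat FL// FQ// tL.
  + constructor 3; split=> //; exists (take (size L) Q).
    rewrite cat_take_drop size_takel ?(ltnW LQ)//; split=> //.
    by rewrite -size_eq0 size_takel ?(ltnW LQ)// -lt0n.
Qed.

Lemma all2P_runs (P P' : wavefront R -> seq nat -> Prop) l Fs Ws :
  front_runs eps f v0 l Fs Ws -> all2P P Fs Ws ->
  (forall F1 phi F2 Ws1 W Ws2, Fs = F1 ++ phi :: F2 -> Ws = Ws1 ++ W :: Ws2 ->
    front_run eps f v0 (end_state l F1) phi W -> P phi W -> P' phi W) ->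
  all2P P' Fs Ws.
Proof.
elim: Fs l Ws => [|phi Fs IH] l [|W Ws] //= [h hs] [p ps] H; split.
  exact: (H [::] phi Fs [::] W Ws).
apply: (IH _ _ hs ps) => F1 psi F2 Ws1 V Ws2 e1 e2.
by apply: (H (phi :: F1) psi F2 (W :: Ws1) V Ws2); rewrite ?e1 ?e2.
Qed.

Lemma front_runs_all2P l Fs Ws : front_runs eps f v0 l Fs Ws ->
  all2P (fun _ _ => True) Fs Ws.
Proof. by elim: Fs l Ws => [|phi Fs IH] l [|W Ws] //= [_ /IH h]. Qed.

Lemma placed_fan t x l S A Os : S = 1 \/ S = -1 -> on_grid eps l ->
  run eps v0 l S A -> sorted ltn A -> riemann_groups c A Os ->
  left_lim (u t) x = l -> u t x = l + (size A)%:R * (S * eps) ->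
  (forall s, s \in A -> X t s = x%:E) ->
  all2P (placed t) (group_fronts c t x l (S * eps) Os) Os.
Proof.
move=> hS gl runA sA rg hl hr XA.
have [runOs _] : front_runs eps f v0 l (group_fronts c t x l (S * eps) Os) Os /\
    end_state l (group_fronts c t x l (S * eps) Os)
      = l + (size (flatten Os))%:R * (S * eps).
  apply: group_fronts_run => //.
  - by rewrite (rg_flatten rg).
  - exact: (rg_nonempty rg).
  - exact: (rg_shock rg).
apply: (all2P_runs runOs (front_runs_all2P runOs)) => F1 chi F2 Ws1 W Ws2 e1 e2 _ _ s sW.
have OsE : flatten Os = flatten Ws1 ++ W ++ flatten Ws2 by rewrite e2 flatten_cat.
have AE : A = flatten Ws1 ++ W ++ flatten Ws2 by rewrite -OsE (rg_flatten rg).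
have sAs : s \in A by rewrite AE !mem_cat sW orbT.
have A0 : A != [::] by case: (A) sAs.
have -> : wf_pos chi t = x.
  have : chi \in group_fronts c t x l (S * eps) Os.
    by rewrite e1 mem_cat inE eqxx orbT.
  move=> /mem_group_fronts[ o1 [V [ o2 [_ ->]]]].
  by rewrite /wf_pos /= subrr mulr0 addr0.
rewrite XA//; split=> //.
have hfan := fan_of_run eps0 hS gl runA A0 sA rg.
have kW : (index s W < size W)%N by rewrite index_mem.
have [|e3 e4] := runA (size (flatten Ws1) + index s W)%N.
  by rewrite AE !size_cat ltn_add2l ltn_addr.
rewrite AE nth_cat ltnNge leq_addr /= addKn nth_cat kW in e3 e4.
have := @sigma_of_fan t x S l _ A Os Ws1 W Ws2 (index s W) hl hr hfan e2 kW.
by rewrite nth_index// in e3 e4 *; apply => //; exact: XA.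
Qed.

Lemma sum_speed_change t t' (P : seq nat) (a b : R) :
  (forall s, s \in P -> sig t s = a%:E /\ sig t' s = b%:E) ->
  (\sum_(s <- P) `|sig t s - sig t' s| * eps%:E = (eps * (`|a - b| * (size P)%:R))%:E)%E.
Proof.
move=> h; rewrite big_seq (eq_bigr (fun _ => (`|a - b| * eps)%:E)); last first.
  by move=> s /h[-> ->].
rewrite -big_seq sumEFin; congr (_%:E).
rewrite big_const_seq count_predT iter_addr_0 -mulr_natr; ring.
Qed.

Lemma sum_groups_change t t' (Os : seq (seq nat)) (m : R) :
  (forall W s, W \in Os -> s \in W -> sig t s = (mean c W)%:E /\ sig t' s = m%:E) ->
  (\sum_(s <- flatten Os) `|sig t s - sig t' s| * eps%:E
   = (eps * \sum_(W <- Os) `|mean c W - m| * (size W)%:R)%:E)%E.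
Proof.
move=> h; rewrite big_flatten /= mulr_sumr -sumEFin !big_seq.
by apply: eq_bigr => W WO; apply: sum_speed_change => s; exact: h.
Qed.

Lemma stage_step M j Ws I Fl : 0 <= M ->
  (forall x, on_grid eps x ->
    `|f (x + eps) - f x - (f x - f (x - eps))| <= M * eps ^+ 2) ->
  (j < J)%N -> stage j Ws -> state_inv c sgn n Ws I Fl ->
  exists Ws' I' Fl', [/\ stage j.+1 Ws', state_inv c sgn n Ws' I' Fl' &
    (\sum_(s <- waves_at eps v0 X (tc j.+1))
        `|sig (tc j.+1) s - sig (tc j) s| * eps%:E
     <= (eps * (M * eps * potential n I Fl (size (flatten Ws))
                - M * eps * potential n I' Fl' (size (flatten Ws'))))%:E)%E].
Proof.
move=> M0 hM jJ [runs wat pl] inv.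
have [pre [post [out [phi [psi [Fj Fj1 outP sout [p1 p2 ltr sp outx]]]]]]] :=
  collision_geometry jJ.
set t := tc j.+1 in outP p1 p2 ltr outx *; set x := xc j.+1 in outP p1 p2 outx.
rewrite Fj in runs pl.
have [wpre [W2 [WsE runpre run2]]] := front_runs_catl runs.
case: W2 WsE run2 => [|L [|Q wpost]] WsE //=; first by case.
set l := end_state 0 pre => -[runL [runQ runpost]].
rewrite WsE in wat pl inv *.
have [plpre [plL [plQ plpost]]] : all2P (placed (tc j)) pre wpre /\
    (placed (tc j) phi L /\ (placed (tc j) psi Q /\ all2P (placed (tc j)) post wpost)).
  by move/(all2P_cat _ _ _ (front_runs_size runpre)): pl.
have g0 : on_grid eps (0 : R) by exists 0; rewrite mul0r.
have gl : on_grid eps l := end_state_grid g0 runpre.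
have s_al : sorted ltn (flatten (wpre ++ L :: Q :: wpost)) by rewrite -wat; exact: waves_at_sorted.
have alE : flatten (wpre ++ L :: Q :: wpost) =
    flatten wpre ++ (L ++ Q) ++ flatten wpost by rewrite flatten_cat /= -catA.
have inw s : s \in flatten (wpre ++ L :: Q :: wpost) -> s \in waves eps v0.
  by rewrite -wat mem_filter => /andP[].
have [sLQ sL sQ] : [/\ sorted ltn (L ++ Q), sorted ltn L & sorted ltn Q].
  move: s_al; rewrite alE => /sorted_catP[_ /sorted_catP[h _ _] _].
  by have [] := sorted_catP h.
have [prex postx] := left_to_right_cat ltr; rewrite p1 in prex postx.
have [A [S [hS runA rpsi fitsA kinds]]] := survivors t x runL runQ.
have sA : sorted ltn A.
  case: kinds => [[_ ->//]|[_ [B [e _ _]]]|[_ [B [e _ _]]]].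
    by move: sL; rewrite e => /sorted_catP[].
  by move: sQ; rewrite e => /sorted_catP[].
have [Os rg] := @riemann_groups_exist _ c A sA.
have lphi : wf_left phi = l by case: runL.
(* If [A] is empty the outer states coincide, so the Riemann problem emits no front and both lists
   are empty. *)
have outE : out = group_fronts c t x l (S * eps) Os.
  rewrite lphi in outP; have [A0|A0] := eqVneq A [::].
    have := rg_flatten rg; rewrite A0 => /(flatten_eq0 (rg_nonempty rg)) -> /=.
    case: (out) outP => // chi out' /(_ chi)[+ _].
    rewrite mem_head => /(_ isT)[_ _]; rewrite rpsi A0 /= mul0r addr0 ltxx.
    by case=> [[]|[]].
  have hfan := fan_of_run eps0 hS gl runA A0 sA rg; rewrite -rpsi in hfan.
  exact: (riemann_out_eq eps0 hfan outP sout).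
have [runOs endOs] : front_runs eps f v0 l out Os /\ end_state l out = wf_right psi.
  rewrite outE rpsi -(rg_flatten rg); apply: group_fronts_run => //.
  - by rewrite (rg_flatten rg).
  - exact: (rg_nonempty rg).
  - exact: (rg_shock rg).
have utE : u t = profile (F j.+1) t.
  apply/funext => y; apply: (wft_solution hu) => //.
  by move=> j1J; exact: (wft_tc_incr hu).
have outpostx : all (fun chi => x <= wf_pos chi t) (out ++ post).
  rewrite all_cat; apply/andP; split.
    by apply: sub_all outx => chi /eqP->.
  by apply: sub_all postx => chi /ltW.
have hl : left_lim (u t) x = l by rewrite utE Fj1 (profile_left prex outpostx).
have hr : u t x = wf_right psi.
  by rewrite utE Fj1 profile_right// end_state_cat.
have fitsE := fitsA hl hr.
have runpost' : front_runs eps f v0 (end_state l out) post wpost by rewrite endOs.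
have runs' : front_runs eps f v0 0 (F j.+1) (wpre ++ Os ++ wpost).
  by rewrite Fj1; apply: front_runs_cat => //; exact: front_runs_cat.
have spphi : wf_speed phi = mean c L by case: runL.
have sppsi : wf_speed psi = mean c Q by case: runQ.
have XLQ s : s \in L ++ Q -> X t s =
    if ~~ wave_fits eps v0 (u t) x s then +oo%E else x%:E.
  move=> sLs; have sw : s \in waves eps v0.
    by apply: inw; rewrite alE !mem_cat -mem_cat sLs orbT.
  move: sLs; rewrite mem_cat => /orP[sLs|sQs].
    by rewrite (moved_wave jJ plL spphi sLs sw) -/t -/x p1 eqxx.
  by rewrite (moved_wave jJ plQ sppsi sQs sw) -/t -/x p2 eqxx.
have plpre' : all2P (placed t) pre wpre.
  apply: (all2P_runs runpre plpre) => F1 chi F2 Ws1 W Ws2 e1 e2 rchi pchi.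
  have chix : wf_pos chi t < x.
    by move/allP: prex; apply; rewrite e1 mem_cat inE eqxx orbT.
  have Wal s : s \in W -> s \in flatten wpre.
    by move=> sW; rewrite e2 flatten_mid !mem_cat sW orbT.
  have [c1 c2] : all (fun chi' => wf_pos chi' t < wf_pos chi t) F1 /\
      all (fun chi' => wf_pos chi t < wf_pos chi' t) (F2 ++ out ++ post).
    move: ltr; rewrite e1 -catA cat_cons => /left_to_right_cat[h1 h2]; split=> //.
    move: h2; rewrite all_cat => /andP[h2 _]; rewrite all_cat h2 /=.
    by apply: sub_all outpostx => chi' /=; exact: lt_le_trans.
  apply: (@placed_single t (end_state 0 F1)) => //.
  - rewrite utE Fj1 e1 -catA profile_left//=.
    by rewrite lexx; apply: sub_all c2 => chi' /ltW.
  - rewrite utE Fj1 e1 -catA -[chi :: F2]/([:: chi] ++ F2) -catA profile_right//=.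
      by rewrite end_state_cat.
    by rewrite eqxx.
  - move: runs; rewrite e1 -catA => /front_runs_catl[? [? [_ h _]]].
    exact: end_state_grid h.
  - by move: s_al; rewrite alE e2 flatten_mid => /sorted_catP[/sorted_catP[_ /sorted_catP[]]].
  - move=> s sW; have spE : wf_speed chi = mean c W by case: rchi.
    rewrite (moved_wave jJ pchi spE sW); last by apply: inw; rewrite alE mem_cat Wal.
    by rewrite -/t -/x (lt_eqF chix).
have plpost' : all2P (placed t) post wpost.
  apply: (all2P_runs runpost plpost) => F1 chi F2 Ws1 W Ws2 e1 e2 rchi pchi.
  have chix : x < wf_pos chi t.
    by move/allP: postx; apply; rewrite e1 mem_cat inE eqxx orbT.
  have Wal s : s \in W -> s \in flatten wpost.
    by move=> sW; rewrite e2 flatten_mid !mem_cat sW orbT.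
  have [c1 c2] : all (fun chi' => wf_pos chi' t < wf_pos chi t) (pre ++ out ++ F1) /\
      all (fun chi' => wf_pos chi t < wf_pos chi' t) F2.
    move: ltr; rewrite e1 -cat_cons catA => /left_to_right_cat[h1 h2]; split=> //.
    move: h1; rewrite !all_cat /= => /andP[_ /andP[_ ->]]; rewrite andbT.
    apply/andP; split; first by apply: sub_all prex => chi' h; exact: lt_trans chix.
    by apply: sub_all outx => chi' /eqP->.
  have esE : end_state 0 (pre ++ out ++ F1) = end_state (wf_right psi) F1.
    by rewrite !end_state_cat -/l endOs.
  have FE : F j.+1 = (pre ++ out ++ F1) ++ chi :: F2 by rewrite Fj1 e1 -!catA.
  apply: (@placed_single t (end_state (wf_right psi) F1)) => //.
  - rewrite utE FE profile_left//=.
    by rewrite lexx; apply: sub_all c2 => chi' /ltW.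
  - rewrite utE FE -[chi :: F2]/([:: chi] ++ F2) profile_right//=.
      by rewrite end_state_cat.
    by rewrite eqxx.
  - have gpsi : on_grid eps (wf_right psi).
      by rewrite rpsi mulrCA; exact: on_gridD.
    by move: runpost; rewrite e1 => /front_runs_catl[? [? [_ h _]]]; exact: end_state_grid h.
  - move: s_al; rewrite alE e2 flatten_mid catA => /sorted_catP[_ h _].
    by have [_ /sorted_catP[]] := sorted_catP h.
  - move=> s sW; have spE : wf_speed chi = mean c W by case: rchi.
    rewrite (moved_wave jJ pchi spE sW); last by apply: inw; rewrite alE !mem_cat Wal ?orbT.
    by rewrite -/t -/x (gt_eqF chix).
have OsA W s : W \in Os -> s \in W -> s \in A.
  by move=> WO sW; rewrite -(rg_flatten rg); exact: mem_flatten sW.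
have XA s : s \in A -> X t s = x%:E.
  by rewrite -fitsE mem_filter => /andP[h sLs]; rewrite XLQ// h.
have plout : all2P (placed t) out Os.
  by rewrite outE; apply: placed_fan rg hl _ _ => //; rewrite hr.
have sigA W s : W \in Os -> s \in W -> sig t s = (mean c W)%:E.
  by move=> WO sW; have [chi /(_ _ sW)[]] := all2P_mem plout WO.
have plall : all2P (placed t) (F j.+1) (wpre ++ Os ++ wpost).
  rewrite Fj1; apply/(all2P_cat _ _ _ (front_runs_size runpre)); split=> //.
  by apply/(all2P_cat _ _ _ (front_runs_size runOs)).
have finX Fs Ws' s : all2P (placed t) Fs Ws' -> s \in flatten Ws' -> (X t s < +oo)%E.
  move=> h /flattenP[W WW sW]; have [chi hchi] := all2P_mem h WW.
  by have [-> _] := hchi _ sW; rewrite ltry.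
have flE : flatten (wpre ++ Os ++ wpost) = flatten wpre ++ A ++ flatten wpost.
  by rewrite !flatten_cat (rg_flatten rg).
have watE : waves_at eps v0 X t = flatten (wpre ++ Os ++ wpost).
  have -> : waves_at eps v0 X t = [seq s <- waves_at eps v0 X (tc j) | (X t s < +oo)%E].
    rewrite /waves_at -filter_predI; apply: eq_in_filter => s sw /=.
    apply/esym/andb_idr; rewrite !ltey; apply: contraNneq => Xs.
    by rewrite (removed_wave jJ sw Xs).
  rewrite wat alE flE !filter_cat; congr (_ ++ _).
    by apply/all_filterP/allP => s; exact: finX plpre'.
  congr (_ ++ _); last by apply/all_filterP/allP => s; exact: finX plpost'.
  rewrite -filter_cat -[RHS]fitsE; apply: eq_in_filter => s sLs.
  by rewrite XLQ//; case: (wave_fits _ _ _ _ _); rewrite /= ?ltxx ?ltry.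
have hstage : stage j.+1 (wpre ++ Os ++ wpost) by split.
have zero Fs Fs' Ws' : all2P (placed (tc j)) Fs Ws' -> all2P (placed t) Fs' Ws' ->
    (\sum_(s <- flatten Ws') `|sig t s - sig (tc j) s| * eps%:E = 0)%E.
  move=> h h'; rewrite big_seq big1// => s /flattenP[W WW sW].
  have [chi hchi] := all2P_mem h WW; have [chi' hchi'] := all2P_mem h' WW.
  have [_ ->] := hchi _ sW; have [_ ->] := hchi' _ sW.
  by rewrite -EFinB subrr /= normr0 mul0e.
have costE : (\sum_(s <- waves_at eps v0 X t) `|sig t s - sig (tc j) s| * eps%:E
    = \sum_(s <- A) `|sig t s - sig (tc j) s| * eps%:E)%E.
  rewrite watE flE !big_cat /= (zero _ _ _ plpre plpre') (zero _ _ _ plpost plpost').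
  by rewrite add0e adde0.
have oldL s : s \in L -> sig (tc j) s = (mean c L)%:E by move=> /plL[].
have oldQ s : s \in Q -> sig (tc j) s = (mean c Q)%:E by move=> /plQ[].
have K0 : 0 <= M * eps by rewrite mulr_ge0// ltW.
have L0 : L != [::] by case: runL.
have Q0 : Q != [::] by case: runQ.
have shL : shock c L by case: runL.
have shQ : shock c Q by case: runQ.
have fin (a b k : R) : a + b <= k -> ((eps * a)%:E <= (eps * (k - b))%:E)%E.
  by move=> h; rewrite lee_fin ler_pM2l// lerBrDr.
exists (wpre ++ Os ++ wpost); rewrite costE.
case: kinds => [[sgLQ AE]|[sgLQ [B [LE B0 BQ]]]|[sgLQ [B [QE B0 BL]]]].
- have QL : mean c Q < mean c L by rewrite -spphi -sppsi.
  have LQ0 : L ++ Q != [::] by case: (L) L0.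
  (* The merged list of two approaching shocks is a shock, so its fan is a single front. *)
  have OsE : Os = [:: L ++ Q].
    rewrite -AE; apply: (riemann_groups_shock _ _ _ rg); rewrite AE//.
    exact: shock_cat (ltW QL).
  have liA : lip c (M * eps) (L ++ Q) by rewrite -AE; exact: lip_of_run runA.
  have [I' [Fl' [inv' cost]]] := merge_step inv K0 liA QL sgLQ.
  exists I', Fl'; rewrite OsE in hstage sigA *; split=> //.
  have sigLQ s : s \in L ++ Q -> sig t s = (mean c (L ++ Q))%:E.
    by move=> sLs; apply: sigA sLs; rewrite inE.
  rewrite AE big_cat /=.
  rewrite (@sum_speed_change t (tc j) L (mean c (L ++ Q)) (mean c L)); last first.
    by move=> s sLs; split; [apply: sigLQ; rewrite mem_cat sLs|exact: oldL].
  rewrite (@sum_speed_change t (tc j) Q (mean c (L ++ Q)) (mean c Q)); last first.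
    by move=> s sQs; split; [apply: sigLQ; rewrite mem_cat sQs orbT|exact: oldQ].
  rewrite -EFinD -mulrDr; apply: fin; apply: le_trans cost.
  by rewrite alE flatten_cat /= -catA.
- have liL : lip c (M * eps) L.
    by case: runL => _ _ [SL [hSL _ rL]] _ _; exact: lip_of_run rL.
  have [I' [Fl' [inv' cost]]] := cut_right_step inv K0 LE B0 BQ sgLQ shL liL rg.
  exists I', Fl'; split=> //.
  rewrite -(rg_flatten rg) (@sum_groups_change t (tc j) Os (mean c L)); first exact: fin.
  move=> W s WO sW; split; first exact: sigA WO sW.
  by apply: oldL; rewrite LE mem_cat (OsA W).
- have liQ : lip c (M * eps) Q.
    case: runQ => _ _ [SQ [hSQ _ rQ]] _ _; apply: lip_of_run rQ => //.
    by apply: front_run_grid runL.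
  have [I' [Fl' [inv' cost]]] := cut_left_step inv K0 QE B0 BL sgLQ shQ liQ rg.
  exists I', Fl'; split=> //.
  rewrite -(rg_flatten rg) (@sum_groups_change t (tc j) Os (mean c Q)); first exact: fin.
  move=> W s WO sW; split; first exact: sigA WO sW.
  by apply: oldQ; rewrite QE mem_cat (OsA W) ?orbT.
Qed.

End step.

(** * The initial datum *)

Section step_function.
Context {R : realType}.
Implicit Types (v : R -> R) (D : seq R) (x y z p q : R).

Lemma gap_left (s : seq R) x p : x < p ->
  exists y, [/\ x <= y, y < p & forall q, q \in s -> ~~ (y < q < p)].
Proof.
move=> xp; elim: s => [|q s [y [xy yp h]]]; first by exists x.
have [/andP[yq qp]|nq] := boolP (y < q < p).
  exists q; split=> //; first exact: le_trans (ltW yq).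
  move=> r; rewrite inE => /predU1P[->|rs]; first by rewrite ltxx.
  apply: contraNN (h _ rs) => /andP[qr rp].
  by rewrite (lt_trans yq qr) rp.
exists y; split=> // r; rewrite inE => /predU1P[->//|]; exact: h.
Qed.

Lemma left_lim_eq v p y w : y < p -> (forall z, y < z -> z < p -> v z = w) ->
  left_lim v p = w.
Proof.
move=> yp h; rewrite /left_lim; apply: cvg_lim => //; apply: cvg_near_cst.
near=> z; apply: h; near: z; [exact: nbhs_left_gt|exact: nbhs_left_lt].
Unshelve. all: by end_near. Qed.

Definition jumps_at v D := [/\ sorted <%R D,
  forall x y, x <= y -> (forall p, p \in D -> ~~ (x < p <= y)) -> v x = v y,
  forall p, p \in D -> v p != left_lim v p &
  forall p, p \notin D -> v p = left_lim v p].

(** The points given by [piecewise_constant] may include spurious ones; only the true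
    discontinuities are kept, and constancy across the others follows by induction on their
    number. *)
Lemma jumps_exist v : right_continuous v -> piecewise_constant v ->
  exists D, jumps_at v D.
Proof.
move=> rc [d hd].
have base x y : x <= y -> (forall p, p \in d -> ~~ (x < p <= y)) -> v x = v y.
  rewrite le_eqVlt => /predU1P[->//|xy] h.
  have h' z : x < z -> z <= y -> v z = v y.
    move=> xz zy; apply: hd => // p pd; have := h p pd.
    rewrite negb_and -leNgt -ltNge => /orP[px|]; last by right.
    by left; exact: le_lt_trans xz.
  apply/esym; have := rc x; apply: cvg_unique => //.
  apply: cvg_near_cst; near=> z; apply: h'; near: z; [exact: nbhs_right_gt|exact: nbhs_right_le].
have lim p y : y < p -> (forall q, q \in d -> ~~ (y < q < p)) -> left_lim v p = v y.
  move=> yp h; apply: (left_lim_eq yp) => z yz zp; apply/esym/base; first exact: ltW.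
  move=> q qd; apply: contraNN (h q qd) => /andP[yq qz].
  by rewrite yq (le_lt_trans qz).
exists (sort <=%R (undup [seq p <- d | v p != left_lim v p])).
set D := sort _ _.
have memD p : (p \in D) = (p \in d) && (v p != left_lim v p).
  by rewrite mem_sort mem_undup mem_filter andbC.
have inD p : v p != left_lim v p -> p \in D.
  move=> vp; rewrite memD vp andbT; apply: contraNT vp => pd.
  have [y [_ yp h]] := @gap_left d (p - 1) p (ltac:(by rewrite gtrBl)).
  rewrite (lim p y yp h); apply/eqP/esym/base; first exact: ltW.
  move=> q qd; apply: contraNN (h q qd) => /andP[yq].
  rewrite le_eqVlt => /predU1P[qp|qp]; last by rewrite yq.
  by move: pd; rewrite -qp qd.
split.
- by rewrite sort_lt_sorted undup_uniq.
- move=> x y; have [m] := ubnP (size [seq p <- d | x < p <= y]).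
  elim: m y => // m IH y; rewrite ltnS => sz xy h.
  have [|] := boolP (has (fun p => x < p <= y) d); last first.
    by move=> /hasPn hn; exact: base.
  (* [p] is the last listed point in the interval. It is no jump, so [v p] is its left limit, and
     the interval may be shortened to end just before it. *)
  move=> hs; have [p [pd /andP[xp py] pmax]] : exists p, [/\ p \in d, x < p <= y &
      forall q, q \in d -> ~~ (p < q <= y)].
    move: hs; elim: (d) => //= a s IHs.
    have [/hasP|/hasPn hn] := boolP (has (fun p => x < p <= y) s).
      move=> hs _; have [p [ps pxy pm]] := IHs (introT hasP hs).
      have [/andP[pa ay]|na] := boolP (p < a <= y).
        exists a; rewrite inE eqxx; split=> //.
          by rewrite ay (lt_trans _ pa)//; case/andP: pxy.
        move=> q; rewrite inE => /predU1P[->|qs]; first by rewrite ltxx.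
        apply: contraNN (pm _ qs) => /andP[aq ->].
        by rewrite (lt_trans pa aq).
      exists p; rewrite inE ps orbT; split=> // q; rewrite inE => /predU1P[->//|].
      exact: pm.
    rewrite orbF => axy; exists a; rewrite inE eqxx; split=> // q.
    rewrite inE => /predU1P[->|qs]; first by rewrite ltxx.
    apply: contraNN (hn _ qs) => /andP[aq ->].
    by rewrite (lt_trans _ aq)//; case/andP: axy.
  have -> : v y = v p by apply/esym/base.
  have vpE : v p = left_lim v p.
    apply/eqP/negPn/negP => /inD pD; have := h _ pD.
    by rewrite xp py.
  have [z [xz zp hz]] := @gap_left d x p xp.
  rewrite vpE (lim p z zp hz); apply: IH => //.
    apply: leq_trans sz; rewrite !size_filter.
    elim: (d) pd => //= a s IHs; rewrite inE => /predU1P[<-|/IHs lts].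
      rewrite xp py (leNgt p z) zp /= add0n add1n ltnS.
      apply: sub_count => q /= /andP[-> qz] /=.
      by rewrite (le_trans qz)// ltW// (lt_le_trans zp).
    rewrite -addnS leq_add//; case: (x < a) => //=.
    case: (leP a z) => // az; rewrite (le_trans az)// ltW// (lt_le_trans zp)//.
  move=> q qD; apply: contraNN (h q qD) => /andP[xq qz].
  by rewrite xq (le_trans qz)// ltW// (lt_le_trans zp).
- by move=> p; rewrite memD => /andP[].
- by move=> p pD; apply/eqP/negPn/negP => /inD; rewrite (negbTE pD).
Unshelve. all: by end_near. Qed.

Section jumps.
Variables (v : R -> R) (D : seq R).
Hypothesis hD : jumps_at v D.

Lemma jump_const x y : x <= y -> (forall p, p \in D -> ~~ (x < p <= y)) -> v x = v y.
Proof. by have [_ h _ _] := hD; exact: h. Qed.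

Lemma jump_left_lim y p : y < p -> (forall q, q \in D -> ~~ (y < q < p)) ->
  left_lim v p = v y.
Proof.
move=> yp h; apply: (left_lim_eq yp) => z yz zp; apply/esym/jump_const; first exact: ltW.
move=> q qd; apply: contraNN (h q qd) => /andP[yq qz].
by rewrite yq (le_lt_trans qz).
Qed.

Lemma total_variation_const a b : a <= b ->
  (forall p, p \in D -> ~~ (a < p <= b)) -> total_variation a b v = 0%E.
Proof.
move=> ab h; rewrite nondecreasing_total_variation//.
  by rewrite (jump_const ab h) subrr.
move=> x y; rewrite !in_itv /= => /andP[ax xb] /andP[ay yb] xy.
rewrite (@jump_const x y)// => p pD; apply: contraNN (h p pD) => /andP[xp py].
by rewrite (le_lt_trans ax xp) (le_trans py yb).
Qed.

Lemma total_variation_one a p : a < p -> (forall q, q \in D -> ~~ (a < q < p)) ->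
  total_variation a p v = (`|v p - left_lim v p|)%:E.
Proof.
move=> ap h; have ll := jump_left_lim ap h.
have cst x : a <= x -> x < p -> v x = v a.
  move=> ax xp; apply/esym/jump_const => // q qD.
  by apply: contraNN (h q qD) => /andP[-> qx] /=; exact: le_lt_trans xp.
rewrite ll.
have [vap|vpa] := leP (v a) (v p).
  rewrite nondecreasing_total_variation ?(ltW ap)// ?ger0_norm ?subr_ge0//.
  move=> x y; rewrite !in_itv /= => /andP[ax xp] /andP[ay yp] xy.
  have [xp'|px] := ltP x p; last first.
    have -> : x = y by apply/eqP; rewrite eq_le xy (le_trans yp px).
    by [].
  rewrite cst//; have [yp'|py] := ltP y p; first by rewrite cst.
  by have -> : y = p by apply/eqP; rewrite eq_le yp py.
rewrite -total_variationN nondecreasing_total_variation ?(ltW ap)//=.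
  by rewrite ltr0_norm ?subr_lt0// opprK opprB addrC.
move=> x y; rewrite !in_itv /= => /andP[ax xp] /andP[ay yp] xy.
rewrite lerN2; have [xp'|px] := ltP x p; last first.
  have -> : x = y by apply/eqP; rewrite eq_le xy (le_trans yp px).
  by [].
rewrite [leRHS]cst//; have [yp'|py] := ltP y p; first by rewrite cst.
have -> : y = p by apply/eqP; rewrite eq_le yp py.
exact: ltW.
Qed.

Lemma total_variation_jumps a b : a <= b -> total_variation a b v =
  (\sum_(p <- D | a < p <= b) `|v p - left_lim v p|)%:E.
Proof.
have [sD _ _ _] := hD.
(* Induction from the last jump [p] up to [b]: the interval splits at [p] and at a point [y] before
   it such that no jump lies strictly between [y] and [p]. *)
suff : forall P Q b, D = P ++ Q -> (forall q, q \in Q -> b < q) -> a <= b ->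
    total_variation a b v = (\sum_(p <- P | a < p <= b) `|v p - left_lim v p|)%:E.
  by move=> h ab; apply: (h D [::]); rewrite ?cats0.
move=> {b}; elim/last_ind => [|P p IH] Q b.
    move=> e hQ ab; rewrite big_nil total_variation_const// => p.
    by rewrite e => /hQ bp; rewrite negb_and -!leNgt -ltNge bp orbT.
  rewrite cat_rcons => e hQ ab; rewrite -cats1 big_cat big_cons big_nil /=.
  have PpQ : (forall q, q \in P -> q < p) /\ (forall q, q \in Q -> p < q).
    move: sD; rewrite e lt_sorted_pairwise pairwise_cat allrel_consr /=.
    move=> /and3P[/andP[/allP h _] _ /andP[/allP h' _]].
    by split=> q; [exact: h|exact: h'].
  have [Pp pQ] := PpQ.
  have [pb|bp] := leP p b; last first.
    rewrite andbF addr0; apply: (IH (p :: Q) b) => //.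
    by move=> q; rewrite inE => /predU1P[->//|/pQ]; exact: lt_trans.
  rewrite andbT; have [ap|pa] := ltP a p; last first.
    rewrite addr0 [in RHS]big_seq_cond big_pred0 => [|q]; last first.
      case qP: (q \in P) => //=; rewrite ltNge (le_trans (ltW (Pp _ qP)) pa)//.
    rewrite total_variation_const// => q.
    rewrite e mem_cat inE => /or3P[/Pp qp|/eqP->|/hQ bq].
    - by rewrite negb_and -leNgt (le_trans (ltW qp) pa).
    - by rewrite negb_and -leNgt pa.
    - by rewrite negb_and -!leNgt -ltNge bq orbT.
  have [y [ay yp hy]] := @gap_left D a p ap.
  rewrite (@total_variationD _ a b p v (ltW ap) pb).
  rewrite (@total_variationD _ a p y v ay (ltW yp)).
  rewrite (total_variation_one yp hy) (@total_variation_const p b pb) ?adde0; last first.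
    move=> q; rewrite e mem_cat inE => /or3P[/Pp qp|/eqP->|/hQ bq].
    - by rewrite negb_and -leNgt ltW.
    - by rewrite ltxx.
    - by rewrite negb_and -!leNgt -ltNge bq orbT.
  rewrite (IH (p :: Q) y)//; last first.
    by move=> q; rewrite inE => /predU1P[->//|/pQ]; exact: lt_trans.
  rewrite EFinD addr0; congr (_%:E + _)%E.
  rewrite big_seq_cond [RHS]big_seq_cond; apply: eq_bigl => q.
  case qP: (q \in P) => //=; congr (_ && _).
  have qp := Pp _ qP; rewrite (le_trans (ltW qp) pb).
  have : q \in D by rewrite e mem_cat qP.
  by move=> /hy; rewrite qp andbT -leNgt => ->.
Qed.

End jumps.

End step_function.

(** * Labels, positions and states of the initial waves *)

Section initial_waves.
Context {R : realType}.
Variables (eps : R) (v0 : R -> R) (D : seq R).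
Hypotheses (eps0 : 0 < eps) (hD : jumps_at v0 D)
  (hgrid : forall x, on_grid eps (v0 x)).

Definition jump_cells (p : R) : nat := Num.truncn (`|v0 p - left_lim v0 p| / eps).

Lemma left_lim_grid p : on_grid eps (left_lim v0 p).
Proof.
have [y [_ yp h]] := @gap_left _ D (p - 1) p (ltac:(by rewrite gtrBl)).
by rewrite (jump_left_lim hD yp h).
Qed.

Lemma jump_cellsE p : `|v0 p - left_lim v0 p| = (jump_cells p)%:R * eps.
Proof.
rewrite /jump_cells; have [k ->] := hgrid p; have [k' ->] := left_lim_grid p.
rewrite -mulrBl normrM (gtr0_norm eps0) mulfK ?gt_eqF// -intrB -intr_norm.
by rewrite -[`|k - k'|%R]abszE -pmulrn natrK.
Qed.

Lemma jump_cells_gt0 p : p \in D -> (0 < jump_cells p)%N.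
Proof.
move=> pD; have [_ _ /(_ p pD) vp _] := hD.
rewrite lt0n; apply: contraNneq vp => m0.
by have := jump_cellsE p; rewrite m0 mul0r => /eqP; rewrite normr_eq0 subr_eq0.
Qed.

Lemma sum_jumps (P : pred R) : \sum_(p <- D | P p) `|v0 p - left_lim v0 p|
  = (\sum_(p <- D | P p) jump_cells p)%:R * eps.
Proof.
rewrite natr_sum mulr_suml; apply: eq_bigr => p _; exact: jump_cellsE.
Qed.

Let below (x : R) : exists a, a <= x /\ forall p, p \in D -> a < p.
Proof.
elim: (D) => [|p s [a [ax h]]]; first by exists x.
exists (Num.min a (p - 1)); split; first by rewrite ge_min ax.
move=> q; rewrite inE => /predU1P[->|/h aq]; first by rewrite gt_min gtrBl ltr01 orbT.
by rewrite gt_min aq.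
Qed.

Let above (x : R) : exists b, x <= b /\ forall p, p \in D -> p <= b.
Proof.
elim: (D) => [|p s [b [xb h]]]; first by exists x.
exists (Num.max b p); split; first by rewrite le_max xb.
by move=> q; rewrite inE => /predU1P[->|/h qb]; rewrite le_max ?lexx ?orbT ?qb.
Qed.

Lemma wave_U_jumps x : wave_U v0 x = (\sum_(p <- D | p <= x) jump_cells p)%:R * eps.
Proof.
rewrite -sum_jumps /wave_U -[RHS]/(fine (_%:E)); congr fine; rewrite /tot_var_upto.
apply/eqP; rewrite eq_le; apply/andP; split.
  apply: ge_ereal_sup => _ [a ax ->].
  rewrite (total_variation_jumps hD ax) lee_fin.
  rewrite [leRHS](bigID (fun p => a < p)) /=.
  rewrite (eq_bigl (fun p => (p <= x) && (a < p))) => [|p]; last by rewrite andbC.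
  by rewrite lerDl sumr_ge0.
have [a [ax h]] := below x; apply: le_ereal_sup_tmp.
exists (total_variation a x v0); first by exists a.
rewrite (total_variation_jumps hD ax) lee_fin le_eqVlt; apply/orP; left; apply/eqP.
rewrite big_seq_cond [RHS]big_seq_cond; apply: eq_bigl => p.
by case pD: (p \in D) => //=; rewrite h.
Qed.

Lemma tot_var_jumps : tot_var v0 = ((\sum_(p <- D) jump_cells p)%:R * eps)%:E.
Proof.
rewrite -sum_jumps /tot_var; apply/eqP; rewrite eq_le; apply/andP; split.
  apply: ge_ereal_sup => _ [a [b [ab ->]]].
  rewrite (total_variation_jumps hD ab) lee_fin.
  rewrite [leRHS](bigID (fun p => a < p <= b)) /=.
  by rewrite lerDl sumr_ge0.
have [a [a0 ha]] := below 0; have [b [b0 hb]] := above 0.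
apply: le_ereal_sup_tmp; exists (total_variation a b v0).
  by exists a, b; split=> //; exact: le_trans b0.
rewrite (total_variation_jumps hD (le_trans a0 b0)) lee_fin.
rewrite le_eqVlt; apply/orP; left; apply/eqP.
rewrite big_seq [RHS]big_seq_cond; apply: eq_bigl => p.
by case pD: (p \in D) => //=; rewrite ha// hb.
Qed.

Lemma nwaves_jumps : nwaves eps v0 = (\sum_(p <- D) jump_cells p)%N.
Proof. by rewrite /nwaves tot_var_jumps /= mulfK ?gt_eqF// natrK. Qed.

Section one_jump.
Variables (D1 D2 : seq R) (p : R).
Hypothesis DE : D = D1 ++ p :: D2.
Let N := (\sum_(q <- D1) jump_cells q)%N.
Let S := Num.sg (v0 p - left_lim v0 p).

Let order : (forall q, q \in D1 -> q < p) /\ (forall q, q \in D2 -> p < q).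
Proof.
have [sD _ _ _] := hD.
move: sD; rewrite DE lt_sorted_pairwise pairwise_cat allrel_consr /=.
move=> /and3P[/andP[/allP h _] _ /andP[/allP h' _]].
by split=> q; [exact: h|exact: h'].
Qed.

Let pD : p \in D. Proof. by rewrite DE mem_cat inE eqxx orbT. Qed.

Lemma jump_sign : S = 1 \/ S = -1.
Proof.
have [_ _ /(_ p pD) vp _] := hD; rewrite /S.
have : v0 p - left_lim v0 p != 0 by rewrite subr_eq0.
by case: sgrP => //; [left|right].
Qed.

Lemma jump_right : v0 p = left_lim v0 p + (jump_cells p)%:R * (S * eps).
Proof.
rewrite mulrCA -jump_cellsE -[X in X = _](subrK (left_lim v0 p)) addrC; congr (_ + _).
by rewrite /S -numEsg.
Qed.

Let sum_lt x : x < p -> (\sum_(q <- D | (q <= x)%R) jump_cells q <= N)%N.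
Proof.
move=> xp; rewrite DE big_cat /= big_cons leNgt xp /=.
have -> : (\sum_(q <- D2 | (q <= x)%R) jump_cells q)%N = 0%N.
  rewrite big_seq_cond big_pred0// => q.
  case qD : (q \in D2) => //=; apply/negbTE; rewrite -ltNge.
  by apply: (lt_trans xp); case: order => _; apply.
by rewrite addn0 big_mkcond /= leq_sum// => q _; case: ifP.
Qed.

Let sum_ge x : p <= x -> (N + jump_cells p <= \sum_(q <- D | (q <= x)%R) jump_cells q)%N.
Proof.
move=> px; rewrite DE big_cat /= big_cons px /= addnA -[leqLHS]addn0 leq_add//.
rewrite leq_add2r /N big_seq [leqRHS]big_seq_cond.
rewrite [leqRHS](eq_bigl (fun q => q \in D1))// => q /=; apply: andb_idr => qD.
by apply: ltW; apply: lt_le_trans px; case: order => + _; apply.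
Qed.

(** At [p] the cumulative variation jumps over exactly the levels of these labels. *)
Lemma wave_x0_jump s : (N < s <= N + jump_cells p)%N -> wave_x0 eps v0 s = p.
Proof.
move=> /andP[Ns sN]; rewrite /wave_x0.
have -> : [set x | eps * s%:R <= wave_U v0 x] = `[p, +oo[%classic.
  apply/seteqP; split=> x /=; rewrite in_itv /= andbT wave_U_jumps mulrC ler_pM2r// ler_nat.
    by move=> h; rewrite leNgt; apply/negP => /sum_lt; rewrite leqNgt (leq_trans Ns h).
  by move=> /sum_ge; exact: leq_trans.
exact: inf_itv.
Qed.

Lemma wave_U_left : left_lim (wave_U v0) p = N%:R * eps.
Proof.
have [y [_ yp h]] := @gap_left _ D (p - 1) p (ltac:(by rewrite gtrBl)).
apply: (left_lim_eq yp) => z yz zp; rewrite wave_U_jumps; congr (_%:R * _).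
apply/eqP; rewrite eqn_leq sum_lt//= DE big_cat /= -[leqLHS]addn0 leq_add//.
rewrite /N big_seq [leqRHS]big_seq_cond.
rewrite [leqRHS](eq_bigl (fun q => q \in D1))// => q /=; apply: andb_idr => qD.
have [/(_ _ qD) qp _] := order.
have : q \in D by rewrite DE mem_cat qD.
by move=> /h; rewrite qp andbT -leNgt => qy; exact: le_trans (ltW yz).
Qed.

Lemma jump_run : run eps v0 (left_lim v0 p) S (iota N.+1 (jump_cells p)).
Proof.
move=> k; rewrite size_iota => km; rewrite nth_iota//.
have x0 : wave_x0 eps v0 (N.+1 + k) = p.
  by apply: wave_x0_jump; rewrite addSn ltnS leq_addr /= -addnS leq_add2l.
rewrite /wave_state /wave_sign x0 wave_U_left; split=> //.
congr (_ + _ * _); rewrite addSn -addnS natrD; ring.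
Qed.

End one_jump.

End initial_waves.

(** * The initial fronts and their waves *)

Section initial_stage.
Context {R : realType}.
Variables (f : R -> R) (eps : R) (v0 : R -> R) (J : nat) (tc xc : nat -> R)
  (F : nat -> seq (wavefront R)) (u : R -> R -> R) (X : R -> nat -> \bar R).
Hypothesis eps0 : 0 < eps.
Let g := pw_affine_interp eps f.
Hypothesis hu : wavefront_tracking g v0 J tc xc F u.
Hypothesis hX : wave_positions eps g v0 J tc xc u X.
Hypothesis hv0 : right_continuous v0.
Hypothesis pv0 : piecewise_constant v0.
Hypothesis cv0 : compact (closure [set x | v0 x != 0]).
Hypothesis gv0 : forall x, on_grid eps (v0 x).
Let c := wave_slope eps f v0.
Let sgn := wave_sign eps v0.
Let sig := sigma eps g v0 u X.
Let n := nwaves eps v0.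

(* The order of the fronts at times slightly larger than [0]. *)
Definition issued_before (phi psi : wavefront R) : bool :=
  (wf_origin phi < wf_origin psi) ||
  ((wf_origin phi == wf_origin psi) && (wf_speed phi < wf_speed psi)).

Lemma issued_before_trans : transitive issued_before.
Proof.
move=> psi phi chi; rewrite /issued_before.
move=> /orP[h1|/andP[/eqP e1 h1]] /orP[h2|/andP[/eqP e2 h2]].
- by rewrite (lt_trans h1 h2).
- by rewrite -e2 h1.
- by rewrite e1 h2.
- by rewrite e1 e2 eqxx (lt_trans h1 h2) orbT.
Qed.

Lemma issued_before_irr : irreflexive issued_before.
Proof. by move=> phi; rewrite /issued_before !ltxx andbF. Qed.

(** The strict order of the positions for all small positive times forces the origins into order,
    and at a common origin the speeds. *)
Lemma initial_order : sorted issued_before (F 0%N).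
Proof.
case FE : (F 0%N) => [//|phi0 F0]; rewrite -FE; apply/(sortedP phi0) => i iF.
set phi := nth phi0 (F 0%N) i; set psi := nth phi0 (F 0%N) i.+1.
have front0 chi : chi \in F 0%N -> wf_time chi = 0 by move=> /(wft_init hu)[].
have phi_in : phi \in F 0%N by rewrite mem_nth// ltnW.
have psi_in : psi \in F 0%N by rewrite mem_nth.
have [t1 t10 ltr] : exists2 t1, 0 < t1 & forall t, 0 < t -> t < t1 ->
    wf_origin phi + wf_speed phi * t < wf_origin psi + wf_speed psi * t.
  have [t1 t10 h] : exists2 t1, 0 < t1 & forall t, 0 < t -> t < t1 ->
      left_to_right t (F 0%N).
    have tc0 := wft_tc0 hu; case: (posnP J) => [J0|J0].
      exists 1 => // t t0 _; apply: (wft_no_meeting hu) => //; rewrite ?tc0//.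
      by rewrite J0.
    exists (tc 1%N); first by have := wft_tc_incr hu J0; rewrite tc0.
    by move=> t t0 tt; apply: (wft_no_meeting hu) => //; rewrite ?tc0.
  exists t1 => // t t0 tt1; have := h t t0 tt1; rewrite /left_to_right.
  move=> /(sortedP (wf_pos phi0 t)) /(_ i); rewrite size_map => /(_ iF).
  rewrite !(nth_map phi0)//; last exact: ltnW.
  by rewrite /wf_pos !front0// !subr0.
rewrite /issued_before; have [//|psi_phi|e] := ltgtP (wf_origin phi) (wf_origin psi).
  set d := wf_origin phi - wf_origin psi.
  have d0 : 0 < d by rewrite subr_gt0.
  set k := wf_speed psi - wf_speed phi.
  have k0 : 0 < `|k| + 1 by rewrite ltr_wpDl.
  (* By this time a difference of speed [k] cannot have made up the distance [d]; the added 1 keeps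
     the quotient meaningful for [k = 0]. *)
  set t := Num.min (t1 / 2) (d / (`|k| + 1)).
  have t0 : 0 < t by rewrite lt_min !divr_gt0.
  have tt1 : t < t1 by rewrite gt_min ltr_pdivrMr// ltr_pMr// ltr1n.
  have := ltr t t0 tt1.
  have : t * (`|k| + 1) <= d by rewrite -ler_pdivlMr// ge_min lexx orbT.
  have : k * t <= `|k| * t by rewrite ler_wpM2r ?(ltW t0)// ler_norm.
  rewrite /k /d; move: `|_| => K; lra.
have := ltr (t1 / 2); rewrite divr_gt0// => /(_ isT).
rewrite ltr_pdivrMr// ltr_pMr// ltr1n => /(_ isT).
by rewrite e ltrD2l ltr_pM2r// divr_gt0.
Qed.

Lemma vanishes_left (D : seq R) x : jumps_at v0 D ->
  (forall p, p \in D -> x < p) -> v0 x = 0.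
Proof.
move=> hD h; have [M [_ hM]] := compact_bounded cv0.
pose y := Num.min x (- (`|M| + 2)).
have yx : y <= x by rewrite ge_min lexx.
rewrite -(jump_const hD yx) => [|p pD]; last first.
  by rewrite negb_and -[X in _ || X]ltNge h ?orbT.
apply/eqP/negPn/negP => vy.
have := hM (`|M| + 1); rewrite (le_lt_trans (ler_norm M)) ?ltrDl// => /(_ isT y).
have cy : closure [set x | v0 x != 0] y by exact: subset_closure.
move=> /(_ cy) /=; rewrite leNgt => /negP; apply.
have y2 : y <= - (`|M| + 2) by rewrite ge_min lexx orbT.
rewrite ltNge; apply/negP => h1; have := ler_norm (- y); rewrite normrN.
have := h1; lra.
Qed.

(** Induction over the jumps from left to right: [D1] holds those already treated, which fixes the
    offset of the labels, and [l] is the state in front of the next one. *)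
Lemma initial_fans D1 D2 l : jumps_at v0 (D1 ++ D2) ->
  (forall p D2', D2 = p :: D2' -> left_lim v0 p = l) ->
  let N := (\sum_(q <- D1) jump_cells eps v0 q)%N in
  exists Fs Ws, [/\ front_runs eps f v0 l Fs Ws,
    flatten Ws = iota N.+1 (\sum_(q <- D2) jump_cells eps v0 q)%N,
    (forall phi, phi \in Fs <-> wf_origin phi \in D2 /\
      riemann_front g 0 (wf_origin phi) (left_lim v0 (wf_origin phi))
        (v0 (wf_origin phi)) phi),
    sorted issued_before Fs & all2P (placed f eps v0 u X 0) Fs Ws].
Proof.
elim: D2 D1 l => [|p D2 IH] D1 l hD hl N.
  exists [::], [::]; rewrite big_nil; split=> // phi; split=> //.
  by rewrite in_nil => -[].
have hD' : jumps_at v0 (rcons D1 p ++ D2) by rewrite cat_rcons.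
have lp := hl p D2 erefl.
have [sD _ _ _] := hD.
have pD2 q : q \in D2 -> p < q.
  move: sD => /cat_sorted2[_] /=; rewrite path_sortedE; last exact: lt_trans.
  by move=> /andP[/allP h _]; exact: h.
have [|Fs [Ws [runs flE memF sF plF]]] := IH (rcons D1 p) (v0 p) hD'.
  move=> q D2' D2E; apply: (jump_left_lim hD').
    by apply: pD2; rewrite D2E inE eqxx.
  move=> r; rewrite mem_cat mem_rcons inE => /orP[/predU1P[->|rD1]|rD2].
  - by rewrite ltxx.
  - have : r < p.
      move: sD; rewrite lt_sorted_pairwise pairwise_cat allrel_consr.
      by move=> /and3P[/andP[/allP h _] _ _]; exact: h.
    by move=> rp; rewrite (lt_gtF rp).
  - rewrite negb_and orbC; apply/orP; left; rewrite -leNgt.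
    move: hD'; rewrite D2E => -[sD' _ _ _].
    move: sD' => /cat_sorted2[_] /=; rewrite path_sortedE; last exact: lt_trans.
    move: rD2; rewrite D2E inE => /predU1P[->//|rD2'] /andP[/allP h _].
    by apply/ltW/h.
set S := Num.sg (v0 p - left_lim v0 p).
have hS := jump_sign hD erefl : S = 1 \/ S = -1.
have runA := jump_run eps0 hD gv0 erefl; rewrite -/N -/S lp in runA.
have vp := jump_right eps0 hD gv0 p; rewrite -/S lp in vp.
set A := iota N.+1 (jump_cells eps v0 p) in runA.
have sA : sorted ltn A by exact: iota_ltn_sorted.
have szA : size A = jump_cells eps v0 p by rewrite size_iota.
have A0 : A != [::].
  by rewrite -size_eq0 szA -lt0n (jump_cells_gt0 eps0 hD gv0)// mem_cat inE eqxx orbT.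
have gl : on_grid eps l by rewrite -lp; exact: left_lim_grid hD gv0 p.
have [Os rg] := riemann_groups_exist c sA.
have hfan := fan_of_run eps0 hS gl runA A0 sA rg.
rewrite szA -vp in hfan.
have [runOs endOs] : front_runs eps f v0 l (group_fronts c 0 p l (S * eps) Os) Os /\
    end_state l (group_fronts c 0 p l (S * eps) Os)
      = l + (size (flatten Os))%:R * (S * eps).
  apply: group_fronts_run => //.
  - by rewrite (rg_flatten rg).
  - exact: (rg_nonempty rg).
  - exact: (rg_shock rg).
rewrite (rg_flatten rg) szA -vp in endOs.
have u0 : u 0 = v0 by apply/funext => x; exact: (wft_solution0 hu).
have origin phi : phi \in group_fronts c 0 p l (S * eps) Os -> wf_origin phi = p.
  by move=> /(riemann_front_groups eps0 0 p phi hfan)[].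
have NS : (N.+1 + jump_cells eps v0 p = (\sum_(q <- rcons D1 p) jump_cells eps v0 q).+1)%N.
  by rewrite -cats1 big_cat /= big_seq1 addSn.
exists (group_fronts c 0 p l (S * eps) Os ++ Fs), (Os ++ Ws); split.
- by apply: front_runs_cat => //; rewrite endOs.
- by rewrite flatten_cat (rg_flatten rg) flE big_cons iotaD NS.
- move=> phi; rewrite mem_cat inE; split.
    move=> /orP[h|/memF[-> h]]; last by rewrite orbT.
    by rewrite (origin _ h) eqxx lp; split=> //; apply/(riemann_front_groups eps0 0 p phi hfan).
  move=> [/orP[/eqP e|h] hr].
    apply/orP; left; apply/(riemann_front_groups eps0 0 p phi hfan).
    by move: hr; rewrite e lp.
  by apply/orP; right; apply/memF.
- rewrite (sorted_pairwise issued_before_trans) pairwise_cat.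
  rewrite -!(sorted_pairwise issued_before_trans) sF andbT; apply/andP; split.
    apply/allrelP => phi psi /origin ephi /memF[psiD _].
    by rewrite /issued_before ephi pD2.
  have := group_fronts_sorted 0 p l (S * eps) (rg_speed rg).
  apply: (@sub_in_sorted _ (mem (group_fronts c 0 p l (S * eps) Os))); last exact/allP.
  move=> phi psi /origin ephi /origin epsi h.
  by rewrite /issued_before ephi epsi eqxx h orbT.
- apply/(all2P_cat _ _ _ (front_runs_size runOs)); split=> //.
  apply: (placed_fan eps0 hS gl runA sA rg); rewrite ?u0 ?szA//.
  move=> s sAs; have sw : s \in waves eps v0.
    move: sAs; rewrite /waves (nwaves_jumps eps0 hD gv0) !mem_iota.
    move=> /andP[h1 h2]; apply/andP; split; first exact: leq_trans h1.
    apply: (leq_trans h2); rewrite add1n addSn ltnS big_cat /= big_cons addnA.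
    exact: leq_addr.
  rewrite (wave_pos_init hX sw) (wave_x0_jump eps0 hD gv0 erefl)//.
  by move: sAs; rewrite mem_iota addSn ltnS.
Qed.

Lemma initial_stage : exists Ws, stage f eps v0 tc F u X 0 Ws /\
  flatten Ws = waves eps v0.
Proof.
have [D hD] := jumps_exist hv0 pv0.
have [|Fs [Ws [runs flE memF sF plF]]] := @initial_fans [::] D 0 hD.
  move=> p D' DE; have [y [_ yp h]] := @gap_left _ D (p - 1) p (ltac:(by rewrite gtrBl)).
  rewrite (jump_left_lim hD yp h); apply: vanishes_left (hD) _ => q qD.
  have pq : p <= q.
    have [sD _ _ _] := hD; move: qD sD; rewrite DE inE => /predU1P[->//|qD'] /=.
    by rewrite path_sortedE; [move=> /andP[/allP h' _]; exact/ltW/h'|exact: lt_trans].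
  exact: lt_le_trans pq.
have F0 : F 0%N = Fs.
  apply: (irr_sorted_eq issued_before_trans issued_before_irr initial_order sF) => phi.
  apply/idP/idP => [/(wft_init hu) h|/memF[_ h]]; last exact/(wft_init hu).
  apply/memF; split=> //.
  (* Away from the jumps both states agree, and such a Riemann problem has no front. *)
  have [_ _ _ hn] := hD; apply/negPn/negP => /hn e.
  by case: h => _ _; rewrite -e ltxx => -[[]|[]].
have flw : flatten Ws = waves eps v0.
  by rewrite flE big_nil /waves (nwaves_jumps eps0 hD gv0).
exists Ws; split=> //; rewrite /stage (wft_tc0 hu) F0; split=> //.
rewrite flw; apply/all_filterP/allP => s sw.
by rewrite (wave_pos_init hX sw) ltry.
Qed.

End initial_stage.

(** * The total change of speed *)

Lemma lebesgue_setT_gt0 (R : realType) :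
  (0 < (@lebesgue_measure R) [set: R])%E.
Proof.
apply: (@lt_le_trans _ _ ((@lebesgue_measure R) `[0%R, 1%R])).
  by rewrite lebesgue_measure_itv /= lte_fin ltr01 sube0 lte_fin.
by apply: le_measure; rewrite ?inE.
Qed.

(** A value above the essential supremum would persist on a ball, which has positive measure. This
    turns the norm of the statement into the pointwise bound used for second differences. *)
Lemma continuous_le_Linf (R : realType) (k : R -> R) (x : R) : continuous k ->
  (`|k x|%:E <= 'N[@lebesgue_measure R]_(+oo)[EFin \o k])%E.
Proof.
move=> kc; rewrite unlock lebesgue_setT_gt0 leNgt; apply/negP => lt.
set N := ess_sup _ _ in lt.
have /= [Z [mZ Z0 sub]] := ess_sup_ge (@lebesgue_measure R) (abse \o (EFin \o k)).
have : \forall y \near x, (N < `|k y|%:E)%E.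
  case: N lt {sub} => [r|//|_]; last by near=> y; rewrite ltNyr.
  rewrite lte_fin => rx.
  have : `|k y| @[y --> x] --> `|k x| by apply: cvg_norm; exact: kc.
  move=> /cvgr_gt /(_ _ rx); apply: filterS => y.
  by rewrite lte_fin.
move=> /nbhs_ballP[e /= e0 he].
have : (lebesgue_measure (ball x e) <= lebesgue_measure Z)%E.
  apply: le_measure; rewrite ?inE//; first by rewrite ball_itv; exact: measurable_itv.
  move=> y /he hy; apply: sub => /=; apply/negP; rewrite -ltNge; exact: hy.
rewrite Z0 lebesgue_measure_ball ?(ltW e0)// lee_fin leNgt.
by rewrite mulrn_wgt0.
Unshelve. all: by end_near. Qed.

Lemma Linf_le (R : realType) (k : R -> R) (M : R) : (forall x, `|k x| <= M) ->
  ('N[@lebesgue_measure R]_(+oo)[EFin \o k] <= M%:E)%E.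
Proof.
move=> h; rewrite unlock lebesgue_setT_gt0; apply/ess_supP.
by apply: aeW => x /=; rewrite lee_fin.
Qed.

Section total_change.
Context {R : realType}.
Variables (f : R -> R) (eps : R) (v0 : R -> R) (J : nat) (tc xc : nat -> R)
  (F : nat -> seq (wavefront R)) (u : R -> R -> R) (X : R -> nat -> \bar R).
Hypothesis eps0 : 0 < eps.
Let g := pw_affine_interp eps f.
Hypothesis hu : wavefront_tracking g v0 J tc xc F u.
Hypothesis hX : wave_positions eps g v0 J tc xc u X.
Let c := wave_slope eps f v0.
Let sgn := wave_sign eps v0.
Let sig := sigma eps g v0 u X.
Let n := nwaves eps v0.

Lemma total_change_from M Ws I Fl (k : nat) : 0 <= M ->
  (forall x, on_grid eps x ->
    `|f (x + eps) - f x - (f x - f (x - eps))| <= M * eps ^+ 2) ->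
  stage f eps v0 tc F u X 0 Ws -> state_inv c sgn n Ws I Fl -> (k <= J)%N ->
  exists Ws' I' Fl', [/\ stage f eps v0 tc F u X k Ws', state_inv c sgn n Ws' I' Fl' &
    (\sum_(1 <= j < k.+1) \sum_(s <- waves_at eps v0 X (tc j))
        `|sig (tc j) s - sig (tc j.-1) s| * eps%:E
     <= (eps * (M * eps * potential n I Fl (size (flatten Ws))
                - M * eps * potential n I' Fl' (size (flatten Ws'))))%:E)%E].
Proof.
move=> M0 hM st inv; elim: k => [_|k IH kJ].
  by exists Ws, I, Fl; split=> //; rewrite big_geq// subrr mulr0.
have [Ws1 [I1 [Fl1 [st1 inv1 h1]]]] := IH (ltnW kJ).
have [Ws2 [I2 [Fl2 [st2 inv2 h2]]]] := stage_step eps0 hu hX M0 hM kJ st1 inv1.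
exists Ws2, I2, Fl2; split=> //; rewrite big_nat_recr//=.
apply: (le_trans (leeD h1 h2)); rewrite -EFinD lee_fin -mulrDr.
by rewrite ler_wpM2l ?(ltW eps0)// addrA subrK.
Qed.

End total_change.

Theorem theorem2 (R : realType) (f ubar : R -> R)
    (hf : admissible_flux f)
    (hubar : (tot_var ubar < +oo)%E)
    (eps : R) (heps : 0 < eps)
    (v0 : R -> R) (hv0 : admissible_datum eps ubar v0)
    (J : nat) (tc xc : nat -> R) (F : nat -> seq (wavefront R)) (u : R -> R -> R)
    (hu : wavefront_tracking (pw_affine_interp eps f) v0 J tc xc F u)
    (X : R -> nat -> \bar R)
    (hX : wave_positions eps (pw_affine_interp eps f) v0 J tc xc u X) :
  let sig := sigma eps (pw_affine_interp eps f) v0 u X in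
  (\sum_(1 <= j < J.+1) \sum_(s <- waves_at eps v0 X (tc j))
      `|sig (tc j) s - sig (tc j.-1) s| * eps%:E
   <= (3 + 2 * ln 2)%:E * 'N[@lebesgue_measure R]_(+oo)[EFin \o f^`(2)]
      * tot_var ubar ^+ 2)%E.
Proof.
cbv zeta; have [df ddf cf _ [M' hM']] := hf.
have [rc pc cv gr tv] := hv0.
have Ninf x := continuous_le_Linf x cf.
set N := ('N[_]_(+oo)[_])%E in Ninf *.
have N0 : (0 <= N)%E by apply: le_trans (Ninf 0); rewrite lee_fin.
have Nfin : N \is a fin_num.
  by rewrite ge0_fin_numE// (le_lt_trans (Linf_le hM'))// ltry.
pose M := fine N.
have NE : N = M%:E by rewrite fineK.
have M0 : 0 <= M by rewrite -lee_fin -NE.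
have hM x : `|f^`(2) x| <= M by rewrite -lee_fin -NE.
have hM2 x : on_grid eps x ->
    `|f (x + eps) - f x - (f x - f (x - eps))| <= M * eps ^+ 2.
  by move=> _; exact: second_difference.
have [Ws [st0 wE]] := initial_stage heps hu hX rc pc cv gr.
have [D hD] := jumps_exist rc pc.
have tvE : tot_var v0 = ((nwaves eps v0)%:R * eps)%:E.
  by rewrite (tot_var_jumps heps hD gr) (nwaves_jumps heps hD gr).
have [runs wat _] := st0.
have inv : state_inv (wave_slope eps f v0) (wave_sign eps v0) (nwaves eps v0) Ws
    (same_front Ws) [::].
  apply: state_inv_initial.
  - by rewrite wE iota_ltn_sorted.
  - by rewrite wE.
  - exact: front_runs_nonempty runs.
  - move=> W s s' WW sW s'W; have [l [S hr]] := front_runs_mem runs WW.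
    by rewrite (run_sign hr sW) (run_sign hr s'W).
have [Ws' [I' [Fl' [_ _ h]]]] := total_change_from heps hu hX M0 hM2 st0 inv (leqnn J).
apply: (le_trans h); set n := nwaves eps v0 in tvE *.
have ubarfin : tot_var ubar \is a fin_num.
  by rewrite ge0_fin_numE//; apply: le_trans tv; rewrite tvE lee_fin mulr_ge0// ltW.
rewrite NE -(fineK ubarfin) -EFin_expe -!EFinM lee_fin.
set V := fine _.
have nV : n%:R * eps <= V by rewrite -lee_fin -tvE fineK.
have n0 : 0 <= n%:R * eps by rewrite mulr_ge0// ltW.
have ln20 : 0 <= ln 2 :> R by rewrite ln_ge0// ler1n.
have szn : size (flatten Ws) = n by rewrite wE size_iota.
have p1 := @potential_le R n (same_front Ws) (size (flatten Ws)) (eq_leq szn).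
have p2 := @potential_ge0 R n I' Fl' (size (flatten Ws')).
have eM : 0 <= eps * (M * eps) by rewrite !mulr_ge0// ltW.
(* The final potential is nonnegative and the initial one at most three times the square of n, while
   [n * eps] is the total variation of [v0]; the constant 3 is then enlarged by a multiple of
   [ln 2], which is nonnegative. *)
apply: (@le_trans _ _ (eps * (M * eps) * (3 * n%:R ^+ 2))).
  by rewrite -mulrBr [leLHS]mulrA ler_wpM2l//; move: p1 p2; lra.
have -> : eps * (M * eps) * (3 * n%:R ^+ 2) = 3 * M * (n%:R * eps) ^+ 2 by ring.
apply: ler_pM => //.
- by rewrite mulr_ge0.
- by rewrite sqr_ge0.
- by rewrite ler_wpM2r// lerDl mulr_ge0.
- by rewrite lerXn2r ?nnegrE// (le_trans n0).
Qed.
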